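(* Let $N\geq 1$ and let $f\in \mathbb{Q}\left[t_i,\frac{1}{t_i},\frac{1}{t_i-t_j}\ \middle|\ 1\leq i\leq N,\ 1\leq i<j\leq N\right]$. There exist real constants $A_i,B_i$ ($1\leq i\leq N$) and $\Gamma_{ij}$ ($1\leq i<j\leq N$), depending on $f$, such that the Selberg integral $$I(\alpha_i,\beta_i,\gamma_{ij})=\int\cdots\int_{0<t_1<\cdots<t_N<1} f\,\prod_{1\leq i\leq N} t_i^{\alpha_i}(1-t_i)^{\beta_i}\prod_{1\leq i<j\leq N}(t_j-t_i)^{\gamma_{ij}}\,dt_1\cdots dt_N$$ is a holomorphic function of the complex variables $(\alpha_i)_{1\le i\le N},(\beta_i)_{1\le i\le N},(\gamma_{ij})_{1\le i<j\le N}$ on the region $$\mathrm{Re}(\alpha_i)>A_i,\quad \mathrm{Re}(\beta_i)>B_i\quad(1\leq i\leq N),\qquad \mathrm{Re}(\gamma_{ij})>\Gamma_{ij}\quad (1\leq i<j\leq N),$$ and, at any integral point of this region (a point all of whose coordinates $\alpha_i,\beta_i,\gamma_{ij}$ are integers), all the coefficients of the Taylor expansion of $I(\alpha_i,\beta_i,\gamma_{ij})$ with respect to $\alpha_i,\beta_i,\gamma_{ij}$ are $\mathbb{Q}$-linear combinations of multiple zeta values.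
   Context: Multiple zeta values are the real numbers $$\zeta(k_1,\ldots,k_r)=\sum_{0<n_1<\cdots<n_r}\frac{1}{n_1^{k_1}\cdots n_r^{k_r}},\qquad r\geq 1,\ k_1,\ldots,k_{r-1}\geq 1,\ k_r\geq 2,$$ with $k_1,\ldots,k_r$ integers, together with the number $1$, which is regarded as a multiple zeta value (of weight $0$ and depth $0$). For a positive real number $x$ and $s\in\mathbb{C}$, $x^s=\exp(s\log x)$ with the real logarithm. The ring $\mathbb{Q}\left[t_i,\frac{1}{t_i},\frac{1}{t_i-t_j}\right]$ is the $\mathbb{Q}$-subalgebra of the rational function field $\mathbb{Q}(t_1,\ldots,t_N)$ generated by $t_i,\frac1{t_i}$ for $1\leq i\leq N$ and $\frac1{t_i-t_j}$ for $1\leq i<j\leq N$. In the statement, $I$ being a holomorphic function on the region refers to the function defined by the (convergent) integral there. *)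

(* Defs.v *)
From HB Require Import structures.
From mathcomp Require Import all_boot all_order all_algebra.
From mathcomp Require mpoly.

Set Implicit Arguments.
Unset Strict Implicit.
Unset Printing Implicit Defensive.

Import Order.TTheory GRing.Theory Num.Theory.
Local Open Scope ring_scope.

Lemma tofrac_div_eq (D : idomainType) (p q p' q' : D) :
  tofrac p / tofrac q = tofrac p' / tofrac q' -> q != 0 -> q' != 0 ->
  p * q' = p' * q.
Proof.
move=> e q0 q'0; apply/eqP; rewrite -tofrac_eq !tofracM.
by rewrite -eqr_div ?tofrac_eq0// e.
Qed.

(* [mpoly] is imported only inside this module because its notations clash
   with those of mathcomp-analysis. *)
Module RatFun.
Import mpoly.

Section RatFun.
Variable N : nat.

Definition ratfun : fieldType := {fraction {mpoly rat[N]}}.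

Definition ratfun_const (q : rat) : ratfun := tofrac q%:MP.

Definition ratfun_var (i : 'I_N) : ratfun := tofrac 'X_i.

(* The Q-subalgebra Q[t_i, 1/t_i, 1/(t_i - t_j)] of Q(t_1, ..., t_N). *)
Inductive selberg_ring : ratfun -> Prop :=
| selberg_ring_const q : selberg_ring (ratfun_const q)
| selberg_ring_var i : selberg_ring (ratfun_var i)
| selberg_ring_var_inv i : selberg_ring (ratfun_var i)^-1
| selberg_ring_sub_inv (i j : 'I_N) : (i < j)%N ->
    selberg_ring (ratfun_var i - ratfun_var j)^-1
| selberg_ring_add f g :
    selberg_ring f -> selberg_ring g -> selberg_ring (f + g)
| selberg_ring_mul f g :
    selberg_ring f -> selberg_ring g -> selberg_ring (f * g).

Definition poly_eval (R : fieldType) (t : N.-tuple R) (p : {mpoly rat[N]}) : R :=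
  (map_mpoly ratr p).@[tnth t].

(* [ratfun_value f t v]: f is defined at t, where it takes the value v. *)
Definition ratfun_value (R : fieldType) (f : ratfun) (t : N.-tuple R) (v : R) :=
  exists p q : {mpoly rat[N]}, [/\ poly_eval t q != 0, f = tofrac p / tofrac q
    & v = poly_eval t p / poly_eval t q].

Lemma poly_eval0 (R : numFieldType) (t : N.-tuple R) : poly_eval t 0 = 0.
Proof. by rewrite /poly_eval raddf0 meval0. Qed.

Lemma poly_evalM (R : numFieldType) (t : N.-tuple R) :
  {morph poly_eval t : p q / p * q}.
Proof. by move=> p q; rewrite /poly_eval rmorphM mevalM. Qed.

Lemma ratfun_value_uniq (R : numFieldType) (f : ratfun) (t : N.-tuple R) (v w : R) :
  ratfun_value f t v -> ratfun_value f t w -> v = w.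
Proof.
move=> [p [q [q0 -> ->]]] [p' [q' [q'0 /tofrac_div_eq pq ->]]].
have nz r : poly_eval t r != 0 -> r != 0.
  by apply: contraNneq => ->; rewrite poly_eval0.
apply/eqP; rewrite eqr_div//; apply/eqP.
by move: (pq (nz _ q0) (nz _ q'0)) => /(congr1 (poly_eval t)); rewrite !poly_evalM.
Qed.

End RatFun.
End RatFun.

Export RatFun.

From mathcomp Require Import all_classical all_reals all_analysis.
From mathcomp Require Import complex.
Import numFieldNormedType.Exports.
Local Open Scope classical_set_scope.
Local Open Scope complex_scope.


Definition ratfun_eval (N : nat) (R : realType) (f : ratfun N)
  (t : N.-tuple R) : R := xget 0 (ratfun_value f t).

Section LebesgueTuple.
Variable R : realType.
Local Open Scope ereal_scope.
Local Notation T := (measurableTypeR R).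

Section Cons.
Variable n : nat.
Variable mu : {sigma_finite_measure set (n.-tuple T) -> \bar R}.

Let cons_pair (p : T * n.-tuple T) : n.+1.-tuple T := [tuple of p.1 :: p.2].

Let measurable_cons_pair : measurable_fun [set: T * n.-tuple T] cons_pair.
Proof. by apply: measurable_cons. Qed.

Definition lebesgue_cons : set (n.+1.-tuple T) -> \bar R :=
  pushforward (@lebesgue_measure R \x mu) cons_pair.

HB.instance Definition _ := Measure.copy lebesgue_cons
  (measure_function_pushforward__canonical__measure_function_Measure
     (@lebesgue_measure R \x mu) measurable_cons_pair).

Let lebesgue_cons_sigma_finite : sigma_finite setT lebesgue_cons.
Proof.
have /sigma_finiteP[F [TF ndF Foo]] := sigma_finiteT (@lebesgue_measure R).
have /sigma_finiteP[G [TG ndG Goo]] := sigma_finiteT mu.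
pose uncons (t : n.+1.-tuple T) := (thead t, [tuple of behead t]).
have munc : measurable_fun setT uncons.
  apply/measurable_fun_pair => /=; last exact: measurable_behead.
  exact: measurable_tnth.
have unconsK : uncons \o cons_pair = id.
  by apply/funext => -[x t]; congr pair; exact/val_inj.
exists (fun k => uncons @^-1` (F k `*` G k)) => [|k].
  apply/seteqP; split => // t _.
  have [k _ Fk] : (\bigcup_k F k) (uncons t).1 by rewrite -TF.
  have [l _ Gl] : (\bigcup_k G k) (uncons t).2 by rewrite -TG.
  exists (maxn k l) => //; split.
  - by move: Fk; exact/subsetPset/ndF/leq_maxl.
  - by move: Gl; exact/subsetPset/ndG/leq_maxr.
have [[mF Fk] [mG Gk]] := (Foo k, Goo k).
split.
  rewrite -[X in measurable X]setTI; apply: munc => //; exact: measurableX.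
rewrite /lebesgue_cons /pushforward -comp_preimage unconsK preimage_id.
by rewrite product_measure1E// lte_mul_pinfty// ge0_fin_numE.
Qed.

HB.instance Definition _ := Measure_isSigmaFinite.Build _ _ _
  lebesgue_cons lebesgue_cons_sigma_finite.

End Cons.

Fixpoint lebesgue_tuple (n : nat) :
    {sigma_finite_measure set (n.-tuple T) -> \bar R} :=
  if n is n'.+1 then lebesgue_cons (lebesgue_tuple n')
  else \d_([tuple] : 0.-tuple T).

Lemma lebesgue_tuple_box n (A : 'I_n -> set T) :
  (forall i, measurable (A i)) ->
  lebesgue_tuple n [set t | forall i, A i (tnth t i)] =
    \prod_(i < n) lebesgue_measure (A i).
Proof.
elim: n A => [|n IHn] A mA /=.
  by rewrite big_ord0 diracE mem_set//= => -[].
rewrite big_ord_recl -IHn => [|i]; last exact: mA.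
rewrite /lebesgue_cons /pushforward.
rewrite (_ : _ @^-1` _ =
    A ord0 `*` [set t | forall i, A (lift ord0 i) (tnth t i)]); last first.
  apply/seteqP; split => [[x t] /= At|[x t] /= [Ax At] i].
    by split => [|i]; [exact: (At ord0)|have := At (lift ord0 i); rewrite tnthS].
  by case: (unliftP ord0 i) => [j|] ->; rewrite ?tnthS.
rewrite product_measure1E//.
rewrite (_ : mkset _ = \bigcap_(i in setT)
  ((fun t => tnth t i) @^-1` A (lift ord0 i))).
  apply: fin_bigcap_measurable => // i _.
  by rewrite -[X in measurable X]setTI; exact: measurable_tnth.
by apply/seteqP; split => t /= h i => [_|]; exact: h.
Qed.
End LebesgueTuple.

(* R[i] as a normed space over itself; it follows that all differentiability
   statements below are over R[i]. *)
HB.instance Definition _ (R : realType) :=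
  NormedModule.copy R[i] ((R[i] : numFieldType)^o).

Definition cexp (R : realType) (z : R[i]) : R[i] :=
  (expR (Re z))%:C * (cos (Im z) +i* sin (Im z)).

(* x ^ s = exp (s log x), meant for x > 0. *)
Definition cpow (R : realType) (x : R) (s : R[i]) : R[i] :=
  cexp (s * (ln x)%:C).

Section Integral.
Context d (T : measurableType d) (R : realType) (mu : {measure set T -> \bar R}).

Definition cintegrable (D : set T) (g : T -> R[i]) : Prop :=
  mu.-integrable D (fun t => (Re (g t))%:E) /\
  mu.-integrable D (fun t => (Im (g t))%:E).

Definition cintegral (D : set T) (g : T -> R[i]) : R[i] :=
  (\int[mu]_(t in D) Re (g t)) +i* (\int[mu]_(t in D) Im (g t)).

End Integral.

(* Functions of finitely many complex variables, indexed by a finType [I]: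
   C^I is represented by row vectors of length #|I|. *)
Section SeveralVariables.
Variables (R : realType) (I : finType).
Local Notation C := R[i].
Local Notation point := 'rV[C]_#|I|.

Definition ccoord (s : point) (i : I) : C := s ord0 (enum_rank i).

Definition holomorphic_on (U : set point) (F : point -> C) : Prop :=
  open U /\ forall s, U s -> differentiable F s.

Definition partial (i : I) (F : point -> C) : point -> C :=
  fun s => 'D_(delta_mx ord0 (enum_rank i) : point) F s.

Definition mpartial (m : {ffun I -> nat}) (F : point -> C) : point -> C :=
  foldr (fun i => iter (m i) (partial i)) F (enum I).

Definition taylor_coef (F : point -> C) (a : point) (m : {ffun I -> nat}) : C :=
  mpartial m F a / (\prod_i (m i)`!)%:R.

End SeveralVariables.

Section MultipleZeta.
Variable R : realType.

(* The empty index is admissible, and its multiple zeta value is 1. *)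
Definition mzv_admissible (k : seq nat) : bool :=
  all (leq 1) k && (2 <= last 2 k)%N.

Definition mzv (k : seq nat) : R :=
  fine (\esum_(n in [set n : (size k).-tuple nat | path ltn 0%N n])
    ((\prod_(j < size k) (tnth n j)%:R ^+ nth 0%N k j)^-1)%:E).

Definition mzv_combination (z : R[i]) : Prop :=
  exists2 c : seq (rat * seq nat), all (fun x => mzv_admissible x.2) c &
    z = (\sum_(x <- c) ratr x.1 * mzv x.2)%:C.

End MultipleZeta.

Section Selberg.
Variables (R : realType) (N : nat).
Local Notation C := R[i].

Definition ord_pair : finType := {p : 'I_N * 'I_N | (p.1 < p.2)%N}.

Definition selberg_var : finType := ('I_N + 'I_N + ord_pair)%type.

Definition selberg_point : Type := 'rV[C]_#|selberg_var|.

Definition alpha_of (s : selberg_point) (i : 'I_N) : C :=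
  ccoord s (inl (inl i) : selberg_var).
Definition beta_of (s : selberg_point) (i : 'I_N) : C :=
  ccoord s (inl (inr i) : selberg_var).
Definition gamma_of (s : selberg_point) (p : ord_pair) : C :=
  ccoord s (inr p : selberg_var).

(* 0 < t_1 < ... < t_N < 1 *)
Definition selberg_domain : set (N.-tuple (measurableTypeR R)) :=
  [set t | path <%R (0 : R) (rcons t 1)].

Definition selberg_integrand (f : ratfun N) (s : selberg_point)
    (t : N.-tuple (measurableTypeR R)) : C :=
  (ratfun_eval f (t : N.-tuple R))%:C *
  (\prod_(i < N) (cpow (tnth t i) (alpha_of s i) * cpow (1 - tnth t i) (beta_of s i))) *
  \prod_(p : ord_pair)
    cpow (tnth t (val p).2 - tnth t (val p).1) (gamma_of s p).

Definition selberg_integral (f : ratfun N) (s : selberg_point) : C :=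
  cintegral (lebesgue_tuple R N) selberg_domain (selberg_integrand f s).

Definition selberg_region (A B : 'I_N -> R) (G : ord_pair -> R) :
    set selberg_point :=
  [set s | [/\ forall i, A i < Re (alpha_of s i), forall i, B i < Re (beta_of s i)
    & forall p, G p < Re (gamma_of s p)]].

Definition integral_point (s : selberg_point) : Prop :=
  forall v, exists z : int, ccoord s v = z%:~R.

End Selberg.

Arguments selberg_domain R N : clear implicits.

(* Main.v *)
Require Import Defs.
From HB Require Import structures.
From mathcomp Require Import all_boot all_order all_algebra.
From mathcomp Require Import ring lra.
From mathcomp Require mpoly.

(** The theorem has an analytic half and an arithmetic half.

    Analysis.  On the simplex, f is a polynomial in the t_i divided by the
    K-th power of prod t_i * prod (t_j - t_i), for some K.  Take K as the bound
    for the alpha_i and gamma_ij, and 0 for the beta_i.  The integrand is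
    v(t) * exp(sum_v s_v l_v(t)), where s_v runs over all exponents and l_v is
    the logarithm of t_i, 1 - t_i or t_j - t_i, hence nonpositive: the integral
    is a Laplace transform over a set of finite measure, and
    v(t) * exp(sum_v A_v l_v(t)) is bounded, A_v being the bound for s_v.  When
    Re s_v > A_v there remains a factor exp(- e L), with L = sum_v |l_v|, which
    absorbs any power of L.  So one may differentiate under the integral sign
    as often as one likes, which multiplies the integrand by factors l_v
    (differentiable_laplace, mpartial_laplace).

    Arithmetic.  At an integral point of the region the denominator of f is
    cancelled, so a Taylor coefficient is, up to a factorial, the integral over
    the simplex of a rational polynomial in the t_i and in the logarithms of
    t_i, 1 - t_i and t_j - t_i = t_j (1 - t_i / t_j).  It suffices to integrate
    products of factors t_i, - ln t_i and - ln (1 - t_i / t_j), where 1 is one of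
    the allowed values of t_j, and to do so one variable at a time, the smallest
    first.  The class of integrands has to be enlarged to be stable under such
    an integration: one also allows a hyperlogarithm.

    A word w in a letter 0 and letters j with weights b_j gives an iterated
    integral, from 0 to z, of the forms dz/z and b_j dz/(1 - b_j z); hlog b w n is
    its n-th Taylor coefficient, and Phi b w its value at z = 1.  The coefficients
    multiply by shuffles (cauchy_prod_hlog).  When all weights are 1, the
    convergent values Phi are the multiple zeta values (mzv_Phi, Phi_mzv); in
    particular these span a ring.  As - ln (1 - t_1 / t_j) is a hyperlogarithm with a single
    letter, the dependence of an integrand on t_1 reduces, by shuffling, to
    t_1^q (ln t_2 - ln t_1)^l times a hyperlogarithm with weights t_1 / t_j.  This
    is integrated term by term over 0 < t_1 < t_2, and the result is the series of
    the hlog b w n / (n + p)^k, now with the weights 1 and y s_j, where y = t_2 and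
    s_j = 1 / t_j (integral_Phi_Ssum).  Partial fractions express this series through
    values Phi for the same weights (reducible_Ssum).

    One obstacle remains: the weight 1, which comes from the end point t_2, must
    be eliminated.  This is Phi_scaled_rep: a value Phi with weights 1 and y s_j is
    a linear combination of values with weights y s_j only, the coefficients
    being multiple zeta values.  Indeed, as for all iterated integrals, y d/dy of
    such a value is a combination of values for the words obtained by deleting
    a letter.  In terms of the coefficients with respect to y, where y d/dy becomes
    multiplication by the degree e, this is the identity hlog2_euler, and it can be
    integrated by induction on the length of the word.  The constants of
    integration are the coefficients of degree e = 0, which are multiple zeta
    values. *)

Set Implicit Arguments.
Unset Strict Implicit.
Unset Printing Implicit Defensive.

Import Order.TTheory GRing.Theory Num.Theory.
Local Open Scope ring_scope.

(** * Values of rational functions *)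

(** A module confines the notations for multivariate polynomials. *)
Module RatFunValue.
Import mpoly.
Section RatFunValue.
Variables (N : nat) (R : numFieldType) (t : N.-tuple R).

Lemma poly_evalD : {morph @poly_eval N R t : p q / p + q}.
Proof. by move=> p q; rewrite /poly_eval raddfD mevalD. Qed.

Lemma poly_evalN : {morph @poly_eval N R t : p / - p}.
Proof. by move=> p; rewrite /poly_eval raddfN mevalN. Qed.

Lemma poly_evalC q : @poly_eval N R t q%:MP = ratr q.
Proof. by rewrite /poly_eval map_mpolyC mevalC. Qed.

Lemma poly_evalX i : @poly_eval N R t 'X_i = tnth t i.
Proof. by rewrite /poly_eval map_mpolyX mevalXU. Qed.

Lemma poly_eval1 : @poly_eval N R t 1 = 1.
Proof. by rewrite -mpolyC1 poly_evalC rmorph1. Qed.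

Lemma poly_eval_neq0 p : @poly_eval N R t p != 0 -> p != 0.
Proof. by apply: contraNneq => ->; rewrite poly_eval0. Qed.

Lemma ratfun_value_poly p : ratfun_value (tofrac p) t (poly_eval t p).
Proof. by exists p, 1; rewrite poly_eval1 oner_neq0 tofrac1 !divr1. Qed.

Lemma ratfun_value_const q : ratfun_value (ratfun_const N q) t (ratr q).
Proof. by rewrite -poly_evalC; exact: ratfun_value_poly. Qed.

Lemma ratfun_value_var i : ratfun_value (ratfun_var i) t (tnth t i).
Proof. by rewrite -poly_evalX; exact: ratfun_value_poly. Qed.

Lemma ratfun_value_inv f v : v != 0 -> ratfun_value f t v -> ratfun_value f^-1 t v^-1.
Proof.
move=> v0 [p [q [q0 -> E]]]; exists q, p; split; [|exact: invf_div|].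
  by apply: contraNneq v0 => p0; rewrite E p0 mul0r.
rewrite E; exact: invf_div.
Qed.

Lemma ratfun_valueD f g v w : ratfun_value f t v -> ratfun_value g t w ->
  ratfun_value (f + g) t (v + w).
Proof.
move=> [p [q [q0 -> ->]]] [p' [q' [q'0 -> ->]]].
have nz r : poly_eval t r != 0 -> tofrac r != 0 :> ratfun N.
  by move=> /poly_eval_neq0; rewrite tofrac_eq0.
exists (p * q' + p' * q), (q * q'); split.
- rewrite poly_evalM; exact: (mulf_neq0 q0 q'0).
- by rewrite tofracD !tofracM; apply: addf_div; exact: nz.
- by rewrite poly_evalD !poly_evalM addf_div.
Qed.

Lemma ratfun_valueM f g v w : ratfun_value f t v -> ratfun_value g t w ->
  ratfun_value (f * g) t (v * w).
Proof.
move=> [p [q [q0 -> ->]]] [p' [q' [q'0 -> ->]]].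
exists (p * p'), (q * q'); split.
- rewrite poly_evalM; exact: (mulf_neq0 q0 q'0).
- by rewrite !tofracM; exact: mulf_div.
- by rewrite !poly_evalM mulf_div.
Qed.

Lemma ratfun_valueN f v : ratfun_value f t v -> ratfun_value (- f) t (- v).
Proof.
move=> [p [q [q0 -> ->]]]; exists (- p), q; rewrite poly_evalN tofracN.
by split; [exact: q0|rewrite mulNr|rewrite mulNr].
Qed.

End RatFunValue.
End RatFunValue.

(** * Words, shuffles, and Taylor coefficients of hyperlogarithms *)

(** [None] is the letter 0, that is, the form dz/z; [Some j] stands for the form
    b_j dz/(1 - b_j z), for weights b to be specified. *)
Definition letter := option nat.
Definition word := seq letter.
(** No logarithmic singularity at the lower end point 0.  The last letter of a word
    is the one that is integrated first. *)
Definition admissible (w : word) := last (Some 0%N) w != None.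

Fixpoint shuffle (u : word) : word -> seq word :=
  fix sh (w : word) : seq word :=
  match u, w with
  | [::], _ => [:: w]
  | _, [::] => [:: u]
  | a :: u', b :: w' => map (cons a) (shuffle u' w) ++ map (cons b) (sh w')
  end.

Lemma shuffle0w w : shuffle [::] w = [:: w]. Proof. by case: w. Qed.
Lemma shufflew0 w : shuffle w [::] = [:: w]. Proof. by case: w. Qed.
Lemma shuffle_cons a u b w : shuffle (a :: u) (b :: w) =
  map (cons a) (shuffle u (b :: w)) ++ map (cons b) (shuffle (a :: u) w).
Proof. by []. Qed.

Lemma last_shuffle d u w x : x \in shuffle u w ->
  last d x = last d u \/ last d x = last d w.
Proof.
have [k] := ubnP (size u + size w); elim: k u w d x => // k IH [|a u] w d x.
  by rewrite shuffle0w mem_seq1 => _ /eqP ->; right.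
case: w => [|c w]; first by rewrite shufflew0 mem_seq1 => _ /eqP ->; left.
rewrite ltnS => szk; rewrite shuffle_cons mem_cat => /orP[] /mapP[x' x'in ->] /=.
  case: u szk x'in => [|a' u] szk x'in.
    by right; move: x'in; rewrite shuffle0w mem_seq1 => /eqP ->.
  by have [|->|->] := IH _ _ a _ _ x'in; [|left|right].
case: w szk x'in => [|c' w] szk x'in.
  by left; move: x'in; rewrite shufflew0 mem_seq1 => /eqP ->.
have [|->|->] := IH _ _ c _ _ x'in; [|by left|by right].
by rewrite addnS in szk.
Qed.

Lemma admissible_shuffle u w x : admissible u -> admissible w ->
  x \in shuffle u w -> admissible x.
Proof. by rewrite /admissible => au aw /(@last_shuffle (Some 0%N)) [->|->]. Qed.

Lemma mem_shuffle u w x a : x \in shuffle u w -> a \in x -> (a \in u) || (a \in w).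
Proof.
have [k] := ubnP (size u + size w); elim: k u w x => // k IH [|c u] w x.
  by rewrite shuffle0w mem_seq1 => _ /eqP ->.
case: w => [|d w]; first by rewrite shufflew0 mem_seq1 orbF => _ /eqP ->.
rewrite ltnS => szk; rewrite shuffle_cons mem_cat => /orP[] /mapP[x' x'in ->].
  rewrite inE => /orP[/eqP ->|/(IH _ _ _ _ x'in)]; first by rewrite inE eqxx.
  move=> /(_ szk) /orP[aq|->]; last by rewrite orbT.
  by rewrite inE aq orbT.
rewrite inE => /orP[/eqP ->|/(IH _ _ _ _ x'in)]; first by rewrite !inE eqxx !orbT.
rewrite -addnS => /(_ szk) /orP[->//|aq].
by rewrite [X in _ || X]inE aq !orbT.
Qed.

Lemma head_shuffle u w x d : x \in shuffle u w ->
  head d x = head d u \/ head d x = head d w.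
Proof.
case: u => [|a u]; first by rewrite shuffle0w mem_seq1 => /eqP ->; right.
case: w => [|c w]; first by rewrite shufflew0 mem_seq1 => /eqP ->; left.
by rewrite shuffle_cons mem_cat => /orP[] /mapP[x' _ ->]; [left|right].
Qed.

Section Coef.
Variable R : realFieldType.
Implicit Types (b s : nat -> R) (x y : nat -> R) (n e : nat) (w : word).

(** [geo c x] is the sequence of coefficients of X(z) * c z/(1 - c z), where X is the
    generating series of x. *)
Fixpoint geo (b : R) x n : R := if n is m.+1 then b * (x m + geo b x m) else 0.

Definition letter_op b (a : letter) x : nat -> R :=
  if a is Some j then geo (b j) x else x.

(** The Taylor coefficients at 0 of the hyperlogarithm of w: the derivation z d/dz,
    which multiplies the n-th coefficient by n, undoes the outermost integration.  For
    words that are not admissible the convention x / 0 = 0 makes all coefficients vanish. *)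
Fixpoint hlog b w : nat -> R :=
  if w is a :: w' then fun n => letter_op b a (hlog b w') n / n%:R
  else fun n => (n == 0%N)%:R.

Lemma eq_geo c x y n : (forall m, (m < n)%N -> x m = y m) -> geo c x n = geo c y n.
Proof.
elim: n => //= n IH h; rewrite h // IH // => m mn; exact/h/ltnW.
Qed.

Lemma geo_ge0 c x n : 0 <= c -> (forall m, 0 <= x m) -> 0 <= geo c x n.
Proof. by move=> c0 x0; elim: n => //= n IH; rewrite mulr_ge0 ?addr_ge0. Qed.

Lemma le_geo c d x y n : 0 <= c <= d -> (forall m, 0 <= x m <= y m) ->
  geo c x n <= geo d y n.
Proof.
move=> /andP[c0 cd] xy; elim: n => //= n IH.
have /andP[x0 xy'] := xy n.
apply: ler_pM => //; last exact: lerD.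
by rewrite addr_ge0// geo_ge0// => m; case/andP: (xy m).
Qed.

Lemma geo1 x n : geo 1 x n = \sum_(m < n) x m.
Proof. by elim: n => [|n IH]; rewrite ?big_ord0//= big_ord_recr /= mul1r IH addrC. Qed.

Lemma geoE c x n : geo c x n = \sum_(m < n) c ^+ (n - m) * x m.
Proof.
elim: n => [|n IH]; first by rewrite big_ord0.
rewrite /= big_ord_recr /= subSn // subnn expr1 IH mulrDr addrC mulr_sumr.
by congr (_ + _); apply: eq_bigr => i _; rewrite subSn ?exprS ?mulrA// ltnW.
Qed.

Lemma geo_add c x y n : geo c (fun m => x m + y m) n = geo c x n + geo c y n.
Proof. elim: n => [|n IH] /=; [by rewrite addr0 | rewrite IH; ring]. Qed.

Lemma geo_scale c k x n : geo c (fun m => k * x m) n = k * geo c x n.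
Proof. elim: n => [|n IH] /=; [by rewrite mulr0 | rewrite IH; ring]. Qed.

Lemma geo_sum c I (r : seq I) (F : I -> nat -> R) n :
  geo c (fun m => \sum_(i <- r) F i m) n = \sum_(i <- r) geo c (F i) n.
Proof.
elim: r => [|i r IH].
  by rewrite big_nil; under eq_geo do rewrite big_nil;
     elim: n => //= n ->; rewrite addr0 mulr0.
rewrite big_cons -IH -geo_add; apply: eq_geo => m _; exact: big_cons.
Qed.

Lemma hlog0 b a w : hlog b (a :: w) 0 = 0.
Proof. by rewrite /= invr0 mulr0. Qed.

Lemma mul_hlog b a w n : n != 0%N -> n%:R * hlog b (a :: w) n = letter_op b a (hlog b w) n.
Proof. by move=> n0 /=; rewrite mulrC divfK // pnatr_eq0. Qed.

Lemma letter_op_ge0 b a x n : (forall j, 0 <= b j) -> (forall m, 0 <= x m) ->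
  0 <= letter_op b a x n.
Proof. by move=> b0 x0; case: a => [j|] /=; rewrite ?geo_ge0. Qed.

Lemma hlog_ge0 b w n : (forall j, 0 <= b j) -> 0 <= hlog b w n.
Proof.
move=> b0; elim: w n => [|a w IH] n; first by rewrite /= ler0n.
by rewrite /= divr_ge0// letter_op_ge0.
Qed.

Lemma le_hlog b c w n : (forall j, 0 <= b j <= c j) -> hlog b w n <= hlog c w n.
Proof.
move=> bc; elim: w n => [//|a w IH] n /=.
rewrite ler_wpM2r ?invr_ge0//.
case: a => [j|] //=; apply: le_geo => // m.
by rewrite IH hlog_ge0// => i; case/andP: (bc i).
Qed.

Definition word_letters (P : nat -> Prop) w := forall j, Some j \in w -> P j.

Lemma eq_hlog b c w n : word_letters (fun j => b j = c j) w -> hlog b w n = hlog c w n.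
Proof.
elim: w n => [//|a w IH] n h /=.
have h' : word_letters (fun j => b j = c j) w by move=> j jw; apply: h; rewrite inE jw orbT.
congr (_ / _).
case: a h => [j|] h /=; last exact: IH.
rewrite h ?inE ?eqxx//; apply: eq_geo => m _; exact: IH.
Qed.

Lemma geo_homog k c x n : geo (k * c) (fun m => k ^+ m * x m) n = k ^+ n * geo c x n.
Proof. elim: n => [|n IH] /=; [by rewrite mulr0 | rewrite IH exprS; ring]. Qed.

(** Scaling all weights by k amounts to evaluating the hyperlogarithm at k z. *)
Lemma hlog_homog k b w n : hlog (fun j => k * b j) w n = k ^+ n * hlog b w n.
Proof.
elim: w n => [|a w IH] n /=.
  by case: n => [|n] /=; rewrite ?expr0 ?mulr1 ?mulr0.
rewrite mulrA; congr (_ / _); case: a => [j|] //=.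
rewrite -geo_homog; apply: eq_geo => m _; exact: IH.
Qed.

Definition cauchy_prod x y n := \sum_(i < n.+1) x i * y (n - i)%N.

Lemma cauchy_prodC x y n : cauchy_prod x y n = cauchy_prod y x n.
Proof.
rewrite /cauchy_prod (reindex_inj rev_ord_inj) /=; apply: eq_bigr => i _.
by rewrite mulrC subSS subKn // -ltnS.
Qed.

Lemma cauchy_prod_geo c x y n : cauchy_prod (geo c x) y n = geo c (cauchy_prod x y) n.
Proof.
elim: n => [|n IH]; first by rewrite /cauchy_prod big_ord1 /= mul0r.
rewrite /cauchy_prod big_ord_recl /= mul0r add0r -IH /cauchy_prod -big_split /= mulr_sumr.
by apply: eq_bigr => i _; rewrite /bump leq0n /= add1n subSS; ring.
Qed.

(** Leibniz rule for z d/dz. *)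
Lemma cauchy_prod_deriv x y n : n%:R * cauchy_prod x y n =
  cauchy_prod (fun m => m%:R * x m) y n + cauchy_prod x (fun m => m%:R * y m) n.
Proof.
rewrite /cauchy_prod mulr_sumr -big_split; apply: eq_bigr => i _ /=.
have {1}-> : n%:R = i%:R + (n - i)%:R :> R by rewrite -natrD subnKC // -ltnS.
ring.
Qed.

Lemma eq_cauchy_prod x x' y y' n : (forall m, x m = x' m) -> (forall m, y m = y' m) ->
  cauchy_prod x y n = cauchy_prod x' y' n.
Proof. by move=> xx yy; apply: eq_bigr => i _; rewrite xx yy. Qed.

Lemma cauchy_prod_nil b x n : cauchy_prod (hlog b [::]) x n = x n.
Proof.
rewrite /cauchy_prod big_ord_recl /= mul1r subn0 big1 ?addr0 // => i _.
by rewrite mul0r.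
Qed.

Lemma cauchy_prod_letter b a x y n : 
  cauchy_prod (letter_op b a x) y n = letter_op b a (cauchy_prod x y) n.
Proof. by case: a => [j|] //=; rewrite cauchy_prod_geo. Qed.

Lemma letter_op_sum b a I (r : seq I) (F : I -> nat -> R) n :
  letter_op b a (fun m => \sum_(i <- r) F i m) n = \sum_(i <- r) letter_op b a (F i) n.
Proof. by case: a => [j|] //=; rewrite geo_sum. Qed.

Lemma eq_letter_op b a x y n : (forall m, x m = y m) ->
  letter_op b a x n = letter_op b a y n.
Proof. by move=> xy; case: a => [j|] //=; apply: eq_geo => m _. Qed.

Lemma mul_hlog_admissible b a w n : admissible (a :: w) ->
  n%:R * hlog b (a :: w) n = letter_op b a (hlog b w) n.
Proof.
case: n => [|n] adm; last exact: mul_hlog.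
rewrite mul0r; case: a adm => [j|] //; case: w => [|a w] // _.
by rewrite /letter_op hlog0.
Qed.

(** Shuffle product of iterated integrals: z d/dz of the left side is computed by the
    Leibniz rule, and deletes the first letter of one of the two words, exactly as the
    recursive definition of the shuffle does. *)
Lemma cauchy_prod_hlog b u w n : admissible u -> admissible w ->
  cauchy_prod (hlog b u) (hlog b w) n = \sum_(x <- shuffle u w) hlog b x n.
Proof.
move=> au aw.
have [k] := ubnP (size u + size w); elim: k u w n au aw => // k IH [|a u] w n au aw.
  by move=> _; rewrite shuffle0w big_seq1 cauchy_prod_nil.
case: w aw => [|c w] aw; first by move=> _; rewrite shufflew0 big_seq1 cauchy_prodC cauchy_prod_nil.
rewrite ltnS => szk.
case: n => [|n].
  rewrite /cauchy_prod big_ord1 hlog0 mul0r big1_seq // => x /andP[_].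
  by rewrite shuffle_cons mem_cat => /orP[] /mapP[x' _ ->]; rewrite hlog0.
have n0 : n.+1%:R != 0 :> R by rewrite pnatr_eq0.
apply: (mulfI n0); rewrite cauchy_prod_deriv.
rewrite shuffle_cons big_cat !big_map /= mulrDr; congr (_ + _).
  rewrite (@eq_cauchy_prod _ (letter_op b a (hlog b u)) _ (hlog b (c :: w)))//; last first.
    by move=> m; rewrite mul_hlog_admissible.
  rewrite cauchy_prod_letter mulr_sumr.
  transitivity (\sum_(i <- shuffle u (c :: w)) letter_op b a (hlog b i) n.+1); last first.
    by apply: eq_bigr => i _; rewrite mulrC divfK.
  rewrite -letter_op_sum; case: u au szk => [|a' u] au szk.
    apply: eq_letter_op => m; rewrite shuffle0w big_seq1; exact: cauchy_prod_nil.
  by apply: eq_letter_op => m; rewrite IH.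
rewrite (@eq_cauchy_prod _ (hlog b (a :: u)) _ (letter_op b c (hlog b w)))//; last first.
  by move=> m; rewrite mul_hlog_admissible.
rewrite cauchy_prodC cauchy_prod_letter mulr_sumr.
transitivity (\sum_(i <- shuffle (a :: u) w) letter_op b c (hlog b i) n.+1); last first.
  by apply: eq_bigr => i _; rewrite mulrC divfK.
rewrite -letter_op_sum; case: w aw szk => [|c' w] aw szk.
  apply: eq_letter_op => m; rewrite shufflew0 big_seq1; exact: cauchy_prod_nil.
apply: eq_letter_op => m; rewrite cauchy_prodC IH //.
by rewrite addnS in szk.
Qed.

End Coef.

(** * Hyperlogarithms whose letters share a scale *)

Definition nonzero_letter (a : letter) : bool := a != None.

(** In [(g, a, b, u)], u is the word after the removal of a letter, a and b are the two
    neighbouring letters whose difference is responsible for this contribution, and g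
    tells whether it enters with a minus sign. *)
Definition removal := (bool * letter * letter * word)%type.

Definition removal_cons (a : letter) (t : removal) : removal :=
  let: (g, a', b', u) := t in (g, a', b', a :: u).

(** Every letter is compared with its right neighbour (with the letter 0 after the end of
    the word) and, unless it comes first, with its left neighbour.  The comparison of the
    first letter with the upper end point is left out. *)
Fixpoint removals (w : word) : seq removal :=
  if w is a :: w' then
    (~~ nonzero_letter a, a, head None w', w') ::
    (if w' is b :: w'' then
       map (removal_cons a) ((nonzero_letter b, a, b, w'') :: removals w')
     else [::])
  else [::].

Section Coef2.
Variable R : realFieldType.
Implicit Types (s : nat -> R) (x y : nat -> nat -> R) (n e : nat).

(** Multiplication by c z y/(1 - c z y) on generating series in z and y; the two
    indices are the degrees in z and in y. *)
Fixpoint geo2 (c : R) x n e : R :=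
  if n is m.+1 then if e is f.+1 then c * (x m f + geo2 c x m f) else 0 else 0.

(** Here [Some 0] is the letter of weight 1, and [Some j.+1] the letter of weight
    y s_j. *)
Definition letter_op2 s (a : letter) x : nat -> nat -> R :=
  match a with
  | None => x
  | Some 0 => fun n e => geo 1 (x^~ e) n
  | Some j.+1 => geo2 (s j) x
  end.

(** The coefficient of z^n y^e in the hyperlogarithm with the weights
    [scaled_weights s y] (see [hlog_hlog2]). *)
Fixpoint hlog2 s (w : word) : nat -> nat -> R :=
  if w is a :: w' then fun n e => letter_op2 s a (hlog2 s w') n e / n%:R
  else fun n e => ((n == 0%N) && (e == 0%N))%:R.

(** A letter of weight b is singular at the point 1/b.  For two adjacent letters, this is
    multiplication by y d/dy of the logarithm of the difference of their singular points,
    up to constants that cancel in the sum over all removals: it is 1 for the letters 0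
    and 1, and - s_j y/(1 - s_j y) for the letters 1 and y s_j. *)
Definition dlog_op s (a b : letter) x : nat -> nat -> R :=
  match a, b with
  | None, Some 0 | Some 0, None => x
  | Some 0, Some j.+1 | Some j.+1, Some 0 => fun n e => - geo (s j) (x n) e
  | _, _ => fun _ _ => 0
  end.

(** The analogue of [dlog_op] for the first letter and the upper end point z. *)
Definition dlog_top s (a : letter) x : nat -> nat -> R :=
  if a is Some j.+1 then fun n e => - geo2 (s j) x n e else x.

Definition removal_val s (t : removal) n e : R :=
  let: (g, a, b, u) := t in (-1) ^+ g * dlog_op s a b (hlog2 s u) n e.

Lemma eq_geo2 c x y n e : (forall m f, x m f = y m f) -> geo2 c x n e = geo2 c y n e.
Proof. by move=> xy; elim: n e => [|n IH] [|e] //=; rewrite IH xy. Qed.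

Lemma geo2_ge0 c x n e : 0 <= c -> (forall m f, 0 <= x m f) -> 0 <= geo2 c x n e.
Proof. by move=> c0 x0; elim: n e => [|n IH] [|e] //=; rewrite mulr_ge0 ?addr_ge0. Qed.

Lemma geo2_add c x y n e :
  geo2 c (fun m f => x m f + y m f) n e = geo2 c x n e + geo2 c y n e.
Proof. by elim: n e => [|n IH] [|e] /=; rewrite ?addr0// IH; ring. Qed.

Lemma geo2_scale c k x n e : geo2 c (fun m f => k * x m f) n e = k * geo2 c x n e.
Proof. by elim: n e => [|n IH] [|e] /=; rewrite ?mulr0// IH; ring. Qed.

Lemma geo2_sum c I (r : seq I) (F : I -> nat -> nat -> R) n e :
  geo2 c (fun m f => \sum_(i <- r) F i m f) n e = \sum_(i <- r) geo2 c (F i) n e.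
Proof.
elim: r => [|i r IH].
  by rewrite big_nil; elim: n e => [|n IH] [|e] //=; rewrite big_nil IH addr0 mulr0.
rewrite big_cons -IH -geo2_add; apply: eq_geo2 => m f; exact: big_cons.
Qed.

(** The factor c z y/(1 - c z y) is a function of z y, so z d/dz and y d/dy agree on it. *)
Lemma geo2_balance c x n e :
  n%:R * geo2 c x n e + geo2 c (fun m f => f%:R * x m f) n e =
  e%:R * geo2 c x n e + geo2 c (fun m f => m%:R * x m f) n e.
Proof.
elim: n e => [|n IH] [|e] /=; rewrite ?mulr0 ?mul0r//.
by move: (congr1 ( *%R c) (IH e)); rewrite -!natr1 !mulrDr => {}IH; lra.
Qed.

(** The partial fraction identity
    C * Z = D * Z + D + D * C for C = c y/(1 - c y), Z = z/(1 - z), D = c z y/(1 - c z y). *)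
Lemma geo_geo1_geo2 c x n e :
  geo c (fun f => geo 1 (x^~ f) n) e =
  geo2 c (fun m f => geo 1 (x^~ f) m) n e + geo2 c x n e +
  geo2 c (fun m => geo c (x m)) n e.
Proof.
elim: n e => [|n IH] [|e] /=; rewrite ?addr0//.
  by elim: e => [|e IHe] /=; rewrite ?addr0 ?mulr0// IHe addr0 mulr0.
have -> : geo c (fun f => 1 * (x n f + geo 1 (x^~ f) n)) e =
  geo c (x n) e + geo c (fun f => geo 1 (x^~ f) n) e.
  by rewrite -geo_add; apply: eq_geo => m _; rewrite mul1r.
rewrite IH; ring.
Qed.

Lemma geo_geo2 c d x n e :
  geo c (geo2 d x n) e = geo2 d (fun m => geo c (x m)) n e.
Proof.
elim: n e => [|n IH] e /=; first by elim: e => //= e ->; rewrite addr0 mulr0.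
elim: e => [//|e IHe] /=.
rewrite IHe; case: e IHe => [|e] IHe /=; rewrite -!IH /=; ring.
Qed.

Lemma geo1_geo2 d x n e :
  geo 1 (fun m => geo2 d x m e) n = geo2 d (fun m f => geo 1 (x^~ f) m) n e.
Proof.
elim: n e => [|n IH] e //=.
case: e => [|e] //=.
  have z k : geo2 d x k 0 = 0 by case: k.
  by rewrite z add0r mul1r; elim: (n) => //= k ->; rewrite z add0r mul1r.
rewrite IH mul1r {IH}; elim: n e => [|n IH] e /=; first by ring.
case: e => [|e] /=; last by rewrite -(IH e); ring.
have z k y : geo2 d y k 0 = 0 by case: k.
by rewrite !z; ring.
Qed.

Lemma geo_geo1 c x n e : geo c (fun f => geo 1 (x^~ f) n) e =
  geo 1 (fun m => geo c (x m) e) n.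
Proof.
elim: n => [|n IH] /=; first by elim: e => //= e ->; rewrite addr0 mulr0.
rewrite mul1r -IH -geo_add; apply: eq_geo => m _; exact: mul1r.
Qed.

Lemma hlog2_0 s a w e : hlog2 s (a :: w) 0 e = 0.
Proof. by rewrite /= invr0 mulr0. Qed.

Lemma mul_hlog2 s a w n e : n != 0%N ->
  n%:R * hlog2 s (a :: w) n e = letter_op2 s a (hlog2 s w) n e.
Proof. by move=> n0 /=; rewrite mulrC divfK // pnatr_eq0. Qed.

Lemma mul_hlog2_admissible s a w n e : admissible (a :: w) ->
  n%:R * hlog2 s (a :: w) n e = letter_op2 s a (hlog2 s w) n e.
Proof.
case: n => [|n] adm; last exact: mul_hlog2.
rewrite mul0r; case: a adm => [[|j]|] //; case: w => [|a w] // _.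
by rewrite /letter_op2 hlog2_0.
Qed.

Lemma eq_letter_op2 s a x y n e : (forall m f, x m f = y m f) ->
  letter_op2 s a x n e = letter_op2 s a y n e.
Proof. by move=> xy; case: a => [[|j]|] //=; [apply: eq_geo|apply: eq_geo2]. Qed.

Lemma letter_op2_add s a x y n e :
  letter_op2 s a (fun m f => x m f + y m f) n e =
  letter_op2 s a x n e + letter_op2 s a y n e.
Proof. by case: a => [[|j]|] //=; rewrite ?geo_add ?geo2_add. Qed.

Lemma letter_op2_scale s a k x n e :
  letter_op2 s a (fun m f => k * x m f) n e = k * letter_op2 s a x n e.
Proof. by case: a => [[|j]|] //=; rewrite ?geo_scale ?geo2_scale. Qed.

Lemma letter_op2_sum s a I (r : seq I) (F : I -> nat -> nat -> R) n e :
  letter_op2 s a (fun m f => \sum_(i <- r) F i m f) n e =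
  \sum_(i <- r) letter_op2 s a (F i) n e.
Proof. by case: a => [[|j]|] //=; rewrite ?geo_sum ?geo2_sum. Qed.

Lemma eq_dlog_op s a b x y n e : (forall f, x n f = y n f) ->
  dlog_op s a b x n e = dlog_op s a b y n e.
Proof.
move=> xy; case: a => [[|j]|]; case: b => [[|k]|] //=; congr (- _);
  exact: eq_geo.
Qed.

Lemma dlog_op_scale s a b k x n e :
  k * dlog_op s a b x n e = dlog_op s a b (fun m f => k * x m f) n e.
Proof.
by case: a => [[|j]|]; case: b => [[|l]|] //=;
  rewrite ?mulr0// ?mulrN -?geo_scale.
Qed.

Lemma dlog_op_letter s a b c x n e :
  dlog_op s a b (letter_op2 s c x) n e = letter_op2 s c (dlog_op s a b x) n e.
Proof.
have H0 : letter_op2 s c (fun _ _ => 0) n e = 0.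
  rewrite -[RHS](mul0r (letter_op2 s c x n e)) -letter_op2_scale.
  by apply: eq_letter_op2 => m f; rewrite mul0r.
have HN (z : nat -> nat -> R) :
    letter_op2 s c (fun m f => - z m f) n e = - letter_op2 s c z n e.
  by rewrite -mulN1r -letter_op2_scale; apply: eq_letter_op2 => m f; rewrite mulN1r.
have Hg j : geo (s j) (letter_op2 s c x n) e =
    letter_op2 s c (fun m f => geo (s j) (x m) f) n e.
  by case: c {H0 HN} => [[|k]|] //=; [exact: geo_geo1|exact: geo_geo2].
by case: a => [[|j]|]; case: b => [[|l]|] //=; rewrite ?HN ?Hg.
Qed.

Lemma removal_val_cons s a t n e : n != 0%N ->
  n%:R * removal_val s (removal_cons a t) n e = letter_op2 s a (removal_val s t) n e.
Proof.
case: t => [[[g a'] b'] u] n0 /=.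
rewrite letter_op2_scale mulrCA; congr (_ * _).
rewrite dlog_op_scale -dlog_op_letter.
apply: eq_dlog_op => f; exact: mul_hlog2.
Qed.

(** The total differential of an iterated integral, in the direction y d/dy.  Both sides
    are multiplied by n, which takes off the first letter, and the induction hypothesis is
    applied to the rest of the word.  What remains is a check on the first two letters; it
    rests on [geo2_balance] and [geo_geo1_geo2]. *)
Lemma hlog2_euler s a w n e : admissible (a :: w) ->
  e%:R * hlog2 s (a :: w) n e =
  (-1) ^+ nonzero_letter a * dlog_top s a (hlog2 s w) n e +
  \sum_(t <- removals (a :: w)) removal_val s t n e.
Proof.
elim: w a n e => [|b w IH] a n e adm.
  rewrite /= big_seq1 /=; case: a adm => [[|j]|] //= _.
    rewrite /= expr1 expr0 mul1r mulN1r addNr.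
    by case: e => [|e]; rewrite ?mul0r// geo1 big1 ?mul0r ?mulr0// => i _; rewrite andbF.
  rewrite expr1 mulN1r opprK mulr0 addr0.
  have := geo2_balance (s j) (hlog2 s [::]) n e.
  have -> : geo2 (s j) (fun m f => f%:R * hlog2 s [::] m f) n e = 0.
    elim: n e => [|n IHn] [|e] //=; rewrite IHn addr0.
    by case: e => [|e]; rewrite ?mul0r ?andbF mulr0 ?mulr0.
  have -> : geo2 (s j) (fun m f => m%:R * hlog2 s [::] m f) n e = 0.
    elim: n e => [|n IHn] [|e] //=; rewrite IHn addr0.
    by case: n {IHn} => [|n]; rewrite ?mul0r mulr0 ?mulr0.
  rewrite !addr0 /= mulrA => <-.
  case: n => [|n]; first by rewrite !mul0r.
  by rewrite mulrC mulKf // pnatr_eq0.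
have admb : admissible (b :: w) by [].
case: n => [|n].
  have z0 : forall f, hlog2 s (b :: w) 0 f = 0 by move=> f; exact: hlog2_0.
  rewrite hlog2_0 mulr0.
  have -> : dlog_top s a (hlog2 s (b :: w)) 0 e = 0.
    by case: a {adm} => [[|j]|] //; rewrite /dlog_top ?z0 //= oppr0.
  have H0 c d x : (forall f, x 0%N f = 0) -> dlog_op s c d x 0 e = 0.
    have G0 k : geo k (fun _ => 0) e = 0.
      by elim: (e) => //= e' ->; rewrite addr0 mulr0.
    move=> x0; rewrite (@eq_dlog_op _ _ _ x (fun _ _ => 0)) //.
    by case: c => [[|j]|]; case: d => [[|l]|] //=; rewrite G0 oppr0.
  rewrite mulr0 add0r big1_seq // => t /andP[_].
  rewrite inE => /orP[/eqP -> /=|].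
    by rewrite H0 ?mulr0.
  by move=> /mapP[[[[g c] d] u] _ ->] /=; rewrite H0 ?mulr0 // => f; exact: hlog2_0.
have n0 : n.+1%:R != 0 :> R by rewrite pnatr_eq0.
apply: (mulfI n0); rewrite mulrCA mul_hlog2 // mulrDr mulr_sumr.
pose phi := hlog2 s (b :: w); pose psi := hlog2 s w.
rewrite -/phi.
have nphi m f : m%:R * phi m f = letter_op2 s b psi m f by exact: mul_hlog2_admissible.
change (removals (a :: b :: w)) with
  ((~~ nonzero_letter a, a, b, b :: w) ::
   map (removal_cons a) ((nonzero_letter b, a, b, w) :: removals (b :: w))).
rewrite big_cons map_cons big_cons big_map.
under [in RHS]eq_bigr do rewrite removal_val_cons //.
rewrite removal_val_cons // -letter_op2_sum.
rewrite (@eq_letter_op2 _ a (fun m f => \sum_(i <- removals (b :: w)) removal_val s i m f)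
  (fun m f => f%:R * phi m f +
     - (-1) ^+ nonzero_letter b * dlog_top s b psi m f)); last first.
  by move=> m f; rewrite /phi IH // -/psi; ring.
rewrite letter_op2_add !letter_op2_scale.
have -> : n.+1%:R * removal_val s (~~ nonzero_letter a, a, b, b :: w) n.+1 e =
  (-1) ^+ (~~ nonzero_letter a) * dlog_op s a b (letter_op2 s b psi) n.+1 e.
  rewrite /= mulrCA; congr (_ * _); rewrite dlog_op_scale.
  by apply: eq_dlog_op => f; rewrite nphi.
rewrite -(dlog_op_letter s a b a) -/psi.
move: n.+1 {n0} (nphi n.+1) => {}n nphin.
clearbody phi psi; clear IH adm admb; rewrite (mulrCA n%:R).
case: a => [[|j]|]; rewrite /nonzero_letter /= ?expr1 ?expr0.
- case: b nphi nphin => [[|k]|] nphi nphin /=; rewrite ?expr1 ?expr0.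
  + rewrite nphin /= geo_scale; ring.
  + rewrite nphin /= geo_scale !mulN1r mul1r.
    rewrite (_ : geo 1 (fun m => - geo2 (s k) psi m e) n =
      - geo2 (s k) (fun m f => geo 1 (psi^~ f) m) n e); last first.
      rewrite -geo1_geo2 -mulN1r -geo_scale; apply: eq_geo => m _; exact/esym/mulN1r.
    rewrite (geo_geo1_geo2 (s k) psi n e) geo_geo2; ring.
  + rewrite nphin /= geo_scale; ring.
- have := geo2_balance (s j) phi n e.
  rewrite (@eq_geo2 _ (fun m f => m%:R * phi m f) _ _ _ nphi).
  case: b nphi nphin => [[|k]|] nphi nphin /=; rewrite ?expr1 ?expr0 ?mulr0 => E.
  + rewrite geo_geo2 (geo_geo1_geo2 (s j) psi n e).
    lra.
  + rewrite (_ : geo2 (s j) (fun m f => - geo2 (s k) psi m f) n e =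
      - geo2 (s j) (geo2 (s k) psi) n e); last first.
      rewrite -mulN1r -geo2_scale; apply: eq_geo2 => m f; exact/esym/mulN1r.
    lra.
  + lra.
- case: b nphi nphin => [[|k]|] nphi nphin /=; rewrite ?expr1 ?expr0 nphin /=; ring.
Qed.

Lemma hlog2_ge0 s w n e : (forall j, 0 <= s j) -> 0 <= hlog2 s w n e.
Proof.
move=> s0; elim: w n e => [|a w IH] n e; first by rewrite /= ler0n.
rewrite /= divr_ge0//; case: a => [[|j]|] /=; rewrite ?geo_ge0 ?geo2_ge0//.
Qed.

Lemma hlog2_gt s w n e : (n < e)%N -> hlog2 s w n e = 0.
Proof.
elim: w n e => [|a w IH] n e ne /=.
  by case: e ne => // e _; rewrite andbF.
case: a => [[|j]|] /=; last by rewrite IH// mul0r.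
  by rewrite geo1 big1 ?mul0r// => i _; rewrite IH// (leq_trans _ ne) // ltnS ltnW.
suff -> : geo2 (s j) (hlog2 s w) n e = 0 by rewrite mul0r.
elim: n e ne => // n IHn [|e] //= ne; by rewrite IH // IHn // addr0 mulr0.
Qed.

(** The weights seen from the point t = y u, when the singular points are y and the 1/s_j. *)
Definition scaled_weights s (y : R) : nat -> R :=
  fun j => if j is k.+1 then y * s k else 1.

Lemma hlog_hlog2 s w (y : R) n : hlog (scaled_weights s y) w n =
  \sum_(e < n.+1) y ^+ e * hlog2 s w n e.
Proof.
elim: w n => [|a w IH] n /=.
  rewrite big_ord_recl expr0 mul1r big1 ?addr0 ?andbT// => i _.
  by rewrite andbF mulr0.
under eq_bigr do rewrite mulrA; rewrite -mulr_suml; congr (_ / _).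
case: a => [[|j]|] //=.
- rewrite geo1 (eq_bigr (fun m : 'I_n => \sum_(e < n.+1) y ^+ e * hlog2 s w m e)).
    by rewrite exchange_big; apply: eq_bigr => e _ /=; rewrite geo1 mulr_sumr.
  move=> m _; rewrite IH [RHS](big_ord_widen_cond n.+1 xpredT (fun e => y ^+ e * hlog2 s w m e))
      //=.
  rewrite (big_ord_widen_cond n.+1 xpredT (fun e => y ^+ e * hlog2 s w m e)) //=; last by
      rewrite ltnS ltnW.
  rewrite big_mkcond [RHS]big_mkcond /=; apply: eq_bigr => e _.
  rewrite ltn_ord; case: ifP => // /negbT; rewrite -leqNgt => me.
  by rewrite hlog2_gt ?mulr0.
- elim: n => [|n IHn] /=; first by rewrite big_ord1 mulr0.
  rewrite IHn IH [in RHS]big_ord_recl /= mulr0 add0r -big_split mulr_sumr /=.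
  by apply: eq_bigr => e _; rewrite /bump leq0n add1n exprS; ring.
Qed.

End Coef2.

From mathcomp Require Import all_classical all_reals all_analysis.
From mathcomp Require Import measurable_realfun.
Import Order.TTheory GRing.Theory Num.Theory.
From mathcomp Require Import complex.
Import numFieldNormedType.Exports.
Local Open Scope classical_set_scope.
Local Open Scope ring_scope.

(** * Convergence, and recursions for series with shifted denominators *)

Section HasSum.
Variable R : realType.
Implicit Types (x y : nat -> R) (l : R).

(** Convergence of a series to a given sum, sealed so that unification does not unfold
    [series] and limits. *)
Variant has_sum x l : Prop := HasSum of series x n @[n --> \oo] --> l.

Lemma has_sumE x l : has_sum x l <-> series x n @[n --> \oo] --> l.
Proof. by split => [[]|]. Qed.

Definition total x : R := limn (series x).

Lemma has_sum_total x l : has_sum x l -> total x = l.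
Proof. by move=> /has_sumE; exact: cvg_lim. Qed.

Lemma has_sumP x l : has_sum x l -> has_sum x (total x).
Proof. by move=> h; rewrite (has_sum_total h). Qed.

Lemma has_sum_uniq x l l' : has_sum x l -> has_sum x l' -> l = l'.
Proof. by move=> /has_sum_total <- /has_sum_total <-. Qed.

Lemma eq_has_sum x y l : x =1 y -> has_sum x l -> has_sum y l.
Proof. by move=> /funext ->. Qed.

Lemma has_sumD x y l k : has_sum x l -> has_sum y k -> has_sum (fun n => x n + y n) (l + k).
Proof.
move=> /has_sumE hx /has_sumE hy; apply/has_sumE.
rewrite (_ : series _ = (fun n => series x n + series y n)); last first.
  by apply/funext => n; rewrite /series /= big_split.
exact: cvgD.
Qed.

Lemma has_sumZ c x l : has_sum x l -> has_sum (fun n => c * x n) (c * l).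
Proof.
move=> /has_sumE hx; apply/has_sumE.
rewrite (_ : series _ = (fun n => c * series x n)); last first.
  by apply/funext => n; rewrite /series /= mulr_sumr.
by apply: cvgM => //; exact: cvg_cst.
Qed.

Lemma has_sumN x l : has_sum x l -> has_sum (fun n => - x n) (- l).
Proof.
by move=> /(@has_sumZ (-1)); rewrite mulN1r; apply: eq_has_sum => n; rewrite mulN1r.
Qed.

Lemma has_sumB x y l k : has_sum x l -> has_sum y k -> has_sum (fun n => x n - y n) (l - k).
Proof. by move=> hx hy; apply: has_sumD => //; exact: has_sumN. Qed.

Lemma has_sum0 : has_sum (fun=> 0) 0.
Proof.
apply/has_sumE; rewrite (_ : series _ = fun=> 0); first exact: cvg_cst.
by apply/funext => n; rewrite /series /= big1.
Qed.

Lemma has_sum_big I (r : seq I) (P : pred I) (F : I -> nat -> R) (L : I -> R) :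
  (forall i, P i -> has_sum (F i) (L i)) ->
  has_sum (fun n => \sum_(i <- r | P i) F i n) (\sum_(i <- r | P i) L i).
Proof.
move=> h; elim: r => [|i r IH].
  by rewrite big_nil; apply: eq_has_sum has_sum0 => n; rewrite big_nil.
rewrite big_cons; case: ifP => Pi.
  by apply: eq_has_sum (has_sumD (h i Pi) IH) => n; rewrite big_cons Pi.
by apply: eq_has_sum IH => n; rewrite big_cons Pi.
Qed.

Lemma has_sum_recl x l : has_sum x l <-> has_sum (fun n => x n.+1) (l - x 0%N).
Proof.
have E n : series x n.+1 = x 0%N + series (fun n => x n.+1) n.
  by rewrite /series /= big_nat_recl.
split=> /has_sumE h; apply/has_sumE.
  rewrite (_ : series _ = (fun n => series x (n + 1)%N - x 0%N)); last first.
    by apply/funext => n; rewrite addn1 E; ring.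
  apply: cvgB; last exact: cvg_cst.
  by move: h; rewrite -(cvg_shiftn 1).
rewrite -(cvg_shiftn 1).
rewrite (_ : (fun n => series x (n + 1)%N) = (fun n => x 0%N + series (fun n => x n.+1) n)).
  rewrite (_ : l = x 0%N + (l - x 0%N)); last by ring.
  by apply: cvgD => //; exact: cvg_cst.
by apply/funext => n; rewrite addn1 E.
Qed.

Lemma has_sum_shift x l : x 0%N = 0 -> has_sum x l -> has_sum (fun n => x n.+1) l.
Proof. by move=> x0 /has_sum_recl; rewrite x0 subr0. Qed.

Lemma nondecreasing_series_ge0 x : (forall n, 0 <= x n) -> nondecreasing_seq (series x).
Proof.
move=> x0; apply/nondecreasing_seqP => n.
by rewrite /series /= big_nat_recr //= lerDl.
Qed.

Lemma has_sum_bounded x M : (forall n, 0 <= x n) -> (forall n, series x n <= M) ->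
  has_sum x (total x).
Proof.
move=> x0 xM; apply/has_sumE; apply: nondecreasing_is_cvgn; first exact: nondecreasing_series_ge0.
by exists M => _ [n _ <-].
Qed.

Lemma has_sum_ge x l : (forall n, 0 <= x n) -> has_sum x l -> forall n, series x n <= l.
Proof.
move=> x0 h n; rewrite -(has_sum_total h).
apply: nondecreasing_cvgn_le; first exact: nondecreasing_series_ge0.
by apply/cvg_ex; exists l; apply/has_sumE.
Qed.

Lemma has_sum_ge0 x l : (forall n, 0 <= x n) -> has_sum x l -> 0 <= l.
Proof. by move=> x0 /(has_sum_ge x0) /(_ 0%N); rewrite /series /= big_geq. Qed.

Lemma has_sum_le x y l : (forall n, 0 <= x n <= y n) -> has_sum y l ->
  has_sum x (total x).
Proof.
move=> xy h; apply: (@has_sum_bounded _ l) => n; first by case/andP: (xy n).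
apply: le_trans (has_sum_ge _ h n).
  by apply: ler_sum => i _; case/andP: (xy i).
by move=> m; case/andP: (xy m) => /le_trans; apply.
Qed.

Lemma has_sum_cvg0 x l : has_sum x l -> x n @[n --> \oo] --> (0 : R).
Proof. by move=> /has_sumE h; apply: cvg_series_cvg_0; apply/cvg_ex; exists l. Qed.

Lemma has_sum_fin1 (k : R) : has_sum (fun n => (n == 0%N)%:R * k) k.
Proof.
apply/has_sum_recl; rewrite eqxx mul1r subrr.
by apply: eq_has_sum has_sum0 => n; rewrite mul0r.
Qed.

Lemma nneseries_has_sum x l : (forall n, 0 <= x n) -> has_sum x l ->
  (\sum_(n <oo) (x n)%:E = l%:E)%E.
Proof.
move=> x0 /has_sumE h; apply/cvg_lim => //.
rewrite (_ : (fun n => _) = EFin \o series x); last first.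
  by apply/funext => n; rewrite /series /= sumEFin.
by apply: cvg_EFin => //; exact: nearW.
Qed.

Lemma has_sum_nneseries x l : (forall n, 0 <= x n) ->
  (\sum_(n <oo) (x n)%:E = l%:E)%E -> has_sum x l.
Proof.
move=> x0 h; have c : cvgn (series x) by apply: nnseries_is_cvg => //; rewrite h ltry.
have h' : has_sum x (limn (series x)) by apply/has_sumE.
by move: (nneseries_has_sum x0 h'); rewrite h => -[->].
Qed.

End HasSum.

Section Sums.
Variable R : realType.
Implicit Types (b : nat -> R) (w : word).

(** The value at z = 1. *)
Definition Phi b w := total (hlog b w).

(** Summation by parts, 1/(n (n+1)) being a difference. *)
Lemma sum_hlog_summation_by_parts b j w M : b j = 1 ->
  \sum_(0 <= n < M) hlog b (Some j :: w) n / n.+1%:R =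
  \sum_(0 <= n < M) hlog b w n / n.+1%:R - geo 1 (hlog b w) M / M%:R.
Proof.
move=> bj; elim: M => [|M IH]; first by rewrite !big_geq//= mul0r subr0.
rewrite !big_nat_recr //= IH bj.
case: M {IH} => [|M]; first by rewrite !big_geq//= !mul0r !divr1; ring.
have h1 : M.+1%:R != 0 :> R by rewrite pnatr_eq0.
have h2 : M.+1%:R + 1 != 0 :> R by rewrite natr1 pnatr_eq0.
rewrite /= mul1r -![M.+2%:R]natr1.
field; by rewrite -[X in X + 1 != 0]addrC ![1 + M%:R]addrC natr1 h1 h2.
Qed.

(** The bound does not depend on the word: it suffices to treat the weights 1, and then
    prefixing a letter does not increase the sum.  The convergence of all series of
    coefficients rests on it. *)
Lemma sum_hlog_div_le1 b w M : (forall j, 0 <= b j <= 1) ->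
  \sum_(0 <= n < M) hlog b w n / n.+1%:R <= 1.
Proof.
move=> b1; apply: (@le_trans _ _ (\sum_(0 <= n < M) hlog (fun=> 1) w n / n.+1%:R)).
  by apply: ler_sum => n _; rewrite ler_wpM2r ?invr_ge0// le_hlog.
elim: w M => [|a w IH] M.
  case: M => [|M]; first by rewrite big_geq ?ler01.
  rewrite big_nat_recl //= divr1 big1 ?addr0// => i _; exact: mul0r.
apply: le_trans (IH M); case: a => [j|].
  rewrite sum_hlog_summation_by_parts // gerBl divr_ge0// geo_ge0// => m; exact: hlog_ge0.
apply: ler_sum => -[|n] _; first by rewrite hlog0 mul0r divr_ge0 ?hlog_ge0.
rewrite ler_wpM2r ?invr_ge0//= ler_pdivrMr ?ltr0n// ler_peMr ?hlog_ge0//.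
by rewrite ler1n.
Qed.

Section Fixed.
Variable b : nat -> R.
Hypothesis b1 : forall j, 0 <= b j <= 1.

Let b_ge0 j : 0 <= b j. Proof. by case/andP: (b1 j). Qed.
Let c_ge0 w n : 0 <= hlog b w n. Proof. exact: hlog_ge0. Qed.
Let g_ge0 j w n : 0 <= geo (b j) (hlog b w) n. Proof. exact: geo_ge0. Qed.

(** These series arise from integrals of t^(p-1) (ln y - ln t)^(k-1) against
    hyperlogarithms. *)
Definition Ssum w p k := total (fun n => hlog b w n / (n + p)%:R ^+ k).
(** The analogue of [Ssum] for a word that starts with the letter j, without the
    denominator n. *)
Definition Tsum j w p k := total (fun n => geo (b j) (hlog b w) n / (n + p)%:R ^+ k).

Lemma has_sum_hlog_div w : has_sum (fun n => hlog b w n / n.+1%:R) (total (fun n => hlog b w n /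
    n.+1%:R)).
Proof. by apply: (@has_sum_bounded _ _ 1) => n; [exact: divr_ge0|exact: sum_hlog_div_le1]. Qed.

Lemma has_Ssum w p k : (0 < p)%N -> (0 < k)%N ->
  has_sum (fun n => hlog b w n / (n + p)%:R ^+ k) (Ssum w p k).
Proof.
move=> p0 k0; apply: has_sum_le (has_sum_hlog_div w) => n.
rewrite divr_ge0 ?exprn_ge0//= ler_wpM2l// lef_pV2 ?posrE ?exprn_gt0 ?ltr0n ?addn_gt0 ?p0 ?orbT//.
rewrite -(prednK k0) exprS (@le_trans _ _ (n + p)%:R) ?ler_nat//.
  by rewrite -addn1 leq_add2l.
by rewrite ler_peMr// exprn_ege1// ler1n addn_gt0 p0 orbT.
Qed.

Lemma has_Phi0 w : has_sum (hlog b (None :: w)) (Phi b (None :: w)).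
Proof.
apply: has_sum_le (has_sumZ 2 (has_sum_hlog_div w)) => -[|n]; first by rewrite hlog0 mulr_ge0
    ?divr_ge0 ?lexx.
rewrite divr_ge0//= mulrCA ler_wpM2l// ler_pdivlMr ?ltr0n// mulrC.
by rewrite ler_pdivrMr ?ltr0n// -natrM ler_nat mul2n -addnn addnS !ltnS leq_addr.
Qed.

(** The partial sums X satisfy X <= b_j X + 1. *)
Lemma has_Phi_lt1 j w : b j < 1 -> has_sum (hlog b (Some j :: w)) (Phi b (Some j :: w)).
Proof.
move=> bj; have bj' : 0 < 1 - b j by rewrite subr_gt0.
apply: (@has_sum_bounded _ _ (1 - b j)^-1) => // M.
suff h : series (hlog b (Some j :: w)) M.+1 <=
    b j * series (hlog b (Some j :: w)) M + \sum_(0 <= n < M) hlog b w n / n.+1%:R.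
  elim: M h => [|M IH] h; first by rewrite /series /= big_geq// invr_ge0 ltW.
  have : series (hlog b (Some j :: w)) M.+1 <= series (hlog b (Some j :: w)) M.+2.
    by apply/nondecreasing_series_ge0 => //.
  move=> /le_trans /(_ h); set X := series _ _ => /(le_trans) hX.
  have {}hX : X <= b j * X + 1 by apply: hX; rewrite lerD2l sum_hlog_div_le1.
  by rewrite -div1r ler_pdivlMr// mulrC mulrBl mul1r lerBlDl.
rewrite /series /= big_nat_recl //= mul0r add0r mulr_sumr -big_split /=.
apply: ler_sum => n _.
rewrite mulrDr mulrDl addrC lerD//.
  by rewrite ler_wpM2r ?invr_ge0// ler_piMl//; case/andP: (b1 j).
case: n => [|n]; first by rewrite /= !(mulr0, mul0r).
by rewrite -mulrA ler_wpM2l// ler_wpM2l// lef_pV2 ?posrE ?ltr0n// ler_nat.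
Qed.

(** For a first letter of weight 1 the series may diverge, but its terms are at most the
    Cesaro means of a sequence that tends to 0. *)
Lemma hlog_cvg0 w : hlog b w n @[n --> \oo] --> (0 : R).
Proof.
elim: w => [|a w IH].
  rewrite -(cvg_shiftn 1); apply: cvg_near_cst; apply: nearW => n.
  by rewrite /= addn1.
case: a => [j|]; last exact: has_sum_cvg0 (has_Phi0 w).
have h := cesaro IH.
rewrite -(cvg_shiftn 1).
apply: (@squeeze_cvgr _ _ _ _ (fun=> 0) (arithmetic_mean (hlog b w))) => //; last exact: cvg_cst.
apply: nearW => n; change (0 <= hlog b (Some j :: w) (n + 1)%N <= arithmetic_mean (hlog b w) n).
rewrite addn1 c_ge0 /= /arithmetic_mean /=.
rewrite -[X in X / _]/(geo (b j) (hlog b w) n.+1) mulrC ler_wpM2l ?invr_ge0//.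
rewrite /series /= big_mkord -geo1; rewrite -[X in X <= _]/(geo (b j) (hlog b w) n.+1).
apply: le_geo; first exact: b1.
by move=> m; rewrite lexx c_ge0.
Qed.

Lemma Ssum_nil p k : (0 < p)%N -> (0 < k)%N -> Ssum [::] p k = (p%:R ^+ k)^-1.
Proof.
move=> p0 k0; apply: (has_sum_uniq (has_Ssum _ p0 k0)).
by apply: eq_has_sum (has_sum_fin1 _) => -[|n] //=; rewrite !mul0r.
Qed.

Lemma Phi_nil : Phi b [::] = 1.
Proof.
apply: has_sum_total; apply: eq_has_sum (has_sum_fin1 1) => n; exact: mulr1.
Qed.

Lemma has_Phi w : (forall j, head None w = Some j -> b j < 1) ->
  has_sum (hlog b w) (Phi b w).
Proof.
case: w => [_|[j|] w h]; last exact: has_Phi0.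
  by rewrite Phi_nil; apply: eq_has_sum (has_sum_fin1 1) => n; exact: mulr1.
by apply: has_Phi_lt1; exact: h.
Qed.

Let pfrac (c : R) n p k : (0 < p)%N -> (0 < n)%N ->
  (c / n%:R) / (n + p)%:R ^+ k.+1 =
  p%:R^-1 * (c / n%:R / (n + p)%:R ^+ k - c / (n + p)%:R ^+ k.+1).
Proof.
move=> p0 n0; rewrite natrD exprS.
have h1 : p%:R != 0 :> R by rewrite pnatr_eq0 -lt0n.
have h2 : n%:R != 0 :> R by rewrite pnatr_eq0 -lt0n.
have h3 : n%:R + p%:R != 0 :> R by rewrite -natrD pnatr_eq0 -lt0n addn_gt0 n0.
have h4 : (n%:R + p%:R) ^+ k != 0 :> R by rewrite expf_neq0.
by field; rewrite h1 h2 h3 h4.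
Qed.

(** Partial fractions for 1/(n (n+p)^(k+1)). *)
Lemma Ssum_zero a w p k : (0 < p)%N ->
  Ssum (None :: a :: w) p k.+1 =
  p%:R^-1 * ((if k is 0 then Phi b (None :: a :: w) else Ssum (None :: a :: w) p k)
             - Ssum (a :: w) p k.+1).
Proof.
move=> p0; apply: (has_sum_uniq (has_Ssum _ p0 (ltn0Sn k))).
have h : has_sum (fun n => hlog b (None :: a :: w) n / (n + p)%:R ^+ k)
    (if k is 0 then Phi b (None :: a :: w) else Ssum (None :: a :: w) p k).
  case: k => [|k]; last exact: has_Ssum.
  by apply: eq_has_sum (has_Phi0 _) => n; rewrite expr0 divr1.
apply: eq_has_sum (has_sumZ p%:R^-1 (has_sumB h (has_Ssum (a :: w) p0 (ltn0Sn k)))) => n.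
case: n => [|n]; first by rewrite !hlog0 !mul0r subrr mulr0.
by rewrite -pfrac.
Qed.

Lemma has_Tsum0 j w k : (b j < 1) || (1 < k)%N -> (0 < k)%N ->
  has_sum (fun n => geo (b j) (hlog b w) n / n%:R ^+ k)
    (Phi b (nseq k.-1 None ++ Some j :: w)).
Proof.
move=> hk k0.
have E n : geo (b j) (hlog b w) n / n%:R ^+ k = hlog b (nseq k.-1 None ++ Some j :: w) n.
  case: k hk k0 => // k _ _ /=; elim: k => [|k IH]; first by rewrite expr1.
  by rewrite exprSr invfM mulrA IH.
apply: (@eq_has_sum _ _ _ _ (fun n => esym (E n))).
case: k hk k0 {E} => // -[|k] /=; first by rewrite orbF => bj _; exact: has_Phi_lt1.
by move=> _ _; exact: has_Phi0.
Qed.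

(** The recursion of [geo] links the shifts p and p - 1. *)
Lemma has_Tsum j w p k : 0 < b j -> (b j < 1) || (1 < k)%N -> (0 < k)%N ->
  has_sum (fun n => geo (b j) (hlog b w) n / (n + p)%:R ^+ k) (Tsum j w p k)
  /\ ((0 < p)%N -> Tsum j w p k = (b j)^-1 * Tsum j w p.-1 k - Ssum w p k).
Proof.
move=> bj0 hk k0; elim: p => [|p [IH _]].
  split=> //; apply: has_sumP; apply: eq_has_sum (has_Tsum0 w hk k0) => n.
  by rewrite addn0.
have := has_sum_shift _ IH; rewrite /= mul0r => /(_ erefl) h1.
have h2 := has_sumB (has_sumZ (b j)^-1 h1) (has_Ssum w (ltn0Sn p) k0).
have {}h2 : has_sum (fun n => geo (b j) (hlog b w) n / (n + p.+1)%:R ^+ k)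
    ((b j)^-1 * Tsum j w p k - Ssum w p.+1 k).
  apply: eq_has_sum h2 => n; rewrite addSnnS.
  rewrite !mulrA mulVf ?gt_eqF// mul1r -mulrBl; congr (_ / _); ring.
by split; [exact: has_sumP h2|move=> _; exact: has_sum_total h2].
Qed.

Lemma Tsum0 j w k : (b j < 1) || (1 < k)%N -> (0 < k)%N ->
  Tsum j w 0 k = Phi b (nseq k.-1 None ++ Some j :: w).
Proof.
move=> hk k0; apply: has_sum_total; apply: eq_has_sum (has_Tsum0 w hk k0) => n.
by rewrite addn0.
Qed.

Lemma Ssum_some j w p k : 0 < b j -> (b j < 1) || (0 < k)%N -> (0 < p)%N ->
  Ssum (Some j :: w) p k.+1 =
  p%:R^-1 * ((if k is 0 then Phi b (Some j :: w) else Ssum (Some j :: w) p k)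
             - Tsum j w p k.+1).
Proof.
move=> bj0 hk p0; apply: (has_sum_uniq (has_Ssum _ p0 (ltn0Sn k))).
have h : has_sum (fun n => hlog b (Some j :: w) n / (n + p)%:R ^+ k)
    (if k is 0 then Phi b (Some j :: w) else Ssum (Some j :: w) p k).
  case: k hk => [|k] hk; last exact: has_Ssum.
  rewrite orbF in hk.
  by apply: eq_has_sum (has_Phi_lt1 _ hk) => n; rewrite expr0 divr1.
have [hT _] := @has_Tsum j w p k.+1 bj0 hk isT.
apply: eq_has_sum (has_sumZ p%:R^-1 (has_sumB h hT)) => n.
case: n => [|n]; first by rewrite hlog0 /= !mul0r subrr mulr0.
by rewrite -pfrac.
Qed.

(** Here neither part of the partial fraction 1/(n (n+p)) = (1/n - 1/(n+p))/p converges, but the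
    difference telescopes. *)
Lemma Ssum_one j w p : b j = 1 -> (0 < p)%N ->
  Ssum (Some j :: w) p 1 = p%:R^-1 * \sum_(0 <= i < p) Ssum w i.+1 1.
Proof.
move=> bj p0; apply: (has_sum_uniq (has_Ssum _ p0 (ltn0Sn 0))).
pose u n := geo (b j) (hlog b w) n.
have step i : has_sum (fun n => u n / (n + i)%:R - u n / (n + i.+1)%:R) (Ssum w i.+1 1).
  apply/has_sumE.
  have E M : series (fun n => u n / (n + i)%:R - u n / (n + i.+1)%:R) M =
      series (fun n => hlog b w n / (n + i.+1)%:R) M - u M / (M + i)%:R.
    elim: M => [|M IH]; first by rewrite /series /= !big_geq// /u /= mul0r subrr.
    rewrite /series /= !big_nat_recr //= -/(series _ M) -/(series _ M) in IH *.
    rewrite IH /u /= bj -/(u M) addSnnS; ring.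
  rewrite (_ : series _ = fun M => series (fun n => hlog b w n / (n + i.+1)%:R) M - u M / (M +
      i)%:R); last exact/funext.
  rewrite -[Ssum _ _ _]subr0; apply: cvgB.
    apply/has_sumE; apply: eq_has_sum (@has_Ssum w i.+1 1 isT isT) => n; by rewrite expr1.
  apply: (squeeze_cvgr _ (cvg_cst (0 : R)) (hlog_cvg0 (Some j :: w))).
    apply: nearW => n; rewrite divr_ge0 ?/u ?g_ge0//=.
    case: n => [|n]; first by rewrite /= !mul0r.
    by rewrite ler_wpM2l// lef_pV2 ?posrE ?ltr0n// ler_nat leq_addr.
have h := has_sumZ p%:R^-1 (@has_sum_big _ _ (index_iota 0 p) xpredT _ _ (fun i _ => step i)).
apply: eq_has_sum h => n; rewrite expr1.
rewrite [X in _ * X](_ : _ = u n / n%:R - u n / (n + p)%:R); last first.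
  elim: (p) => [|q IHq]; first by rewrite big_geq// addn0 subrr.
  by rewrite big_nat_recr //= IHq; ring.
case: n => [|n]; first by rewrite hlog0 /u /= !mul0r subrr mulr0.
have h1 : p%:R != 0 :> R by rewrite pnatr_eq0 -lt0n.
have := @pfrac (u n.+1) n.+1 p 0 p0 isT; by rewrite expr1 expr0 divr1 => <-.
Qed.

End Fixed.
End Sums.

(** * Multiple zeta values as values of hyperlogarithms *)

Section Cauchy.
Variable R : realType.
Implicit Types x y : nat -> R.

Lemma series_cauchy_prod x y n :
  series (cauchy_prod x y) n = \sum_(i < n) x i * series y (n - i)%N.
Proof.
elim: n => [|n IH]; first by rewrite /series /= big_geq// big_ord0.
rewrite seriesSr IH /cauchy_prod.
rewrite [in RHS](eq_bigr (fun i : 'I_n.+1 => x i * series y (n - i)%N + x i * y (n - i)%N));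
    last first.
  move=> i _; rewrite -mulrDr subSn; last by rewrite -ltnS.
  by rewrite seriesSr.
rewrite big_split /= [in RHS]big_ord_recr /= subnn.
by rewrite [X in _ + _ * X](_ : _ = 0) ?mulr0 ?addr0 // /series /= big_geq.
Qed.

(** Mertens for nonnegative series: the product of the n-th partial sums is at most the
    2n-th partial sum of the Cauchy product. *)
Lemma has_sum_cauchy_prod x y X Y : (forall n, 0 <= x n) -> (forall n, 0 <= y n) ->
  has_sum x X -> has_sum y Y -> has_sum (cauchy_prod x y) (X * Y).
Proof.
move=> x0 y0 hx hy.
have X0 := has_sum_ge0 x0 hx. have Y0 := has_sum_ge0 y0 hy.
have sx0 n : 0 <= series x n by rewrite /series /= sumr_ge0.
have sy0 n : 0 <= series y n by rewrite /series /= sumr_ge0.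
have c0 n : 0 <= cauchy_prod x y n by apply: sumr_ge0 => i _; rewrite mulr_ge0.
have up n : series (cauchy_prod x y) n <= X * Y.
  rewrite series_cauchy_prod; apply: (@le_trans _ _ (series x n * Y)).
    rewrite /series /= big_mkord mulr_suml; apply: ler_sum => i _.
    by rewrite ler_wpM2l// has_sum_ge.
  by rewrite ler_wpM2r// has_sum_ge.
have h := has_sum_bounded c0 up.
rewrite (_ : X * Y = total (cauchy_prod x y)) //.
apply/eqP; rewrite eq_le; apply/andP; split; last first.
  move/has_sumE: h => h; rewrite /total; apply: limr_le; last exact: nearW.
  by apply/cvg_ex; exists (total (cauchy_prod x y)).
move/has_sumE: (hx) => hx'; move/has_sumE: (hy) => hy'.
have hXY : (fun n => series x n * series y n) @ \oo --> X * Y by exact: cvgM.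
rewrite -(cvg_lim _ hXY)//; apply: limr_le; first by apply/cvg_ex; exists (X * Y).
apply: nearW => n; apply: (@le_trans _ _ (series (cauchy_prod x y) (n + n)%N)); last exact:
    has_sum_ge.
rewrite series_cauchy_prod big_split_ord /= {1}/series /= big_mkord mulr_suml.
rewrite -[X in X <= _]addr0 lerD//; last by apply: sumr_ge0 => i _; rewrite mulr_ge0.
apply: ler_sum => i _; rewrite ler_wpM2l//.
apply: nondecreasing_series_ge0 => //.
by rewrite -addnBA ?leq_addr// ltnW.
Qed.

End Cauchy.

Section MZV.
Variable R : realType.

(** Each entry a of the index contributes a - 1 letters 0 and one letter of weight 1.  The
    word starts with the block of the last entry, which belongs to the largest summation
    index. *)
Definition zeta_word (k : seq nat) : word :=
  foldl (fun w a => nseq a.-1 None ++ Some 0%N :: w) [::] k.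

Lemma zeta_word_rcons k a :
  zeta_word (rcons k a) = nseq a.-1 None ++ Some 0%N :: zeta_word k.
Proof. by rewrite /zeta_word foldl_rcons. Qed.

Lemma hlog_nseq (b : nat -> R) c w n :
  hlog b (nseq c None ++ w) n = hlog b w n / n%:R ^+ c.
Proof.
elim: c => [|c IH]; first by rewrite expr0 divr1.
by rewrite /= IH exprSr invfM mulrA.
Qed.

Definition chains r n : set (seq nat) :=
  [set t | [/\ size t = r, path ltn 0%N t & last 0%N t = n]].

Definition zeta_term (k t : seq nat) : \bar R :=
  ((\prod_(j < size k) (nth 0%N t j)%:R ^+ nth 0%N k j)^-1)%:E.

Lemma zeta_term_ge0 k t : (0 <= zeta_term k t)%E.
Proof. by rewrite lee_fin invr_ge0 prodr_ge0. Qed.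

Lemma le_esumZ (T : choiceType) (S : set T) (a : T -> \bar R) (c : R) :
  0 <= c -> (forall t, 0 <= a t)%E ->
  (\esum_(t in S) (c%:E * a t) <= c%:E * \esum_(t in S) a t)%E.
Proof.
move=> c0 a0; apply: ge_ereal_sup => _ [F [fF FS] <-].
rewrite -ge0_mule_fsumr // lee_wpmul2l ?lee_fin//.
by apply: ereal_sup_ubound; exists F.
Qed.

Lemma esumZ (T : choiceType) (S : set T) (a : T -> \bar R) (c : R) :
  0 <= c -> (forall t, 0 <= a t)%E ->
  (\esum_(t in S) (c%:E * a t) = c%:E * \esum_(t in S) a t)%E.
Proof.
move=> c0 a0; apply/eqP; rewrite eq_le le_esumZ //=.
have [->|cn0] := eqVneq c 0.
  by rewrite mul0e; apply: esum_ge0 => t _; rewrite mul0e.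
have c_gt0 : 0 < c by rewrite lt_def cn0.
have ci : 0 <= c^-1 by rewrite invr_ge0.
have ca0 t : (0 <= c%:E * a t)%E by rewrite mule_ge0 ?lee_fin.
have := @le_esumZ _ S (fun t => c%:E * a t)%E c^-1 ci ca0.
rewrite (eq_esum (b := a)); last first.
  by move=> t _; rewrite muleA -EFinM mulVf// mul1e.
move=> h; rewrite -[leRHS]mul1e -(mulfV cn0) EFinM -muleA.
by rewrite lee_wpmul2l ?lee_fin.
Qed.

(** With weights 1, [geo] sums over all smaller indices, so unfolding the coefficients
    gives the multiple sum with prescribed largest index. *)
Lemma esum_chains k n : all (leq 1) k ->
  (\esum_(t in chains (size k) n) zeta_term k t = (hlog (fun=> 1) (zeta_word k) n)%:E)%E.
Proof.
elim/last_ind: k n => [|k a IH] n hk.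
  rewrite /= (_ : chains 0 n = if n == 0%N then [set [::]] else set0).
    case: eqP => _; last by rewrite esum_set0.
    by rewrite esum_set1 ?zeta_term_ge0// /zeta_term big_ord0 invr1.
  apply/seteqP; split => [t [/size0nil -> _ /= <-]|t]; first by rewrite eqxx.
  by case: eqP => // -> ->.
move: hk; rewrite all_rcons => /andP[a1 hk].
rewrite zeta_word_rcons hlog_nseq /= geo1 size_rcons.
have bij : set_bij (`I_n `*`` (chains (size k))) (chains (size k).+1 n)
    (fun p => rcons p.2 n).
  split.
  - move=> [m t] [/= mn [st pt lt]]; split; rewrite ?size_rcons ?st ?last_rcons//.
    by rewrite rcons_path pt lt.
  - move=> [m t] [m' t'] /set_mem [/= _ [_ _ lt]] /set_mem [/= _ [_ _ lt']].
    by move=> /rcons_inj [tt']; rewrite -lt -lt' tt'.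
  - move=> t [st pt lt]; case/lastP: t st pt lt => [//|t x].
    rewrite size_rcons last_rcons rcons_path => -[st] /andP[pt xt] xn.
    by exists (last 0%N t, t) => /=; rewrite ?xn //; split => //=; rewrite -xn.
rewrite (reindex_esum _ _ _ _ bij).
rewrite -(@esum_esum R _ _ `I_n (chains (size k)) (fun _ t => zeta_term (rcons k a) (rcons t
    n))); last first.
  by move=> *; exact: zeta_term_ge0.
transitivity (\esum_(m in `I_n) ((n%:R ^+ a)^-1 * hlog (fun=> 1 : R) (zeta_word k) m)%R%:E)%E.
  apply: eq_esum => m mn; rewrite EFinM -IH//.
  transitivity (\esum_(t in chains (size k) m) ((n%:R ^+ a)^-1%:E * zeta_term k t))%E.
    apply: eq_esum => t [st _ _]; rewrite /zeta_term size_rcons big_ord_recr /=.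
    rewrite !nth_rcons -st ltnn eqxx -EFinM -invfM; congr (_^-1)%R%:E.
    rewrite mulrC; congr (_ * _); apply: eq_bigr => j _.
    by rewrite !nth_rcons -st ltn_ord.
  by apply: esumZ => [|t]; [rewrite invr_ge0 exprn_ge0|exact: zeta_term_ge0].
rewrite esum_fset//; last first.
  by move=> m _; rewrite lee_fin mulr_ge0 ?invr_ge0 ?exprn_ge0 ?hlog_ge0.
rewrite -fsbig_ord sumEFin -mulr_sumr mulrC.
by case: a a1 {bij} => // a _; rewrite -mulrA -invfM -exprS.
Qed.

Definition ones : nat -> R := fun=> 1.

Definition zeta_letters (w : word) := word_letters (fun j => j = 0%N) w.

Lemma ones_le j : 0 <= ones j <= 1. Proof. by rewrite /ones ler01 lexx. Qed.

Lemma has_Phi_ones w : head None w != Some 0%N -> zeta_letters w ->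
  has_sum (hlog ones w) (Phi ones w).
Proof.
case: w => [|[j|] w] //= h hw; last exact: has_Phi0 ones_le _.
  rewrite Phi_nil; apply: eq_has_sum (has_sum_fin1 1) => n; exact: mulr1.
by move: h; rewrite (hw j) ?inE ?eqxx.
Qed.

Lemma zeta_word_admissible k : admissible (zeta_word k).
Proof.
elim/last_ind: k => [//|k a IH]; rewrite zeta_word_rcons /admissible last_cat /=.
by case: (zeta_word k) IH.
Qed.

Lemma zeta_word_letters k : zeta_letters (zeta_word k).
Proof.
elim/last_ind: k => [//|k a IH] j; rewrite zeta_word_rcons mem_cat inE.
by case/or3P => [/nseqP[]//|/eqP[]//|/IH].
Qed.

Lemma zeta_word_head k : (1 < last 2 k)%N -> head None (zeta_word k) != Some 0%N.
Proof.
by case/lastP: k => [//|k a]; rewrite last_rcons zeta_word_rcons; case: a => [|[|a]].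
Qed.

Lemma mzv_Phi k : mzv_admissible k -> mzv R k = Phi ones (zeta_word k).
Proof.
move=> /andP[hk lk]; rewrite /mzv.
have bij : set_bij [set n : (size k).-tuple nat | path ltn 0%N n]
    [set t : seq nat | size t = size k /\ path ltn 0%N t] (fun t => tval t).
  split.
  - by move=> t /= pt; rewrite size_tuple.
  - by move=> t t' _ _; exact: val_inj.
  - move=> t /= [st pt]; have /eqP st' := st.
    by exists (Tuple st').
have -> : (\esum_(n in [set n : (size k).-tuple nat | path ltn 0%N n])
    ((\prod_(j < size k) (tnth n j)%:R ^+ nth 0%N k j)^-1 : R)%:E)%E =
    (\esum_(t in [set t : seq nat | size t = size k /\ path ltn 0%N t]) zeta_term k t)%E.
  rewrite (reindex_esum _ _ _ _ bij); apply: eq_esum => t _.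
  rewrite /zeta_term; congr (_^-1)%R%:E; apply: eq_bigr => j _.
  by rewrite (tnth_nth 0%N).
have -> : [set t : seq nat | size t = size k /\ path ltn 0%N t] =
    \bigcup_n chains (size k) n.
  apply/seteqP; split => t /=; first by move=> [st pt]; exists (last 0%N t).
  by move=> [n _ []].
rewrite esum_bigcupT; last 2 first.
- by apply/trivIsetP => i j _ _ ij; apply/seteqP; split => // t [[_ _ e] [_ _ e']];
     rewrite -e -e' eqxx in ij.
- by move=> t; exact: zeta_term_ge0.
under eq_esum do rewrite esum_chains//.
rewrite -nneseries_esumT; last by move=> n; rewrite lee_fin hlog_ge0.
rewrite (nneseries_has_sum _ (has_Phi_ones (zeta_word_head lk) (@zeta_word_letters k)))//.
by move=> n; exact: hlog_ge0.
Qed.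

Lemma zeta_word_surj w : admissible w -> zeta_letters w ->
  exists2 k, all (leq 1) k & w = zeta_word k.
Proof.
elim: w => [|a w IH] adm hw; first by exists [::].
have hw' : zeta_letters w by move=> j jw; apply: hw; rewrite inE jw orbT.
case: a adm hw => [j|] adm hw.
  have [|k hk ->] := IH _ hw'; first by case: (w) adm.
  exists (rcons k 1%N); first by rewrite all_rcons.
  by rewrite zeta_word_rcons (hw j) ?inE ?eqxx.
case: w IH hw' adm {hw} => [|b w] IH hw' adm //.
have [k hk E] := IH adm hw'.
case/lastP: k hk E => [//|k a]; rewrite all_rcons => /andP[a1 hk] E.
exists (rcons k a.+1); first by rewrite all_rcons hk.
by rewrite E !zeta_word_rcons; case: (a) a1.
Qed.

Lemma Phi_mzv w : admissible w -> zeta_letters w -> head None w != Some 0%N ->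
  exists2 k, mzv_admissible k & Phi ones w = mzv R k.
Proof.
move=> adm hw hh; have [k hk E] := zeta_word_surj adm hw.
have ak : mzv_admissible k.
  rewrite /mzv_admissible hk /=; case/lastP: k hk E => [//|k a] hk E.
  move: hh hk; rewrite E zeta_word_rcons last_rcons all_rcons.
  by case: a {E} => [|[|a]].
by exists k => //; rewrite mzv_Phi // E.
Qed.

Definition mzv_span (z : R) : Prop :=
  exists2 c : seq (rat * seq nat), all (fun x => mzv_admissible x.2) c &
    z = \sum_(x <- c) ratr x.1 * mzv R x.2.

Lemma mzv_spanD x y : mzv_span x -> mzv_span y -> mzv_span (x + y).
Proof.
move=> [c hc ->] [d hd ->]; exists (c ++ d); first by rewrite all_cat hc.
by rewrite big_cat.
Qed.

Lemma mzv_span0 : mzv_span 0.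
Proof. by exists [::]; rewrite ?big_nil. Qed.

Lemma mzv_spanZ q x : mzv_span x -> mzv_span (ratr q * x).
Proof.
move=> [c hc ->]; exists [seq (q * t.1, t.2) | t <- c]; first by rewrite all_map.
by rewrite big_map mulr_sumr; apply: eq_bigr => t _ /=; rewrite rmorphM mulrA.
Qed.

Lemma mzv_spanN x : mzv_span x -> mzv_span (- x).
Proof. by move=> /(mzv_spanZ (-1)); rewrite rmorphN1 mulN1r. Qed.

Lemma mzv_span_sum (I : eqType) (r : seq I) (F : I -> R) :
  (forall i, i \in r -> mzv_span (F i)) -> mzv_span (\sum_(i <- r) F i).
Proof.
elim: r => [|i r IH] h; first by rewrite big_nil; exact: mzv_span0.
rewrite big_cons; apply: mzv_spanD; first by apply: h; rewrite inE eqxx.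
by apply: IH => j jr; apply: h; rewrite inE jr orbT.
Qed.

Lemma mzv_span_Phi w : admissible w -> zeta_letters w -> head None w != Some 0%N ->
  mzv_span (Phi ones w).
Proof.
move=> adm hw hh; have [k ak ->] := Phi_mzv adm hw hh.
by exists [:: (1, k)]; rewrite /= ?ak// big_seq1 rmorph1 mul1r.
Qed.

Lemma mzv_spanQ q : mzv_span (ratr q).
Proof.
rewrite -[ratr q]mulr1; apply: mzv_spanZ; rewrite -(Phi_nil ones).
exact: mzv_span_Phi.
Qed.

(** By the shuffle product, since the shuffles of two convergent words are convergent. *)
Lemma mzv_spanM_mzv k l : mzv_admissible k -> mzv_admissible l ->
  mzv_span (mzv R k * mzv R l).
Proof.
move=> ak al; rewrite !mzv_Phi//.
case/andP: ak => _ lk; case/andP: al => _ ll.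
set u := zeta_word k; set v := zeta_word l.
have hu : head None u != Some 0%N by exact: zeta_word_head.
have hv : head None v != Some 0%N by exact: zeta_word_head.
have zu : zeta_letters u by exact: zeta_word_letters.
have zv : zeta_letters v by exact: zeta_word_letters.
have au : admissible u by exact: zeta_word_admissible.
have av : admissible v by exact: zeta_word_admissible.
have hx x : x \in shuffle u v -> head None x != Some 0%N.
  by move=> /(head_shuffle None) [->|->].
have zx x : x \in shuffle u v -> zeta_letters x.
  by move=> xs j jx; have /orP[/zu|/zv] := mem_shuffle xs jx.
have h := has_sum_cauchy_prod (fun n => hlog_ge0 u n (fun j => ler01))
  (fun n => hlog_ge0 v n (fun j => ler01)) (has_Phi_ones hu zu) (has_Phi_ones hv zv).
have h' : has_sum (cauchy_prod (hlog ones u) (hlog ones v)) (\sum_(x <- shuffle u v) Phi ones x).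
  have : has_sum (fun n => \sum_(x <- shuffle u v | x \in shuffle u v) hlog ones x n)
      (\sum_(x <- shuffle u v | x \in shuffle u v) Phi ones x).
    by apply: has_sum_big => x xs; apply: has_Phi_ones; [exact: hx|exact: zx].
  rewrite -big_seq; apply: eq_has_sum => n.
  by rewrite -big_seq cauchy_prod_hlog.
rewrite (has_sum_uniq h h'); apply: mzv_span_sum => x xs.
by apply: mzv_span_Phi; [exact: admissible_shuffle xs|exact: zx|exact: hx].
Qed.

Lemma mzv_spanM x y : mzv_span x -> mzv_span y -> mzv_span (x * y).
Proof.
move=> [c hc ->] [d hd ->]; rewrite mulr_suml; apply: mzv_span_sum => s sc.
rewrite mulr_sumr; apply: mzv_span_sum => t td.
rewrite mulrACA -rmorphM; apply: mzv_spanZ; apply: mzv_spanM_mzv.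
  by move/allP: hc; apply.
by move/allP: hd; apply.
Qed.

End MZV.

(** * Eliminating the letter of weight 1 *)

Section Key.
Variable R : realType.
Implicit Types (s : nat -> R) (w : word).

(** The end point y lies to the left of the singular points 1/s_j. *)
Definition valid_weights s (y : R) := 0 < y /\ forall j, 0 < s j /\ y * s j < 1.

(** The coefficient of y^e in [Phi (scaled_weights s y) w] (see [has_Phi_Phi2]). *)
Definition Phi2 s w e : R := total (fun n => hlog2 s w n e).

(** [dlog_op] after summation over the degree in z. *)
Definition dlog_op1 s (a b : letter) (x : nat -> R) : nat -> R :=
  match a, b with
  | None, Some 0 | Some 0, None => x
  | Some 0, Some j.+1 | Some j.+1, Some 0 => fun e => - geo (s j) x e
  | _, _ => fun=> 0
  end.

Lemma dlog_op1E s a b x n e : dlog_op s a b x n e = dlog_op1 s a b (x n) e.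
Proof. by case: a => [[|j]|]; case: b => [[|k]|]. Qed.

Lemma has_sum_geo c (x : nat -> nat -> R) X e : (forall f, has_sum (x^~ f) (X f)) ->
  has_sum (fun n => geo c (x n) e) (geo c X e).
Proof.
move=> h; elim: e => [|e IH] /=; first exact: has_sum0.
by apply: has_sumZ; apply: has_sumD.
Qed.

Lemma has_sum_dlog_op1 s a b (x : nat -> nat -> R) X e : (forall f, has_sum (x^~ f) (X f)) ->
  has_sum (fun n => dlog_op1 s a b (x n) e) (dlog_op1 s a b X e).
Proof.
by move=> h; case: a => [[|j]|]; case: b => [[|k]|] //=;
  try exact: has_sum0; apply: has_sumN; exact: has_sum_geo.
Qed.

Lemma has_sum_geo2 c (x : nat -> nat -> R) X e : (forall f, has_sum (x^~ f) (X f)) ->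
  has_sum (fun n => geo2 c x n e) (geo c X e).
Proof.
move=> h; elim: e => [|e IH].
  by apply: eq_has_sum (has_sum0 _) => -[].
apply/has_sum_recl; rewrite /= subr0.
by apply: has_sumZ; apply: has_sumD.
Qed.

Lemma geo_cvg0 c (x : nat -> nat -> R) e :
  (forall f, x n f @[n --> \oo] --> (0 : R)) -> geo c (x n) e @[n --> \oo] --> (0 : R).
Proof.
move=> h; elim: e => [|e IH] /=; first exact: cvg_cst.
rewrite -(mulr0 c) -(addr0 (0 : R)); apply: cvgM; first exact: cvg_cst.
exact: cvgD.
Qed.

Lemma geo2_cvg0 c (x : nat -> nat -> R) e :
  (forall f, x n f @[n --> \oo] --> (0 : R)) -> geo2 c x n e @[n --> \oo] --> (0 : R).
Proof.
move=> h; elim: e => [|e IH].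
  apply: cvg_near_cst; apply: nearW; by case.
rewrite -(cvg_shiftn 1).
have H : c * (x n e + geo2 c x n e) @[n --> \oo] --> c * (0 + 0).
  by apply: cvgM; [exact: cvg_cst|exact: cvgD].
rewrite addr0 mulr0 in H; apply: cvg_trans H; apply: near_eq_cvg.
by apply: nearW => n; rewrite /= addn1.
Qed.

Section Fixed.
Variables (s : nat -> R) (y : R).
Hypothesis sy : valid_weights s y.
Let b := scaled_weights s y.

Let y0 : 0 < y. Proof. by case: sy. Qed.
Let s0 j : 0 < s j. Proof. by case: sy => _ /(_ j) []. Qed.
Let sy1 j : y * s j < 1. Proof. by case: sy => _ /(_ j) []. Qed.
Let s_ge0 j : 0 <= s j. Proof. exact: ltW. Qed.

Lemma valid_weights_le1 j : 0 <= b j <= 1.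
Proof. by case: j => [|j] /=; rewrite ?ler01 ?lexx// mulr_ge0 ?ltW. Qed.

Lemma has_Phi_valid w : head None w != Some 0%N -> has_sum (hlog b w) (Phi b w).
Proof.
move=> hw; apply: (has_Phi valid_weights_le1) => -[|j] e; last exact: sy1.
by rewrite e in hw.
Qed.

Lemma le_hlog2 w n e : 0 <= hlog2 s w n e <= (y ^+ e)^-1 * hlog b w n.
Proof.
rewrite hlog2_ge0//= mulrC ler_pdivlMr ?exprn_gt0// mulrC /b hlog_hlog2.
have [en|ne] := leqP e n.
  rewrite (bigD1 (Ordinal (en : (e < n.+1)%N))) //= lerDl sumr_ge0// => i _.
  by rewrite mulr_ge0 ?hlog2_ge0 ?exprn_ge0 ?ltW.
rewrite hlog2_gt// mulr0 sumr_ge0// => i _.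
by rewrite mulr_ge0 ?hlog2_ge0 ?exprn_ge0 ?ltW.
Qed.

Lemma has_Phi2 w e : head None w != Some 0%N ->
  has_sum (fun n => hlog2 s w n e) (Phi2 s w e).
Proof.
move=> hw; apply: has_sum_le (has_sumZ (y ^+ e)^-1 (has_Phi_valid hw)) => n.
exact: le_hlog2.
Qed.

Lemma hlog2_cvg0 w e : hlog2 s w n e @[n --> \oo] --> (0 : R).
Proof.
apply: (@squeeze_cvgr _ _ _ _ (fun=> 0) (fun n => (y ^+ e)^-1 * hlog b w n)).
- by apply: nearW => n; exact: le_hlog2.
- exact: cvg_cst.
- rewrite -(mulr0 ((y ^+ e)^-1)); apply: cvgM; first exact: cvg_cst.
  apply: hlog_cvg0; exact: valid_weights_le1.
Qed.

Lemma Phi2_ge0 w e : head None w != Some 0%N -> 0 <= Phi2 s w e.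
Proof. by move=> hw; apply: has_sum_ge0 (has_Phi2 e hw) => n; exact: hlog2_ge0. Qed.

(** All terms are nonnegative, so the two summations may be exchanged. *)
Lemma has_Phi_Phi2 w : head None w != Some 0%N ->
  has_sum (fun e => y ^+ e * Phi2 s w e) (Phi b w).
Proof.
move=> hw.
have t0 n e : 0 <= y ^+ e * hlog2 s w n e by rewrite mulr_ge0 ?exprn_ge0 ?hlog2_ge0 ?ltW.
apply: has_sum_nneseries => [e|].
  by rewrite mulr_ge0 ?exprn_ge0 ?Phi2_ge0// ltW.
rewrite -(nneseries_has_sum _ (has_Phi_valid hw)); last first.
  by move=> n; apply: hlog_ge0 => j; case/andP: (valid_weights_le1 j).
transitivity (\sum_(e <oo) \sum_(n <oo) (y ^+ e * hlog2 s w n e)%:E)%E.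
  apply: eq_eseriesr => e _; apply/esym/nneseries_has_sum => //.
  exact: has_sumZ (has_Phi2 e hw).
rewrite nneseries_interchange; last by move=> i j; rewrite lee_fin.
apply: eq_eseriesr => n _; rewrite /b hlog_hlog2.
apply: nneseries_has_sum => //.
apply/has_sumE; apply: cvg_near_cst.
exists n.+1 => // m /= nm.
rewrite /series /= (@big_cat_nat _ _ _ n.+1) //= [X in _ + X]big1_seq; last first.
  by move=> i; rewrite mem_index_iota => /andP[_ /andP[ni _]]; rewrite hlog2_gt ?mulr0.
by rewrite addr0 big_mkord.
Qed.

Lemma has_sum_top a w e : head None w != Some 0%N ->
  has_sum (fun n => dlog_top s a (hlog2 s w) n e)
    (if a is Some 0 then Phi2 s w e else dlog_op1 s (Some 0%N) a (Phi2 s w) e).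
Proof.
move=> hw; case: a => [[|j]|] /=; try exact: has_Phi2.
by apply: has_sumN; apply: has_sum_geo2 => f; exact: has_Phi2.
Qed.

(** Summed over all n, the operators [geo2] and [geo] have the same effect although the
    individual series need not converge: by [geo_geo1_geo2] the partial sums differ by terms
    that tend to 0.  This takes care of the upper end point 1 when the second letter has
    weight 1. *)
Lemma has_sum_cancel j w e :
  has_sum (fun n => geo2 (s j) (hlog2 s w) n e - geo (s j) (hlog2 s w n) e) 0.
Proof.
apply/has_sumE.
set x := hlog2 s w.
rewrite (_ : series _ = fun M => - (geo2 (s j) x M e + geo2 (s j) (fun m => geo (s j) (x m)) M e)).
  rewrite -oppr0; apply: cvgN; rewrite -(addr0 (0 : R)); apply: cvgD.
    by apply: geo2_cvg0 => f; exact: hlog2_cvg0.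
  by apply: geo2_cvg0 => f; apply: geo_cvg0 => f'; exact: hlog2_cvg0.
apply/funext => M; rewrite /series /= sumrB !big_mkord.
rewrite -(geo1 (fun n => geo2 (s j) x n e)) -(geo1 (fun n => geo (s j) (x n) e)).
rewrite -geo_geo1 geo_geo1_geo2 geo1_geo2; ring.
Qed.

Definition removal_total (t : removal) e : R :=
  let: (g, a, b, u) := t in (-1) ^+ g * dlog_op1 s a b (Phi2 s u) e.

(** The terms of the Euler identity at z = 1.  The upper end point then acts like a letter of
    weight 1; if the second letter has weight 1 as well, the two terms that remove the first
    letter cancel. *)
Definition euler_terms w : seq removal :=
  if w is a :: w' then
    if head None w' == Some 0%N then behead (removals w)
    else (nonzero_letter a, Some 0%N, a, w') :: removals w
  else [::].

Lemma has_removal_val t e : head None t.2 != Some 0%N ->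
  has_sum (fun n => removal_val s t n e) (removal_total t e).
Proof.
case: t => [[[g c] d] u] /= hu; apply: has_sumZ.
apply: (@eq_has_sum _ (fun n => dlog_op1 s c d (hlog2 s u n) e)).
  by move=> n; rewrite -dlog_op1E.
by apply: has_sum_dlog_op1 => f; exact: has_Phi2.
Qed.

End Fixed.

Lemma removals_cons2 a b w : removals (a :: b :: w) =
  (~~ nonzero_letter a, a, b, b :: w) ::
  map (removal_cons a) ((nonzero_letter b, a, b, w) :: removals (b :: w)).
Proof. by []. Qed.

Lemma removals_size w t : t \in removals w -> size t.2 = (size w).-1.
Proof.
elim: w t => [//|a [|b w] IH] t; first by rewrite inE => /eqP ->.
rewrite removals_cons2 inE => /orP[/eqP -> //|] /mapP[[[[g c] d] u] tin ->] /=.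
by move: tin; rewrite inE => /orP[/eqP[_ _ _ ->]//|/IH /= ->].
Qed.

Lemma removals_letters w t : t \in removals w ->
  [/\ forall c, t.1.1.2 = Some c -> Some c \in w,
      forall c, t.1.2 = Some c -> Some c \in w
    & {subset t.2 <= w}].
Proof.
elim: w t => [//|a [|b w] IH] t.
  by rewrite inE => /eqP -> /=; split => // c ->; rewrite inE.
have sub v : {subset v <= b :: w} -> {subset a :: v <= [:: a, b & w]}.
  move=> h c'; rewrite inE => /orP[/eqP ->|/h c'in]; first by rewrite inE eqxx.
  by rewrite inE c'in orbT.
rewrite removals_cons2 inE => /orP[/eqP -> /=|].
  split=> [c ->|c ->|c cw]; rewrite ?inE ?eqxx ?orbT//.
  by move: cw; rewrite inE => ->; rewrite orbT.
move=> /mapP[[[[g c] d] u] tin ->] /=.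
move: tin; rewrite inE => /orP[/eqP[_ -> -> ->]|/IH [/= h1 h2 h3]].
  split=> [c' ->|c' ->|]; rewrite ?inE ?eqxx ?orbT//.
  by apply: sub => c' c'in; rewrite inE c'in orbT.
split=> [c' /h1 h|c' /h2 h|]; try by rewrite inE h orbT.
exact: sub.
Qed.

Lemma Phi2_euler s y a b' w e : valid_weights s y -> admissible (a :: b' :: w) ->
  a != Some 0%N ->
  e%:R * Phi2 s (a :: b' :: w) e =
  \sum_(t <- euler_terms (a :: b' :: w)) removal_total s t e.
Proof.
move=> v adm a0.
have h1 := has_sumZ e%:R (has_Phi2 v e (a0 : head None (a :: b' :: w) != _)).
apply: (has_sum_uniq h1).
apply: (@eq_has_sum _ (fun n => (-1) ^+ nonzero_letter a * dlog_top s a (hlog2 s (b' :: w)) n e +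
  \sum_(t <- removals (a :: b' :: w)) removal_val s t n e)).
  by move=> n; rewrite -hlog2_euler.
rewrite /euler_terms removals_cons2.
set tl := map _ _.
have hr : has_sum (fun n => \sum_(t <- tl) removal_val s t n e)
    (\sum_(t <- tl) removal_total s t e).
  rewrite [X in has_sum _ X]big_seq.
  apply: (@eq_has_sum _ (fun n => \sum_(t <- tl | t \in tl) removal_val s t n e)).
    by move=> n; rewrite -big_seq.
  apply: has_sum_big => t tin; apply: (has_removal_val v).
  by move: tin; case/mapP => [[[[g c] d] u] _ ->].
clearbody tl.
have hb (hb' : head None (b' :: w) != Some 0%N) :=
  @has_removal_val s y v (~~ nonzero_letter a, a, b', b' :: w) e hb'.
have htop (hb' : head None (b' :: w) != Some 0%N) := has_sum_top v a e hb'.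
have hw' : head None (b' :: w) = b' by [].
clear h1 adm; move: (b' :: w) hb htop hw' => w' hb htop hw'.
case: ifPn => hb'.
  apply: (@eq_has_sum _ (fun n => ((-1) ^+ nonzero_letter a * dlog_top s a (hlog2 s w') n e
     + removal_val s (~~ nonzero_letter a, a, b', w') n e) +
     \sum_(t <- tl) removal_val s t n e)).
    by move=> n; rewrite big_cons addrA.
  rewrite -[X in has_sum _ X]add0r; apply: has_sumD => //.
  have -> : b' = Some 0%N by rewrite -hw'; exact/eqP.
  case: a a0 {hb htop} => [[|j]|] //= _.
    apply: eq_has_sum (has_sum_cancel v j w' e) => n.
    by rewrite /= expr1 expr0; ring.
  by apply: eq_has_sum (has_sum0 _) => n; rewrite /= expr1 expr0; ring.
rewrite 2!big_cons; apply: has_sumD.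
  apply: has_sumZ; move: (htop hb').
  by case: a a0 {hb htop} => [[|j]|].
apply: (@eq_has_sum _ (fun n => removal_val s (~~ nonzero_letter a, a, b', w') n e +
     \sum_(t <- tl) removal_val s t n e)).
  by move=> n; rewrite big_cons.
by apply: has_sumD => //; exact: hb.
Qed.

Lemma hlog2_inadmissible s w n e : ~~ admissible w -> hlog2 s w n e = 0.
Proof.
elim: w n e => [//|a [|b w] IH] n e.
  rewrite /admissible negbK => /eqP /= ->.
  by case: n => [|n]; rewrite ?invr0 ?mulr0 ?mul0r.
move=> h; have {}IH n' e' : hlog2 s (b :: w) n' e' = 0 by exact: IH.
change (letter_op2 s a (hlog2 s (b :: w)) n e / n%:R = 0).
suff -> : letter_op2 s a (hlog2 s (b :: w)) n e = 0 by rewrite mul0r.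
rewrite (@eq_letter_op2 _ s a _ (fun n' e' => 0 * hlog2 s w n' e')).
  by rewrite letter_op2_scale mul0r.
by move=> m f; rewrite IH mul0r.
Qed.

Lemma hlog_inadmissible (b : nat -> R) w n : ~~ admissible w -> hlog b w n = 0.
Proof.
elim: w n => [//|a [|c w] IH] n.
  rewrite /admissible negbK => /eqP /= ->.
  by case: n => [|n]; rewrite ?invr0 ?mulr0 ?mul0r.
move=> h; have {}IH n' : hlog b (c :: w) n' = 0 by exact: IH.
change (letter_op b a (hlog b (c :: w)) n / n%:R = 0).
case: a {h} => [j|]; rewrite /letter_op ?IH ?mul0r//.
by rewrite geoE big1 ?mul0r// => i _; rewrite IH mulr0.
Qed.

Lemma hlog2_deg0_zeta s w n : zeta_letters w -> hlog2 s w n 0 = hlog (@ones R) w n.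
Proof.
elim: w n => [|a w IH] n hw; first by rewrite /= andbT.
have hw' : zeta_letters w by move=> j jw; apply: hw; rewrite inE jw orbT.
rewrite /=; congr (_ / _); case: a hw => [j|] hw; last exact: IH.
by rewrite (hw j) ?inE ?eqxx//=; apply: eq_geo => m _; exact: IH.
Qed.

Lemma hlog2_deg0 s w n j : Some j.+1 \in w -> hlog2 s w n 0 = 0.
Proof.
elim: w n => [//|a w IH] n; rewrite inE => /orP[/eqP <-|jw] /=.
  by case: n => [|n] /=; rewrite mul0r.
case: a => [[|k]|] /=; rewrite ?IH ?mul0r//.
  by rewrite geo1 big1 ?mul0r// => i _; exact: IH.
by case: n => [|n] /=; rewrite mul0r.
Qed.

(** The form that the solution of the Euler identity takes: coefficients of hyperlogarithms
    with the weights s, combined linearly with multiple zeta values that do not depend on s. *)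
Definition mzv_rep (P : nat -> Prop) (X : (nat -> R) -> nat -> R) := exists2 D : seq (R * word),
  forall t, t \in D -> mzv_span t.1 /\ word_letters P t.2
  & forall s y, valid_weights s y -> forall e, X s e = \sum_(t <- D) t.1 * hlog s t.2 e.

Lemma mzv_rep_ext P X Y : (forall s y e, valid_weights s y -> X s e = Y s e) -> mzv_rep P X ->
    mzv_rep P Y.
Proof. by move=> XY [D hD E]; exists D => // s y v e; rewrite -(XY s y) // (E s y). Qed.

Lemma mzv_repD P X Y : mzv_rep P X -> mzv_rep P Y -> mzv_rep P (fun s e => X s e + Y s e).
Proof.
move=> [D hD E] [D' hD' E']; exists (D ++ D').
  by move=> t; rewrite mem_cat => /orP[/hD|/hD'].
by move=> s y v e; rewrite (E s y)// (E' s y)// big_cat.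
Qed.

Lemma mzv_rep0 P : mzv_rep P (fun _ _ => 0).
Proof. by exists [::] => // s y v e; rewrite big_nil. Qed.

Lemma mzv_rep_sum P (L : seq removal) X : (forall t, t \in L -> mzv_rep P (X t)) ->
  mzv_rep P (fun s e => \sum_(t <- L) X t s e).
Proof.
elim: L => [|t L IH] h.
  by apply: mzv_rep_ext (mzv_rep0 P) => s y e _; rewrite big_nil.
have := mzv_repD (h t (mem_head _ _)) (IH (fun u uL => h u (mem_behead (s := t :: L) uL))).
by apply: mzv_rep_ext => s y e _; rewrite big_cons.
Qed.

Lemma mzv_repN P X : mzv_rep P X -> mzv_rep P (fun s e => - X s e).
Proof.
move=> [D hD E]; exists [seq (- t.1, t.2) | t <- D].
  by move=> t /mapP[u /hD[h1 h2] ->]; split => //; exact: mzv_spanN.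
move=> s y v e; rewrite (E s y)// big_map -sumrN.
by apply: eq_bigr => t _; rewrite mulNr.
Qed.

(** Dividing by e prefixes the letter 0. *)
Lemma mzv_rep_zero P X : mzv_rep P X -> mzv_rep P (fun s e => X s e / e%:R).
Proof.
move=> [D hD E]; exists [seq (t.1, None :: t.2) | t <- D].
  move=> t /mapP[u /hD[h1 h2] ->]; split => // j; rewrite inE => /orP[//|]; exact: h2.
move=> s y v e; rewrite (E s y)// big_map mulr_suml.
by apply: eq_bigr => t _; rewrite -mulrA.
Qed.

(** Applying [geo] and dividing by e prefixes the letter j. *)
Lemma mzv_rep_geo P X j : P j -> mzv_rep P X -> mzv_rep P (fun s e => geo (s j) (X s) e / e%:R).
Proof.
move=> Pj [D hD E]; exists [seq (t.1, Some j :: t.2) | t <- D].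
  move=> t /mapP[u /hD[h1 h2] ->]; split => // i.
  by rewrite inE => /orP[/eqP[->]//|]; exact: h2.
move=> s y v e.
rewrite (@eq_geo _ (s j) _ (fun m => \sum_(t <- D) t.1 * hlog s t.2 m) e); last first.
  by move=> m _; exact: (E s y).
rewrite geo_sum big_map mulr_suml.
by apply: eq_bigr => t _; rewrite geo_scale -mulrA.
Qed.

Lemma mzv_rep_dlog P X g a b : (forall j, a = Some j.+1 -> P j) -> (forall j, b = Some j.+1 -> P
    j) ->
  mzv_rep P X -> mzv_rep P (fun s e => (-1) ^+ (g : bool) * dlog_op1 s a b (X s) e / e%:R).
Proof.
move=> ha hb h.
suff : mzv_rep P (fun s e => dlog_op1 s a b (X s) e / e%:R).
  case: g => [/mzv_repN|]; apply: mzv_rep_ext => s y e _; rewrite ?expr1 ?expr0; ring.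
have h0 : mzv_rep P (fun s e => 0 / e%:R).
  by apply: mzv_rep_ext (mzv_rep0 P) => s y e _; rewrite mul0r.
have hg j : P j -> mzv_rep P (fun s e => - geo (s j) (X s) e / e%:R).
  by move=> Pj; apply: mzv_rep_ext (mzv_repN (mzv_rep_geo Pj h)) => s y e _; rewrite mulNr.
case: a ha => [[|j]|] ha; case: b hb => [[|k]|] hb //=; first [exact: mzv_rep_zero|by apply: hg;
    auto].
Qed.

Lemma mzv_rep_const P z : mzv_span z -> mzv_rep P (fun _ e => (e == 0%N)%:R * z).
Proof.
move=> hz; exists [:: (z, [::])].
  by move=> t; rewrite inE => /eqP ->.
by move=> s y v e; rewrite big_seq1 mulrC.
Qed.

Lemma euler_terms_spec a b w t : a != Some 0%N -> t \in euler_terms [:: a, b & w] ->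
  [/\ (size t.2 < size [:: a, b & w])%N, head None t.2 != Some 0%N,
      forall j, t.1.1.2 = Some j.+1 -> Some j.+1 \in [:: a, b & w],
      forall j, t.1.2 = Some j.+1 -> Some j.+1 \in [:: a, b & w]
    & {subset t.2 <= [:: a, b & w]}].
Proof.
move=> a0; have tl : t \in behead (removals [:: a, b & w]) -> head None t.2 = a.
  by rewrite removals_cons2 => /mapP[[[[g c] d] u] _ ->].
have inr : t \in removals [:: a, b & w] -> head None t.2 != Some 0%N -> _ :=
  fun tin ht => let: And3 h1 h2 h3 := removals_letters tin in
    And5 (eq_leq (f_equal S (removals_size tin))) ht
      (fun j => h1 j.+1) (fun j => h2 j.+1) h3.
rewrite /euler_terms; case: ifPn => hb tin.
  by apply: inr; [rewrite removals_cons2 inE tin orbT|rewrite (tl tin)].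
move: tin; rewrite inE => /orP[/eqP -> /=|tin].
  split => //; first by move=> j ->; rewrite inE eqxx.
  by move=> c cw; rewrite inE cw orbT.
apply: inr => //; move: tin; rewrite removals_cons2 inE => /orP[/eqP -> //|].
by case/mapP => [[[[g c] d] u] _ ->].
Qed.

(** Integration of the Euler identity, by induction on the length of the word.  Dividing
    by e is possible for e > 0.  The coefficient of degree 0 is that of y = 0: it vanishes if
    a letter y s_j occurs, and is a multiple zeta value otherwise. *)
Lemma Phi2_rep w : head None w != Some 0%N ->
  mzv_rep (fun j => Some j.+1 \in w) (fun s e => Phi2 s w e).
Proof.
have [k] := ubnP (size w); elim: k w => // k IH w szw hw.
have [adm|nadm] := boolP (admissible w); last first.
  apply: mzv_rep_ext (mzv_rep0 _) => s y e v.
  by apply/esym/has_sum_total; apply: eq_has_sum (has_sum0 _) => n; rewrite hlog2_inadmissible.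
case: w szw hw adm => [|a [|b w]] szw hw adm.
- apply: mzv_rep_ext (@mzv_rep_const _ 1 _) => [s y e v|].
    apply/esym/has_sum_total; apply: eq_has_sum (has_sum_fin1 _) => n /=.
    by rewrite mulr1; case: n => [|n]; rewrite ?mul1r ?mul0r.
  rewrite -(rmorph1 (@ratr R)); exact: mzv_spanQ.
- case: a hw adm {szw} => [[|j]|] // _ _.
  exists [:: (1, [:: Some j])].
    move=> t; rewrite inE => /eqP ->; split.
      by rewrite -(rmorph1 (@ratr R)); exact: mzv_spanQ.
    by move=> i; rewrite inE => /eqP[->]; rewrite inE.
  move=> s y v e; rewrite big_seq1 mul1r; apply: has_sum_total.
  apply: (@eq_has_sum _ (fun n => (n == e)%:R * hlog s [:: Some j] e)).
    move=> n.
    have G m f : geo2 (s j) (hlog2 s [::]) m f = (m == f)%:R * geo (s j) (hlog s [::]) f.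
      elim: m f => [|m IHm] [|f] //=; rewrite ?mul0r ?mulr0// IHm eqSS.
      case: (eqVneq m f) => [->|mf]; first by rewrite andbb !mul1r.
      rewrite !mul0r; case: m f mf {IHm} => [|m] [|f] //= _; ring.
    rewrite /= G; case: eqP => [->|_]; by rewrite ?mul0r ?mul1r.
  apply/has_sumE; apply: cvg_near_cst; exists e.+1 => // m /= em.
  rewrite /series /= big_mkord (bigD1 (Ordinal (em : (e < m)%N))) //= eqxx mul1r big1 ?addr0// => i.
  by rewrite -val_eqE /= => /negbTE ->; rewrite mul0r.
set w0 := [:: a, b & w]; pose P := fun j => Some j.+1 \in w0.
have hmain : mzv_rep P (fun s e => \sum_(t <- euler_terms w0) (removal_total s t e / e%:R)).
  apply: mzv_rep_sum => t tin.
  have [sz ht h1 h2 h3] := euler_terms_spec hw tin.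
  case: t tin sz ht h1 h2 h3 => [[[g c] d] u] /= tin sz ht h1 h2 h3.
  apply: mzv_rep_dlog => //.
  have [D hD E] := IH u (leq_trans sz szw) ht.
  exists D => // t /hD[z1 z2]; split => // j jt; apply: h3; exact: z2.
have [[j jw]|nz] := pselect (exists j, Some j.+1 \in w0).
  apply: mzv_rep_ext hmain => s y e v; rewrite -mulr_suml -(Phi2_euler e v adm hw).
  case: e => [|e]; last by rewrite mulrC mulKf// pnatr_eq0.
  rewrite mul0r mul0r; apply/esym/has_sum_total; apply: eq_has_sum (has_sum0 _) => n.
  by rewrite (hlog2_deg0 _ _ jw).
have zw : zeta_letters w0.
  by move=> [|j] jw //; case: nz; exists j.
apply: mzv_rep_ext (mzv_repD hmain (mzv_rep_const P (mzv_span_Phi R adm zw hw))) => s y e v.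
rewrite -mulr_suml -(Phi2_euler e v adm hw).
case: e => [|e]; last by rewrite mul0r addr0 mulrC mulKf// pnatr_eq0.
rewrite mul0r mul0r add0r mul1r; apply/esym/has_sum_total.
apply: eq_has_sum (has_Phi_ones R hw zw) => n.
by rewrite hlog2_deg0_zeta.
Qed.

(** Sum [Phi2_rep] times y^e over e: by [hlog_homog] the powers of y turn the weights s_j
    into y s_j. *)
Lemma Phi_scaled_rep w : head None w != Some 0%N -> exists2 D : seq (R * word),
  forall t, t \in D -> [/\ mzv_span t.1, admissible t.2
                           & word_letters (fun j => Some j.+1 \in w) t.2]
  & forall s y, valid_weights s y -> Phi (scaled_weights s y) w =
      \sum_(t <- D) t.1 * Phi (fun j => y * s j) t.2.
Proof.
move=> hw; have [D hD E] := Phi2_rep hw.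
(* words that are not admissible contribute 0 *)
exists [seq t <- D | admissible t.2].
  by move=> t; rewrite mem_filter => /andP[adm /hD[h1 h2]].
move=> s y v; apply: (has_sum_uniq (has_Phi_Phi2 v hw)).
have b1 j : 0 <= y * s j <= 1.
  by case: v => y0 /(_ j)[s0 sy1]; rewrite mulr_ge0 ?ltW.
have hP u : has_sum (hlog (fun j => y * s j) u) (Phi (fun j => y * s j) u).
  by apply: (has_Phi b1) => j _; case: v => _ /(_ j)[].
apply: (@eq_has_sum _ (fun e => \sum_(t <- [seq t <- D | admissible t.2])
    t.1 * hlog (fun j => y * s j) t.2 e)).
  move=> e; rewrite (E s y)// mulr_sumr big_filter [RHS](bigID (fun t => admissible t.2)) /=.
  rewrite [X in _ = _ + X]big1 ?addr0; last first.
    by move=> t /hlog_inadmissible ->; rewrite !mulr0.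
  by apply: eq_bigr => t _; rewrite hlog_homog mulrCA.
by apply: has_sum_big => t _; exact: has_sumZ.
Qed.

End Key.

(** * Partial fractions *)

Section Reduce.
Variable R : realType.
Implicit Types (s : nat -> R) (y : R) (w : word) (P : nat -> Prop).

Definition inv_monomial s y (js : seq nat) : R := \prod_(j <- js) (y * s j)^-1.

(** The bound p on the number of inverse weights matters: in the integral, the 1/(y s_j)
    have to be compensated by a power of y. *)
Definition reducible P (p : nat) (X : (nat -> R) -> R) := exists2 D : seq (rat * seq nat * word),
  forall t, t \in D -> [/\ (size t.1.2 <= p)%N, forall j, j \in t.1.2 -> P j.+1,
    admissible t.2, head None t.2 != Some 0%N & word_letters P t.2]
  & forall s y, valid_weights s y -> X (scaled_weights s y) =
     \sum_(t <- D) ratr t.1.1 * inv_monomial s y t.1.2 * Phi (scaled_weights s y) t.2.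

Lemma reducible_ext P p X Y : (forall s y, valid_weights s y ->
    X (scaled_weights s y) = Y (scaled_weights s y)) -> reducible P p X -> reducible P p Y.
Proof. by move=> XY [D hD E]; exists D => // s y v; rewrite -XY // E. Qed.

Lemma reducible_widen P p q X : (p <= q)%N -> reducible P p X -> reducible P q X.
Proof.
move=> pq [D hD E]; exists D => // t /hD[h1 h2 h3 h4 h5]; split => //.
exact: leq_trans pq.
Qed.

Lemma reducibleD P p X Y : reducible P p X -> reducible P p Y -> reducible P p (fun b => X b + Y b).
Proof.
move=> [D hD E] [D' hD' E']; exists (D ++ D').
  by move=> t; rewrite mem_cat => /orP[/hD|/hD'].
by move=> s y v; rewrite E // E' // big_cat.
Qed.

Lemma reducibleZ P p q X : reducible P p X -> reducible P p (fun b => ratr q * X b).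
Proof.
move=> [D hD E]; exists [seq (q * t.1.1, t.1.2, t.2) | t <- D].
  by move=> t /mapP[u /hD ? ->].
move=> s y v; rewrite E // big_map mulr_sumr; apply: eq_bigr => t _.
by rewrite rmorphM /= !mulrA.
Qed.

Lemma reducibleB P p X Y : reducible P p X -> reducible P p Y -> reducible P p (fun b => X b - Y b).
Proof.
move=> hX /(reducibleZ (-1)) hY; apply: reducible_ext (reducibleD hX hY) => s y _.
by rewrite rmorphN1 mulN1r.
Qed.

Lemma reducible0 P p : reducible P p (fun=> 0).
Proof. by exists [::] => // s y _; rewrite big_nil. Qed.

Lemma reducible_sum P p n X : (forall i, (i < n)%N -> reducible P p (X i)) ->
  reducible P p (fun b => \sum_(0 <= i < n) X i b).
Proof.
elim: n => [|n IH] h.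
  by apply: reducible_ext (reducible0 P p) => s y _; rewrite big_geq.
apply: reducible_ext (reducibleD (IH (fun i ni => h i (ltnW ni))) (h n (ltnSn n))) => s y _.
by rewrite big_nat_recr.
Qed.

Lemma reducible_inv P p j X : P j -> reducible P p X -> reducible P p.+1 (fun b => (b j)^-1 * X b).
Proof.
case: j => [|j] Pj.
  move/(reducible_widen (leqnSn p)); apply: reducible_ext => s y _.
  by rewrite /= invr1 mul1r.
move=> [D hD E]; exists [seq (t.1.1, j :: t.1.2, t.2) | t <- D].
  move=> t /mapP[u /hD[h1 h2 h3 h4 h5] ->]; split => //= i.
  by rewrite inE => /orP[/eqP ->//|]; exact: h2.
move=> s y v; rewrite E // big_map mulr_sumr; apply: eq_bigr => t _ /=.
by rewrite /inv_monomial big_cons; ring.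
Qed.

Lemma reducible_Phi P p w : admissible w -> head None w != Some 0%N -> word_letters P w ->
  reducible P p (fun b => Phi b w).
Proof.
move=> adm hw Pw; exists [:: (1, [::], w)].
  by move=> t; rewrite inE => /eqP ->.
by move=> s y _; rewrite big_seq1 /= rmorph1 /inv_monomial big_nil !mul1r.
Qed.

Lemma ratr_natV (n : nat) : ratr (n%:R^-1) = n%:R^-1 :> R.
Proof. by rewrite fmorphV rmorph_nat. Qed.

Lemma reducible_Tsum P j w p k : P j -> admissible w -> word_letters P w ->
  (0 < j)%N || (1 < k)%N -> (0 < k)%N ->
  (forall q, (0 < q <= p)%N -> reducible P q (fun b => Ssum b w q k)) ->
  reducible P p (fun b => Tsum b j w p k).
Proof.
move=> Pj adm Pw jk k0.
have bj s y : valid_weights s y -> 0 < scaled_weights s y j /\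
    (scaled_weights s y j < 1) || (1 < k)%N.
  move=> [y0 /(_ j.-1)[s0 sy]]; case: j jk sy s0 {Pj} => [|j] jk sy s0 /=.
    by split; [exact: ltr01|move: jk => /= ->; rewrite orbT].
  by rewrite mulr_gt0 // sy.
elim: p => [|p IH] h.
  apply: reducible_ext (_ : reducible P 0 (fun b => Phi b (nseq k.-1 None ++ Some j :: w))).
    by move=> s y v; have [b0 b1] := bj s y v; rewrite Tsum0 //; exact: valid_weights_le1 v.
  apply: reducible_Phi.
  - by rewrite /admissible last_cat /=; case: (w) adm.
  - by case: k jk {bj h k0} => [|[|k]] //=; rewrite orbF; case: (j).
  - move=> i; rewrite mem_cat inE => /or3P[/nseqP[]//|/eqP[->]//|]; exact: Pw.
apply: reducible_ext (reducibleB (reducible_inv Pj (IH _)) (h p.+1 _)).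
- move=> s y v; have [b0 b1] := bj s y v.
  by have [_ /(_ isT) ->] := @has_Tsum _ _ (valid_weights_le1 v) j w p.+1 k b0 b1 k0.
- by move=> q /andP[q0 qp]; apply: h; rewrite q0 leqW.
- by rewrite leqnn.
Qed.

(** Induction on the word, and for a given word on k: the recursions for [Ssum] and
    [Tsum] shorten the word or decrease k or p. *)
Lemma reducible_Ssum P w p k : admissible w -> word_letters P w -> (0 < p)%N ->
  reducible P p (fun b => Ssum b w p k.+1).
Proof.
elim: w p k => [|a w IH] p k adm Pw p0.
  apply: reducible_ext (reducibleZ ((p ^ k.+1)%:R^-1) (@reducible_Phi P p [::] isT isT _)) => //.
  by move=> s y v; rewrite ratr_natV Phi_nil mulr1 Ssum_nil ?natrX//; exact: valid_weights_le1 v.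
have Pw' : word_letters P w by move=> j jw; apply: Pw; rewrite inE jw orbT.
have admw : admissible w by case: (w) adm.
case: a adm Pw => [j|] adm Pw.
  have Pj : P j by apply: Pw; rewrite inE eqxx.
  have hT k' : (0 < j)%N || (1 < k')%N -> (0 < k')%N -> reducible P p (fun b => Tsum b j w p k').
    move=> jk k0; apply: reducible_Tsum => // q /andP[q0 qp].
    by case: k' k0 {jk} => // k' _; exact: IH.
  have bj s y : valid_weights s y -> 0 < scaled_weights s y j /\
      ((0 < j)%N -> scaled_weights s y j < 1).
    by move=> [y0 /(_ j.-1)[s0 sy]]; case: (j) sy s0 => [|i] sy s0 //=; rewrite mulr_gt0 // sy.
  elim: k => [|k IHk].
    have [j0|j0] := posnP j.
      apply: reducible_ext (reducibleZ p%:R^-1 (@reducible_sum P p p (fun i b => Ssum b w i.+1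
          1) _)).
        move=> s y v; rewrite ratr_natV (Ssum_one (valid_weights_le1 v) w _ p0)//; by rewrite j0.
      by move=> i ip; apply: reducible_widen (IH i.+1 0%N admw Pw' isT).
    apply: reducible_ext (reducibleZ p%:R^-1 (reducibleB (reducible_Phi p adm _ Pw) (hT 1%N _
        isT))) => //.
    + move=> s y v; have [b0 /(_ j0) b1] := bj s y v; rewrite ratr_natV.
      by rewrite (@Ssum_some _ _ (valid_weights_le1 v) j w p 0) // b1.
    + by case: (j) j0.
    + by rewrite j0.
  apply: reducible_ext (reducibleZ p%:R^-1 (reducibleB IHk (hT k.+2 _ isT))); last by rewrite orbT.
  move=> s y v; have [b0 _] := bj s y v; rewrite ratr_natV.
  by rewrite (@Ssum_some _ _ (valid_weights_le1 v) j w p k.+1) // orbT.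
case: w IH Pw' admw adm Pw => [//|c w] IH Pw' admw adm Pw.
elim: k => [|k IHk].
  apply: reducible_ext (reducibleZ p%:R^-1 (reducibleB (reducible_Phi p adm _ Pw) (IH p 0%N admw
      Pw' p0))) => //.
  by move=> s y v; rewrite ratr_natV (@Ssum_zero _ _ (valid_weights_le1 v) c w p 0).
apply: reducible_ext (reducibleZ p%:R^-1 (reducibleB IHk (IH p k.+1 admw Pw' p0))).
by move=> s y v; rewrite ratr_natV (@Ssum_zero _ _ (valid_weights_le1 v) c w p k.+1).
Qed.

Definition scaled_rep P p (X : (nat -> R) -> R -> R) := exists2 D : seq (R * seq nat * word),
  forall t, t \in D -> [/\ mzv_span t.1.1, (size t.1.2 <= p)%N,
     forall j, j \in t.1.2 -> P j.+1, admissible t.2 &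
     word_letters (fun j => P j.+1) t.2]
  & forall s y, valid_weights s y -> X s y =
     \sum_(t <- D) t.1.1 * inv_monomial s y t.1.2 * Phi (fun j => y * s j) t.2.

Lemma Ssum_reduction P w p k : admissible w -> word_letters P w -> (0 < p)%N ->
  scaled_rep P p (fun s y => Ssum (scaled_weights s y) w p k.+1).
Proof.
move=> adm Pw p0; have [D hD E] := reducible_Ssum k adm Pw p0.
suff [D' hD' E'] : scaled_rep P p (fun s y =>
    \sum_(t <- D) ratr t.1.1 * inv_monomial s y t.1.2 * Phi (scaled_weights s y) t.2).
  by exists D' => // s y v; rewrite E // E'.
elim: D hD {E} => [|t D IH] hD; first by exists [::] => // s y _; rewrite !big_nil.
have [D1 hD1 E1] := IH (fun u uD => hD u (mem_behead (s := t :: D) uD)).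
have [h1 h2 h3 h4 h5] := hD t (mem_head _ _).
have [D2 hD2 E2] := Phi_scaled_rep R h4.
exists ([seq (ratr t.1.1 * u.1, t.1.2, u.2) | u <- D2] ++ D1).
  move=> u; rewrite mem_cat => /orP[/mapP[v /hD2[g1 g2 g3] ->]|/hD1//].
  split => //=; first exact: mzv_spanZ.
  by move=> j /g3 /h5.
move=> s y v; rewrite big_cons big_cat big_map E1 // (E2 s y) //; congr (_ + _).
by rewrite mulr_sumr; apply: eq_bigr => u _ /=; ring.
Qed.

End Reduce.

(** * The integral in one variable *)

Section Int.
Variable R : realType.
Local Notation mu := (@lebesgue_measure R).

(** A primitive of t^q (ln y - ln t)^l, found by repeated integration by parts. *)
Fixpoint primitive (q : nat) (y : R) (l : nat) (t : R) : R :=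
  if l is l'.+1 then
    (t ^+ q.+1 * (ln y - ln t) ^+ l + l%:R * primitive q y l' t) / q.+1%:R
  else t ^+ q.+1 / q.+1%:R.

Lemma is_derive_primitive q y l (t : R) : 0 < t ->
  is_derive t 1 (primitive q y l) (t ^+ q * (ln y - ln t) ^+ l).
Proof.
move=> t0; have q0 : q.+1%:R != 0 :> R by rewrite pnatr_eq0.
have t1 : t != 0 by rewrite gt_eqF.
have dl := is_derive1_ln t0.
elim: l => [|l IH].
  rewrite (_ : primitive q y 0 = ((q.+1%:R)^-1 \*: (id ^+ q.+1 : R -> R))); last first.
    by apply/funext => u; rewrite /= !fctE mulrC.
  apply: is_derive_eq.
  by rewrite expr0 /GRing.scale /=; field.
rewrite (_ : primitive q y l.+1 = (q.+1%:R)^-1 \*: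
  ((id ^+ q.+1 : R -> R) * ((cst (ln y) : R -> R) - @ln R) ^+ l.+1 + l.+1%:R \*: primitive q y
      l)); last first.
  by apply/funext => u; rewrite /= !fctE mulrC.
apply: is_derive_eq.
rewrite /GRing.scale /= !fctE /= !exprS; field.
by rewrite ?t1 ?nat1r ?pnatr_eq0.
Qed.

Lemma cvg_exprn_expRN l : n%:R ^+ l * expR (- n%:R) @[n --> \oo] --> (0 : R).
Proof.
apply: (@squeeze_cvgr _ _ _ _ (fun=> 0) (fun n => expR 1 * l.+1`!%:R * harmonic n)).
- apply: nearW => n; rewrite mulr_ge0 ?exprn_ge0 ?expR_ge0//= /harmonic /=.
  have n0 : n.+1%:R != 0 :> R by rewrite pnatr_eq0.
  have -> : expR (- n%:R) = expR 1 * expR (- n.+1%:R) :> R.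
    by rewrite -expRD -natr1; congr expR; ring.
  rewrite mulrCA -mulrA ler_wpM2l ?expR_ge0//.
  rewrite expRN ler_pdivrMr ?expR_gt0// mulrAC ler_pdivlMr ?ltr0n//.
  rewrite (@le_trans _ _ (n.+1%:R ^+ l.+1))//.
    by rewrite exprSr ler_wpM2r// lerXn2r ?nnegrE// ler_nat.
  rewrite mulrC -ler_pdivrMr ?ltr0n ?fact_gt0//.
  have := @expR_ge1Dxn R n.+1%:R l (ler0n _ _); apply: le_trans.
  by rewrite lerDr.
- exact: cvg_cst.
- rewrite -(mulr0 (expR 1 * l.+1`!%:R)); apply: cvgM; first exact: cvg_cst.
  exact: cvg_harmonic.
Qed.

Lemma primitive_cvg0 q (y : R) l : 0 < y ->
  primitive q y l (y * expR (- n%:R)) @[n --> \oo] --> (0 : R).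
Proof.
move=> y0.
have G k : (y * expR (- n%:R)) ^+ q.+1 * n%:R ^+ k @[n --> \oo] --> (0 : R).
  apply: (@squeeze_cvgr _ _ _ _ (fun=> 0) (fun n => y ^+ q.+1 * (n%:R ^+ k * expR (- n%:R)))).
  - apply: nearW => n.
    have e0 : 0 <= expR (- n%:R) :> R by rewrite expR_ge0.
    have e1 : expR (- n%:R) <= 1 :> R by rewrite expR_le1 oppr_le0.
    rewrite mulr_ge0 ?exprn_ge0 ?mulr_ge0 ?(ltW y0)//=.
    rewrite exprMn -mulrA ler_wpM2l ?exprn_ge0 ?(ltW y0)//.
    rewrite mulrC ler_wpM2l ?exprn_ge0// exprS ler_piMr// exprn_ile1//.
  - exact: cvg_cst.
  - rewrite -(mulr0 (y ^+ q.+1)); apply: cvgM; first exact: cvg_cst.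
    exact: cvg_exprn_expRN.
have L n : ln y - ln (y * expR (- n%:R)) = n%:R.
  by rewrite lnM ?posrE ?expR_gt0// expRK; ring.
elim: l => [|l IH].
  have H : ((y * expR (- n%:R)) ^+ q.+1 * n%:R ^+ 0) / q.+1%:R @[n --> \oo]
      --> (0 : R) / q.+1%:R.
    by apply: cvgM; [exact: G|exact: cvg_cst].
  rewrite mul0r in H.
  apply: cvg_trans H; apply: near_eq_cvg; apply: nearW => n /=.
  by rewrite expr0 mulr1.
have H : ((y * expR (- n%:R)) ^+ q.+1 * n%:R ^+ l.+1 +
    l.+1%:R * primitive q y l (y * expR (- n%:R))) / q.+1%:R @[n --> \oo]
    --> ((0 + l.+1%:R * 0) / q.+1%:R : R).
  apply: cvgM; last exact: cvg_cst.
  by apply: cvgD => //; apply: cvgM => //; exact: cvg_cst.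
rewrite mulr0 addr0 mul0r in H.
apply: cvg_trans H; apply: near_eq_cvg; apply: nearW => n /=.
by rewrite L.
Qed.

Lemma primitive_end q y l : primitive q y l y = y ^+ q.+1 * l`!%:R / q.+1%:R ^+ l.+1.
Proof.
elim: l => [|l IH] /=; first by rewrite fact0 mulr1 expr1.
rewrite subrr expr0n /= mulr0 add0r IH factS natrM [q.+1%:R ^+ l.+2]exprS.
by field; rewrite expf_neq0 ?nat1r ?pnatr_eq0.
Qed.

Lemma integral_segment q (y : R) l (a : R) : 0 < a < y ->
  (\int[mu]_(t in `[a, y]) (t ^+ q * (ln y - ln t) ^+ l)%:E =
   (primitive q y l y - primitive q y l a)%:E)%E.
Proof.
move=> /andP[a0 ay].
have cont (t : R) : 0 < t -> {for t, continuous (fun t : R => t ^+ q * (ln y - ln t) ^+ l)}.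
  move=> t0; apply: cvgM; first exact: exprn_continuous.
  have h : {for t, continuous (fun u : R => ln y - ln u)}.
    by apply: cvgB; [exact: cvg_cst|exact: continuous_ln].
  exact: (continuous_comp h (@exprn_continuous _ l _)).
have dP (t : R) : 0 < t -> {for t, continuous (primitive q y l)}.
  move=> t0; apply: differentiable_continuous; apply/derivable1_diffP.
  by have [] := is_derive_primitive q y l t0.
rewrite (@continuous_FTC2 _ _ (primitive q y l)) ?EFinB//.
- apply: continuous_in_subspaceT => t; rewrite inE /= in_itv /= => /andP[at_ _].
  by apply: cont; exact: lt_le_trans at_.
- split.
  + move=> t; rewrite in_itv /= => /andP[at_ _].
    by have [] := is_derive_primitive q y l (lt_trans a0 at_).
  + exact/cvg_at_right_filter/dP.
  + by apply/cvg_at_left_filter/dP; exact: lt_trans ay.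
- move=> t; rewrite in_itv /= => /andP[at_ _].
  rewrite derive1E.
  by have [_ ->] := is_derive_primitive q y l (lt_trans a0 at_).
Qed.

(** The fundamental theorem of calculus on [a, y], where a runs through y exp(-n). *)
Lemma integral_power_log q (y : R) l : 0 < y ->
  (\int[mu]_(t in `]0%R, y[) (t ^+ q * (ln y - ln t) ^+ l)%:E =
   (y ^+ q.+1 * l`!%:R / q.+1%:R ^+ l.+1)%:E)%E.
Proof.
move=> y0; rewrite -primitive_end.
pose a n := y * expR (- n.+1%:R).
have a0 n : 0 < a n by rewrite mulr_gt0 ?expR_gt0.
have ay n : a n < y by rewrite gtr_pMr// expR_lt1 oppr_lt0.
pose F n := `[a n, y]%classic.
have UF : \bigcup_n F n = `]0, y]%classic.
  apply/seteqP; split => [t [n _]|t].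
    by rewrite /F /= !in_itv /= => /andP[at_ ->]; rewrite (lt_le_trans _ at_).
  rewrite /= in_itv /= => /andP[t0 ty].
  have := cvg_exprn_expRN 0.
  move=> /cvgrPdist_lt /(_ (t / y)); rewrite divr_gt0// => /(_ isT)[N _ hN].
  exists N => //; rewrite /F /= in_itv /= ty andbT.
  have := hN N.+1 (leqnSn N); rewrite /= expr0 mul1r sub0r normrN gtr0_norm ?expR_gt0//.
  by rewrite ltr_pdivlMr// mulrC => /ltW.
have mf : measurable_fun [set: R] (EFin \o (fun t : R => t ^+ q * (ln y - ln t) ^+ l)).
  apply/measurable_EFinP; apply: measurable_funM; first exact: exprn_measurable.
  by apply: measurable_funX; apply: measurable_funB => //; exact: measurable_ln.
have nd : nondecreasing_seq F.
  move=> m n mn; apply/subsetPset => t; rewrite /F /= !in_itv /= => /andP[at_ ->].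
  rewrite andbT (le_trans _ at_)// ler_pM2l// ler_expR lerN2 ler_nat ltnS.
  exact: mn.
have h : (\int[mu]_(x in F i) (x ^+ q * (ln y - ln x) ^+ l)%:E)%E @[i --> \oo] -->
   (\int[mu]_(x in `]0%R, y]) (x ^+ q * (ln y - ln x) ^+ l)%:E)%E.
  rewrite -UF; apply: ge0_nondecreasing_set_cvg_integral => //.
  - by move=> n; exact: measurable_itv.
  - by move=> n; exact: measurable_funS mf.
  - move=> n t; rewrite /F /= in_itv /= => /andP[at_ ty].
    have t0 : 0 < t by exact: lt_le_trans at_.
    by rewrite lee_fin mulr_ge0 ?exprn_ge0 ?subr_ge0 ?ler_ln ?posrE// ltW.
rewrite integral_itv_bndo_bndc; last first.
  exact: measurable_funS mf.
apply: (cvg_unique _ h) => //.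
rewrite (_ : (fun i => _) = fun n => (primitive q y l y - primitive q y l (a n))%:E).
  apply: cvg_EFin; first exact: nearW.
  rewrite -[X in _ --> X]subr0; apply: cvgB; first exact: cvg_cst.
  have := @primitive_cvg0 q y l y0; rewrite -(cvg_shiftn 1) /=.
  by under eq_fun do rewrite addn1.
by apply/funext => n; rewrite /F integral_segment ?a0 ?ay.
Qed.

(** By the mean value theorem applied to the partial sum plus ln (1 - t), whose derivative
    is - t^N/(1 - t). *)
Lemma has_sum_ln (x : R) : 0 <= x < 1 -> has_sum (fun n => x ^+ n / n%:R) (- ln (1 - x)).
Proof.
move=> /andP[x0 x1].
move: x0; rewrite le_eqVlt => /orP[/eqP <-|x0].
  rewrite subr0 ln1 oppr0; apply: eq_has_sum (has_sum0 _) => -[|n].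
    by rewrite invr0 mulr0.
  by rewrite expr0n /= mul0r.
have x1' : 0 < 1 - x by rewrite subr_gt0.
apply/has_sumE.
pose S N (t : R) := \sum_(0 <= n < N) t ^+ n.+1 / n.+1%:R.
have key N : exists2 c, 0 < c < x & S N x + ln (1 - x) = - (c ^+ N / (1 - c)) * x.
  pose f t := S N t + ln (1 - t).
  have df (t : R) : 0 <= t < 1 -> is_derive t 1 f (- (t ^+ N / (1 - t))).
    move=> /andP[t0 t1]; have t1' : 0 < 1 - t by rewrite subr_gt0.
    have dS : is_derive t 1 (S N) (\sum_(0 <= n < N) t ^+ n).
      rewrite /S; elim: (N) => [|M IH].
        rewrite (_ : (fun t : R => _) = cst 0); last by apply/funext => u; rewrite big_geq.
        by rewrite big_geq//; exact: is_derive_cst.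
      rewrite (_ : (fun t : R => _) = (fun t : R => \sum_(0 <= n < M) t ^+ n.+1 / n.+1%:R) +
          (M.+1%:R)^-1 \*: (id ^+ M.+1 : R -> R)); last first.
        by apply/funext => u; rewrite !fctE big_nat_recr //= mulrC.
      apply: is_derive_eq; rewrite big_nat_recr //= /GRing.scale /= mulr1; congr (_ + _).
      by rewrite mulrA mulVf ?mul1r// pnatr_eq0.
    have dl : is_derive t 1 (fun u : R => ln (1 - u)) (- (1 - t)^-1).
      have h1 : is_derive t 1 ((cst 1 : R -> R) - id) (- 1).
        by apply: is_derive_eq; rewrite sub0r.
      have h2 := is_derive1_ln t1'.
      have := @is_derive1_comp R (@ln R) ((cst 1 : R -> R) - id) t (1 - t)^-1 (- 1) h2 h1.
      by rewrite mulrN1.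
    have -> : f = S N + (fun u : R => ln (1 - u)) by [].
    apply: is_derive_eq.
    have -> : \sum_(0 <= n < N) t ^+ n = (1 - t ^+ N) / (1 - t).
      apply: (mulIf (lt0r_neq0 t1')); rewrite divfK ?gt_eqF// big_mkord.
      by rewrite -[1 in RHS](expr1n _ N) subrXX mulrC; congr (_ * _); apply: eq_bigr => i _;
         rewrite expr1n mul1r.
    by field; rewrite gt_eqF.
  have df' t : t \in `]0, x[ -> is_derive t 1 f (- (t ^+ N / (1 - t))).
    by rewrite in_itv /= => /andP[t0 tx]; apply: df; rewrite ltW//= (lt_trans tx).
  have cf' : {within `[0, x], continuous f}.
    apply: continuous_in_subspaceT => t; rewrite inE /= in_itv /= => /andP[t0 tx].
    apply: differentiable_continuous; apply/derivable1_diffP.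
    by have [] := df t _; rewrite ?t0 ?(le_lt_trans tx).
  have [c cx fx] := MVT x0 df' cf'.
  exists c; first by rewrite in_itv in cx.
  have f0 : f 0 = 0.
    rewrite /f subr0 ln1 addr0 /S big1 // => i _.
    by rewrite expr0n /= mul0r.
  by move: fx; rewrite f0 !subr0 => <-.
apply/has_sumE; apply/has_sum_recl; rewrite invr0 mulr0 subr0; apply/has_sumE.
rewrite (_ : series _ = fun N => S N x); last by apply/funext.
have B N : `|S N x + ln (1 - x)| <= x ^+ N * (x / (1 - x)).
  have [c /andP[c0 cx] ->] := key N.
  have c1 : 0 < 1 - c by rewrite subr_gt0 (lt_trans cx).
  rewrite mulNr normrN ger0_norm; last first.
    by rewrite mulr_ge0 ?divr_ge0 ?exprn_ge0// ltW.
  rewrite mulrAC -mulrA; apply: ler_pM.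
  - by rewrite exprn_ge0// ltW.
  - by rewrite divr_ge0// ltW.
  - by rewrite lerXn2r ?nnegrE// ltW.
  - by rewrite ler_wpM2l ?ltW// ltf_pV2 ?posrE// ltrD2l ltrN2.
have L : S N x + ln (1 - x) @[N --> \oo] --> (0 : R).
  apply/norm_cvg0P.
  apply: (@squeeze_cvgr _ _ _ _ (fun=> 0) (fun N => x ^+ N * (x / (1 - x)))).
  - by apply: nearW => N; rewrite normr_ge0 B.
  - exact: cvg_cst.
  - rewrite -(mul0r (x / (1 - x))); apply: cvgM; last exact: cvg_cst.
    by apply: cvg_expr; rewrite ger0_norm// ltW.
rewrite -[X in _ --> X]add0r.
have -> : (fun N => S N x) = (fun N => (S N x + ln (1 - x)) - ln (1 - x)).
  by apply/funext => N; rewrite addrK.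
by apply: cvgD => //; exact: cvg_cst.
Qed.

(** Term by term integration: t^n yields the denominator (n + q + 1)^(l + 1). *)
Lemma integral_Phi_Ssum s (y : R) w q l : valid_weights s y ->
  (\int[mu]_(t in `]0%R, y[) (t ^+ q * (ln y - ln t) ^+ l *
      Phi (fun j => t * (if j is i.+1 then s i else y^-1)) w)%:E =
   (y ^+ q.+1 * l`!%:R * Ssum (scaled_weights s y) w q.+1 l.+1)%:E)%E.
Proof.
move=> v; have [y0 sy] := v.
pose be j := if j is i.+1 then s i else y^-1.
have be_ge0 j : 0 <= be j.
  by case: j => [|j] /=; [rewrite invr_ge0 ltW|have [/ltW] := sy j].
have small t j : 0 < t < y -> t * be j < 1.
  move=> /andP[t0 ty]; case: j => [|j] /=; first by rewrite ltr_pdivrMr// mul1r.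
  by have [s0] := sy j; apply: le_lt_trans; rewrite ler_pM2r// ltW.
have hP t : 0 < t < y -> has_sum (fun n => t ^+ n * hlog be w n) (Phi (fun j => t * be j) w).
  move=> ty; have t0 : 0 < t by case/andP: ty.
  have b1 j : 0 <= t * be j <= 1 by rewrite mulr_ge0 ?(ltW t0) ?(ltW (small t j ty)).
  have H : has_sum (hlog (fun j => t * be j) w) (Phi (fun j => t * be j) w).
    by apply: (has_Phi b1) => j _; exact: small.
  by apply: eq_has_sum H => n; rewrite hlog_homog.
have g0 t : 0 < t < y -> 0 <= t ^+ q * (ln y - ln t) ^+ l.
  move=> /andP[t0 ty].
  by rewrite mulr_ge0 ?exprn_ge0 ?subr_ge0 ?ler_ln ?posrE// ltW.
transitivity (\int[mu]_(t in `]0%R, y[) \sum_(n <oo)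
    (hlog be w n * (t ^+ (n + q) * (ln y - ln t) ^+ l))%:E)%E.
  apply: eq_integral => t; rewrite inE /= in_itv /= => ty.
  have := has_sumZ (t ^+ q * (ln y - ln t) ^+ l) (hP t ty).
  move=> /nneseries_has_sum <-; last first.
    move=> n; rewrite mulr_ge0 ?g0// mulr_ge0 ?hlog_ge0// exprn_ge0// ltW//.
    by case/andP: ty.
  by apply: eq_eseriesr => n _; congr (_%:E); rewrite exprD; ring.
have mg n : measurable_fun [set: R] (fun t : R => t ^+ n * (ln y - ln t) ^+ l).
  apply: measurable_funM; first exact: exprn_measurable.
  by apply: measurable_funX; apply: measurable_funB => //; exact: measurable_ln.
rewrite integral_nneseries //; last 2 first.
- move=> n; apply/measurable_EFinP; apply: measurable_funM; first exact: measurable_cst.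
  exact: measurable_funS (mg _).
- move=> n t; rewrite /= in_itv /= => ty; rewrite lee_fin mulr_ge0 ?hlog_ge0//.
  by rewrite exprD -mulrA mulr_ge0 ?g0// exprn_ge0// ltW//; case/andP: ty.
transitivity (\sum_(n <oo) (y ^+ q.+1 * l`!%:R *
    (hlog (scaled_weights s y) w n / (n + q.+1)%:R ^+ l.+1))%:E)%E.
  apply: eq_eseriesr => n _.
  under eq_integral do rewrite EFinM.
  rewrite ge0_integralZl//; last 3 first.
  - by apply/measurable_EFinP; exact: measurable_funS (mg _).
  - move=> t; rewrite /= in_itv /= => ty; rewrite lee_fin.
    by rewrite exprD -mulrA mulr_ge0 ?g0// exprn_ge0// ltW//; case/andP: ty.
  - by rewrite lee_fin hlog_ge0.
  rewrite integral_power_log// -EFinM; congr (_%:E).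
  rewrite (@eq_hlog _ (scaled_weights s y) (fun j => y * be j)); last first.
    by move=> [|j] _ //=; rewrite mulfV// gt_eqF.
  by rewrite hlog_homog -addnS exprD; ring.
apply: nneseries_has_sum.
  move=> n; rewrite !mulr_ge0 ?exprn_ge0 ?invr_ge0 ?exprn_ge0 ?hlog_ge0 ?(ltW y0)//.
  by move=> j; case/andP: (valid_weights_le1 v j).
by apply: has_sumZ; apply: has_Ssum => //; exact: valid_weights_le1 v.
Qed.

(** In the application, y and the s_j^-1 are coordinates: the result is then of the same
    kind as the integrand. *)
Lemma integral_Phi (P : nat -> Prop) w q l : admissible w -> word_letters P w ->
  exists2 D : seq (R * nat * seq nat * word),
  forall t, t \in D -> [/\ mzv_span t.1.1.1,
     forall j, j \in t.1.2 -> P j.+1, admissible t.2 &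
     word_letters (fun j => P j.+1) t.2]
  & forall s y, valid_weights s y ->
   (\int[mu]_(t in `]0%R, y[) (t ^+ q * (ln y - ln t) ^+ l *
      Phi (fun j => t * (if j is i.+1 then s i else y^-1)) w)%:E =
     (\sum_(t <- D) t.1.1.1 * (y ^+ t.1.1.2 * (\prod_(j <- t.1.2) (s j)^-1) *
        Phi (fun j => y * s j) t.2))%:E)%E.
Proof.
move=> adm Pw; have [D hD E] := Ssum_reduction R l adm Pw (ltn0Sn q).
exists [seq (ratr (l`!%:R) * t.1.1, (q.+1 - size t.1.2)%N, t.1.2, t.2) | t <- D].
  by move=> t /mapP[u /hD[h1 h2 h3 h4 h5] ->]; split => //=; exact: mzv_spanZ.
move=> s y v; rewrite integral_Phi_Ssum// E//; congr (_%:E).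
rewrite big_map mulr_sumr big_seq [RHS]big_seq; apply: eq_bigr => t /hD[_ sz _ _ _] /=.
rewrite rmorph_nat; have [y0 _] := v.
have -> : y ^+ q.+1 = y ^+ (q.+1 - size t.1.2) * y ^+ size t.1.2 by rewrite -exprD subnK.
have -> : inv_monomial s y t.1.2 = (y ^+ size t.1.2)^-1 * \prod_(j <- t.1.2) (s j)^-1.
  rewrite /inv_monomial; elim: (t.1.2) => [|j js IH]; first by rewrite !big_nil expr0 invr1 mul1r.
  by rewrite !big_cons IH /= exprS !invfM; ring.
have y1 : y ^+ size t.1.2 != 0 by rewrite expf_neq0// gt_eqF.
by field.
Qed.

End Int.

(** * Integrating out the first coordinate *)

(** The factors t_i, - ln t_i and - ln (1 - t_i/t_(i+j+1)), which are nonnegative on the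
    simplex (see [factor_val]). *)
Inductive factor := FX of nat | FL of nat | FP of nat & nat.

Section Simplex.
Variable R : realType.
Local Notation mu := (@lebesgue_measure R).
Implicit Types (t : seq R) (w : word) (fs : seq factor).

(** Coordinates are counted from 0; beyond the last one the value is the upper end point 1. *)
Definition pos t i : R := nth 1 t i.
Arguments pos : simpl never.
Definition simplex t : bool := path <%R (0 : R) (rcons t 1).

Definition factor_val t (f : factor) : R :=
  match f with
  | FX i => pos t i
  | FL i => - ln (pos t i)
  | FP i j => - ln (1 - pos t i / pos t (i + j).+1)
  end.

(** The singular points are all coordinates but the first, and 1; the hyperlogarithm is
    evaluated at the first coordinate. *)
Definition weights t (j : nat) : R := pos t 0 * (pos t j.+1)^-1.

(** The class of integrands that is stable under integration of the first coordinate. *)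
Definition integrand w fs t : R := Phi (weights t) w * \prod_(f <- fs) factor_val t f.

Lemma simplex_cons a t : simplex (a :: t) = (0 < a < pos t 0) && simplex t.
Proof.
rewrite /simplex /pos; case: t => [|b t] /=; first by rewrite ltr01 !andbT.
case a0: (0 < a); case ab: (a < b) => //=.
by rewrite (lt_trans a0 ab).
Qed.

Lemma pos_rcons t i : pos t i = nth 1 (rcons t 1) i.
Proof.
rewrite /pos nth_rcons; case: ltngtP => // [it|->]; by rewrite nth_default// ltnW.
Qed.

Lemma simplex_lt t i j : simplex t -> (i < size t)%N -> (i < j)%N -> pos t i < pos t j.
Proof.
rewrite /simplex (path_sortedE lt_trans) => /andP[_ st] it ij.
have [jt|tj] := leqP j (size t).
  rewrite !pos_rcons; apply: (sorted_ltn_nth lt_trans 1 st) => //; rewrite inE size_rcons ltnS//.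
  exact: ltnW.
rewrite [pos t j]nth_default; last exact: ltnW.
rewrite (_ : 1 = pos t (size t)); last by rewrite /pos nth_default.
rewrite !pos_rcons; apply: (sorted_ltn_nth lt_trans 1 st) => //; rewrite inE size_rcons ltnS//.
exact: ltnW.
Qed.

Lemma simplex_gt0 t i : simplex t -> 0 < pos t i.
Proof.
move=> st; have [it|ti] := ltnP i (size t); last by rewrite /pos nth_default.
move: st; rewrite /simplex (path_sortedE lt_trans) => /andP[/allP h _].
by apply: h; rewrite mem_rcons inE mem_nth ?orbT.
Qed.

Lemma simplex_le t i j : simplex t -> (i <= j)%N -> pos t i <= pos t j.
Proof.
move=> st; rewrite leq_eqVlt => /orP[/eqP ->//|ij].
have [it|ti] := ltnP i (size t); first exact/ltW/simplex_lt.
by rewrite /pos !nth_default// (leq_trans ti) // ltnW.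
Qed.

Lemma simplex_le1 t i : simplex t -> pos t i <= 1.
Proof.
move=> st; have -> : 1 = pos t (i + size t) by rewrite /pos nth_default// leq_addl.
by apply: simplex_le => //; exact: leq_addr.
Qed.

Lemma factor_val_ge0 t f : simplex t -> 0 <= factor_val t f.
Proof.
move=> st; case: f => [i|i|i j] /=.
- exact/ltW/simplex_gt0.
- by rewrite oppr_ge0 ln_le0// simplex_le1.
- by rewrite oppr_ge0 ln_le0// gerBl divr_ge0 //; exact (ltW (simplex_gt0 _ st)).
Qed.

Lemma weights_cons a t j : weights (a :: t) j =
  a * (if j is i.+1 then (pos t j)^-1 else (pos t 0)^-1).
Proof. by rewrite /weights /=; case: j. Qed.

Lemma weights_ge0 t j : simplex t -> 0 <= weights t j.
Proof. by move=> st; rewrite mulr_ge0 ?invr_ge0// ltW// simplex_gt0. Qed.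

Lemma weights_lt1 t j : simplex t -> (0 < size t)%N -> weights t j < 1.
Proof.
by move=> st t0; rewrite /weights ltr_pdivrMr ?simplex_gt0// mul1r simplex_lt.
Qed.

Lemma has_Phi_weights t w : simplex t -> (0 < size t)%N ->
  has_sum (hlog (weights t) w) (Phi (weights t) w).
Proof.
move=> st t0; have b1 j : 0 <= weights t j <= 1 by rewrite weights_ge0 ?ltW ?weights_lt1.
by apply: (has_Phi b1) => j _; exact: weights_lt1.
Qed.

Lemma Phi_weights_shuffle t u w : simplex t -> (0 < size t)%N ->
  admissible u -> admissible w ->
  Phi (weights t) u * Phi (weights t) w = \sum_(x <- shuffle u w) Phi (weights t) x.
Proof.
move=> st t0 au aw.
have b0 j := @weights_ge0 t j st.
have h1 := has_sum_cauchy_prod (fun n => hlog_ge0 u n b0) (fun n => hlog_ge0 w n b0)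
  (has_Phi_weights u st t0) (has_Phi_weights w st t0).
have h2 := @has_sum_big _ _ (shuffle u w) xpredT _ _ (fun x _ => has_Phi_weights x st t0).
apply: (has_sum_uniq h1); apply: eq_has_sum h2 => n.
by rewrite cauchy_prod_hlog.
Qed.

(** A one-letter hyperlogarithm is a logarithm; this is how the factors
    - ln (1 - t_0/t_j) enter the words. *)
Lemma Phi_letter t j : simplex t -> (0 < size t)%N ->
  Phi (weights t) [:: Some j] = - ln (1 - weights t j).
Proof.
move=> st t0.
have h := @has_sum_ln R (weights t j); rewrite weights_ge0// weights_lt1// in h.
apply: has_sum_total; apply: eq_has_sum (h isT) => n.
rewrite /= geoE; case: n => [|n]; first by rewrite big_ord0 invr0 !mulr0.
rewrite big_ord_recl /= subn0 mulr1 big1 ?addr0// => i _.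
by rewrite mulr0.
Qed.

Definition split_term := (nat * nat * word * seq factor)%type.

(** An integrand in which the first coordinate a has been separated from the others.  It is
    convenient to write ln a as ln t_0 - (ln t_0 - ln a). *)
Definition split_val (a : R) t (d : split_term) : R :=
  let: (q, l, w, fs) := d in
  a ^+ q * (ln (pos t 0) - ln a) ^+ l * Phi (weights (a :: t)) w *
  \prod_(f <- fs) factor_val t f.

Definition good_word n w : Prop := admissible w /\ word_letters (fun j => (j <= n)%N) w.

Definition splits n (F : R -> seq R -> R) := exists2 L : seq split_term,
  forall w, w \in [seq d.1.2 | d <- L] -> good_word n w
  & forall a t, size t = n -> simplex (a :: t) -> F a t = \sum_(d <- L) split_val a t d.

(** Factors without a are moved aside; - ln a is split as above; - ln (1 - a/t_j) is
    shuffled into the word. *)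
Lemma split_factor n f d : good_word n d.1.2 ->
  splits n (fun a t => factor_val (a :: t) f * split_val a t d).
Proof.
case: d => [[[q l] w] fs] [/= aw lw].
have shift g : splits n (fun a t => factor_val t g * split_val a t (q, l, w, fs)).
  exists [:: (q, l, w, g :: fs)]; first by move=> d'; rewrite inE => /eqP ->.
  by move=> a t _ _; rewrite big_seq1 /split_val big_cons; ring.
case: f => [[|i]|[|i]|[|i] j].
- exists [:: (q.+1, l, w, fs)]; first by move=> d'; rewrite inE => /eqP ->.
  by move=> a t _ _; rewrite big_seq1 /split_val /= exprS /pos /=; ring.
- exact: (shift (FX i)).
- exists [:: (q, l.+1, w, fs); (q, l, w, FL 0 :: fs)].
    by move=> d'; rewrite !inE => /orP[] /eqP ->.
  move=> a t _ _; rewrite big_cons big_seq1 /split_val big_cons /= exprS /pos /=; ring.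
- exact: (shift (FL i)).
(* all letters from n on stand for the singular point 1 *)
- exists [seq (q, l, x, fs) | x <- shuffle [:: Some (minn j n)] w].
    move=> d'; rewrite -map_comp => /mapP[x xs ->] /=; split.
      exact: admissible_shuffle xs.
    move=> i ix; have /orP[|/lw//] := mem_shuffle xs ix.
    by rewrite inE => /eqP[->]; exact: geq_minr.
  move=> a t sz st; rewrite big_map /=.
  rewrite (_ : - ln (1 - a / pos t j) = Phi (weights (a :: t)) [:: Some (minn j n)]).
    transitivity (a ^+ q * (ln (pos t 0) - ln a) ^+ l *
       (Phi (weights (a :: t)) [:: Some (minn j n)] * Phi (weights (a :: t)) w) *
       \prod_(f <- fs) factor_val t f); first by ring.
    by rewrite Phi_weights_shuffle// mulr_sumr mulr_suml.
  rewrite Phi_letter// /weights /= /pos /=; congr (- ln (1 - _ / _)).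
  case: (leqP j n) => //= nj.
  by rewrite !nth_default ?sz// ltnW.
- exact: (shift (FP i j)).
Qed.

Lemma split_integrand n w fs : good_word n w -> splits n (fun a t => integrand w fs (a :: t)).
Proof.
move=> gw; elim: fs => [|f fs [L hL E]].
  exists [:: (0%N, 0%N, w, [::])]; first by move=> d'; rewrite inE => /eqP ->.
  by move=> a t _ _; rewrite big_seq1 /split_val /integrand !big_nil !expr0 !mul1r.
suff [L' hL' E'] : splits n (fun a t => factor_val (a :: t) f * \sum_(d <- L) split_val a t d).
  exists L' => // a t sz st; rewrite -E' // -E // /integrand big_cons; ring.
elim: L hL {E} => [|d L IH] hL.
  by exists [::] => // a t _ _; rewrite !big_nil mulr0.
have hd : good_word n d.1.2 by apply: hL; rewrite inE eqxx.
have [L1 hL1 E1] := split_factor f hd.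
have [|L2 hL2 E2] := IH; first by move=> d' d'L; apply: hL; rewrite inE d'L orbT.
exists (L1 ++ L2).
  by move=> d'; rewrite map_cat mem_cat => /orP[/hL1|/hL2].
by move=> a t sz st; rewrite big_cat big_cons mulrDr E1 // E2.
Qed.

Lemma eq_Phi (b c : nat -> R) w : word_letters (fun j => b j = c j) w -> Phi b w = Phi c w.
Proof. by move=> bc; congr total; apply/funext => n; exact: eq_hlog. Qed.

Section Measurable.
Context d (T : measurableType d) (D : set T).
Variable be : T -> nat -> R.
Hypothesis mbe : forall j, measurable_fun D (be ^~ j).

Lemma measurable_hlog w n : measurable_fun D (fun x => hlog (be x) w n).
Proof.
elim: w n => [|a w IH] n; first exact: measurable_cst.
rewrite /=; apply: measurable_funM; last exact: measurable_cst.
case: a => [j|] //=.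
elim: n => [|n IHn] /=; first exact: measurable_cst.
by apply: measurable_funM => //; exact: measurable_funD.
Qed.

Lemma measurable_Phi w : (forall x, D x -> has_sum (hlog (be x) w) (Phi (be x) w)) ->
  measurable_fun D (fun x => Phi (be x) w).
Proof.
move=> h; apply: (measurable_fun_cvg (h := fun n x => series (hlog (be x) w) n)).
  move=> n; rewrite /series /=; apply: measurable_sum => i; exact: measurable_hlog.
by move=> x Dx; apply/has_sumE; exact: h.
Qed.
End Measurable.

Definition integrand_comb n (I : seq R -> \bar R) :=
  exists2 C : seq (R * word * seq factor),
  forall c, c \in [seq c.1 | c <- C] -> [/\ mzv_span c.1, admissible c.2 &
     word_letters (fun j => (j < n)%N) c.2]
  & forall t, size t = n -> simplex t ->
      I t = (\sum_(c <- C) c.1.1 * integrand c.1.2 c.2 t)%:E.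

(** The step of the induction on the number of variables: after the splitting, [integral_Phi]
    applies to each summand. *)
Lemma integral_first_coord n w fs : good_word n w ->
  integrand_comb n (fun t => \int[mu]_(a in `]0%R, pos t 0[) (integrand w fs (a :: t))%:E)%E.
Proof.
move=> gw; have [L hL E] := split_integrand fs gw.
pose P j := (j <= n)%N.
(* only j < n matters; the other values merely have to be valid weights *)
pose s t j : R := if (j < n)%N then (pos t j.+1)^-1 else (2 * pos t 0)^-1.
have vs t : size t = n -> simplex t -> valid_weights (s t) (pos t 0).
  move=> sz st; have y0 := simplex_gt0 0 st; split => // j; rewrite /s.
  case: ifP => jn.
    have p0 := simplex_gt0 j.+1 st; split; first by rewrite invr_gt0.
    by rewrite ltr_pdivrMr// mul1r simplex_lt// sz (leq_trans _ jn).
  split; first by rewrite invr_gt0 mulr_gt0.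
  by rewrite invfM mulrCA mulfV ?gt_eqF// mulr1 invf_lt1// ltr1n.
have sw a t u : word_letters P u -> Phi (weights (a :: t)) u =
    Phi (fun j => a * (if j is i.+1 then s t i else (pos t 0)^-1)) u.
  move=> hu; apply: eq_Phi => j /hu; rewrite /P weights_cons /s.
  by case: j => [//|j] ->.
have gsplit t q l u a : simplex t -> `]0%R, pos t 0[%classic a ->
    0 <= a ^+ q * (ln (pos t 0) - ln a) ^+ l * Phi (weights (a :: t)) u.
  rewrite /= in_itv /= => st ha; have /andP[a0 ay] := ha.
  have sat : simplex (a :: t) by rewrite simplex_cons ha.
  apply: mulr_ge0.
    by rewrite mulr_ge0 ?exprn_ge0 ?subr_ge0 ?ler_ln ?posrE ?simplex_gt0 ?(ltW a0) ?(ltW ay).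
  apply: (has_sum_ge0 _ (has_Phi_weights u sat isT)) => k.
  by apply: hlog_ge0 => j; exact: weights_ge0.
have msplit t q l (sz : size t = n) (st : simplex t) u :
    measurable_fun (`]0%R, pos t 0[%classic : set (measurableTypeR R))
     (EFin \o (fun a : R => a ^+ q * (ln (pos t 0) - ln a) ^+ l * Phi (weights (a :: t)) u)).
  apply/measurable_EFinP; apply: measurable_funM.
    apply: measurable_funM; first exact: exprn_measurable.
    apply: measurable_funX; apply: measurable_funB; first exact: measurable_cst.
    by apply: measurable_funS (@measurable_ln R).
  apply: (@measurable_Phi _ _ _ (fun a => weights (a :: t))).
    move=> j; rewrite (_ : (fun a => _) = (fun a : R => a * (pos t j)^-1)).
      by apply: measurable_funM; [exact: measurable_id|exact: measurable_cst].
    by apply/funext => a; rewrite weights_cons; case: j.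
  move=> a; rewrite /= in_itv /= => ha; apply: has_Phi_weights => //.
  by rewrite simplex_cons ha.
have single d : good_word n d.1.2 -> integrand_comb n (fun t =>
    \int[mu]_(a in `]0%R, pos t 0[) (split_val a t d)%:E)%E.
  case: d => [[[q l] u] gs] [/= au lu].
  have [D hD ED] := @integral_Phi R P u q l au lu.
  exists [seq (x.1.1.1, x.2, nseq x.1.1.2 (FX 0) ++ [seq FX j.+1 | j <- x.1.2] ++ gs) | x <- D].
    by move=> c; rewrite -map_comp => /mapP[x /hD[h1 h2 h3 h4] ->].
  move=> t sz st; have y0 := simplex_gt0 0 st.
  pose c := \prod_(f <- gs) factor_val t f.
  have c0 : 0 <= c by apply: prodr_ge0 => f _; exact: factor_val_ge0.
  transitivity (\int[mu]_(a in `]0%R, pos t 0[) (c%:E *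
      (a ^+ q * (ln (pos t 0) - ln a) ^+ l * Phi (weights (a :: t)) u)%:E))%E.
    by apply: eq_integral => a _; rewrite -EFinM /split_val -/c mulrC.
  rewrite ge0_integralZl//; last 2 first.
  - exact: msplit sz st u.
  - by move=> a aD; rewrite lee_fin; exact: gsplit.
  under eq_integral do rewrite (sw _ t u lu).
  rewrite (ED _ _ (vs t sz st)) -EFinM; congr (_%:E).
  rewrite big_map mulr_sumr big_seq [RHS]big_seq; apply: eq_bigr => x /hD[h1 h2 h3 h4] /=.
  rewrite /integrand !big_cat /= big_map (@eq_Phi (weights t) (fun j => pos t 0 * s t j)); last
      first.
    by move=> j /h4; rewrite /P /weights /s => ->.
  have -> : \prod_(i <- nseq x.1.1.2 (FX 0)) factor_val t i = pos t 0 ^+ x.1.1.2.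
    by elim: (x.1.1.2) => [|m IH]; rewrite /= ?big_nil ?big_cons ?expr0 ?exprS ?IH.
  have -> : \prod_(j <- x.1.2) factor_val t (FX j.+1) = \prod_(j <- x.1.2) (s t j)^-1.
    rewrite big_seq [RHS]big_seq; apply: eq_bigr => j /h2; rewrite /P /s => ->.
    by rewrite invrK.
  rewrite -/c; ring.
suff [C hC EC] : integrand_comb n (fun t =>
    \sum_(d <- L) \int[mu]_(a in `]0%R, pos t 0[) (split_val a t d)%:E)%E.
  exists C => // t sz st; rewrite -EC //.
  transitivity (\int[mu]_(a in `]0%R, pos t 0[) \sum_(d <- L) (split_val a t d)%:E)%E.
    apply: eq_integral => a; rewrite inE /= in_itv /= => aD.
    by rewrite E ?simplex_cons ?aD// sumEFin.
  rewrite ge0_integral_sum//.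
  - move=> [[[q l] u] gs]; apply/measurable_EFinP; rewrite /split_val.
    apply: measurable_funM; last exact: measurable_cst.
    by apply/measurable_EFinP; exact: msplit.
  - move=> [[[q l] u] gs] a aD; rewrite lee_fin /split_val mulr_ge0 ?gsplit//.
    by apply: prodr_ge0 => f _; exact: factor_val_ge0.
elim: L hL {E} => [|d L IH] hL.
  by exists [::] => // t _ _; rewrite !big_nil.
have [C1 hC1 E1] := single d (hL d.1.2 (mem_head _ _)).
have [|C2 hC2 E2] := IH; first by move=> d' d'L; apply: hL; rewrite inE d'L orbT.
exists (C1 ++ C2).
  by move=> c; rewrite map_cat mem_cat => /orP[/hC1|/hC2].
by move=> t sz st; rewrite big_cons big_cat EFinD E1 // E2.
Qed.

End Simplex.

(** * Integrals over the simplex *)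

Section Iterate.
Variable R : realType.
Local Notation T := (measurableTypeR R).
Local Notation Delta := (selberg_domain R).

Lemma measurable_nth (x0 : R) n i : measurable_fun [set: n.-tuple T] (fun t : n.-tuple T => nth
    x0 t i).
Proof.
have [ni|ni] := ltnP i n; last first.
  rewrite (_ : (fun t => _) = cst x0); first exact: measurable_cst.
  by apply/funext => t; rewrite nth_default// size_tuple.
rewrite (_ : (fun t => _) = (fun t : n.-tuple T => tnth t (Ordinal ni))).
  exact: measurable_tnth.
by apply/funext => t; rewrite (tnth_nth x0).
Qed.

Lemma measurable_pos n i : measurable_fun [set: n.-tuple T] (fun t : n.-tuple T => pos t i).
Proof. exact: measurable_nth. Qed.

Lemma measurable_Delta n : measurable (Delta n).
Proof.
pose u i (t : n.-tuple T) : R := nth 1 (0 :: (t : seq R)) i.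
have mu i : measurable_fun [set: n.-tuple T] (u i).
  case: i => [|i]; first exact: measurable_cst.
  exact: measurable_nth.
have -> : Delta n = \bigcap_(i in [set i | (i <= n)%N]) [set t | u i t < pos t i].
  apply/seteqP; split => t.
    move=> /(pathP 1) h i /= ni; rewrite /u pos_rcons.
    have := h i; rewrite size_rcons size_tuple ltnS => /(_ ni).
    case: i ni => [|i] ni //=; apply: le_lt_trans.
    by rewrite nth_rcons size_tuple ni.
  move=> h; apply/(pathP 1) => i; rewrite size_rcons size_tuple ltnS => ni.
  have := h i ni; rewrite /= /u pos_rcons.
  case: i ni => [|i] ni //=; apply: le_lt_trans.
  by rewrite nth_rcons size_tuple ni.
apply: bigcap_measurable => [|i _]; first by exists 0%N.
rewrite [X in measurable X](_ : _ = (fun t => u i t < pos t i) @^-1` [set true]).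
  rewrite -[X in measurable X]setTI.
  exact: (measurable_fun_ltr (mu i) (measurable_pos i)).
by apply/seteqP; split => t.
Qed.

Lemma measurable_inv_pos n i :
  measurable_fun (Delta n) (fun t : n.-tuple T => (pos t i)^-1).
Proof.
apply: (eq_measurable_fun (fun t : n.-tuple T => expR (- ln (pos t i)))).
  by move=> t; rewrite inE => Dt; rewrite expRN lnK// posrE simplex_gt0.
apply: (measurableT_comp (@measurable_expR R)); apply: measurable_funN.
apply: (measurableT_comp (@measurable_ln R)).
exact: measurable_funS (measurable_pos i).
Qed.

Lemma measurable_factor_val n f :
  measurable_fun (Delta n) (fun t : n.-tuple T => factor_val t f).
Proof.
have mp i : measurable_fun (Delta n) (fun t : n.-tuple T => pos t i).
  exact: measurable_funS (measurable_pos i).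
case: f => [i|i|i j] /=; first exact: mp.
  by apply: measurable_funN; exact: measurableT_comp (@measurable_ln R) (mp i).
apply: measurable_funN; apply: (measurableT_comp (@measurable_ln R)).
apply: measurable_funB; first exact: measurable_cst.
apply: measurable_funM; first exact: mp.
exact: (@measurable_inv_pos n (i + j).+1).
Qed.

Lemma measurable_weights n j :
  measurable_fun (Delta n) (fun t : n.-tuple T => weights t j).
Proof.
apply: measurable_funM; last exact: measurable_inv_pos.
exact: measurable_funS (measurable_pos 0).
Qed.

Lemma has_Phi_Delta n w (t : n.-tuple T) : word_letters (fun j => (j < n)%N) w ->
  Delta n t -> has_sum (hlog (weights t) w) (Phi (weights t) w).
Proof.
move=> lw Dt; apply: has_Phi => [j|j hj].
  rewrite weights_ge0//= /weights ler_pdivrMr ?simplex_gt0// mul1r.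
  exact: simplex_le.
apply: weights_lt1 => //; rewrite size_tuple.
have : (j < n)%N by apply: lw; case: w hj => //= a w ->; rewrite mem_head.
exact: leq_ltn_trans.
Qed.

Lemma measurable_integrand n w fs : word_letters (fun j => (j < n)%N) w ->
  measurable_fun (Delta n) (fun t : n.-tuple T => integrand w fs t).
Proof.
move=> lw; apply: measurable_funM; last first.
  elim: fs => [|f fs IH].
    by under eq_fun do rewrite big_nil; exact: measurable_cst.
  under eq_fun do rewrite big_cons.
  by apply: measurable_funM => //; exact: measurable_factor_val.
apply: measurable_Phi => [j|t Dt]; first exact: measurable_weights.
exact: has_Phi_Delta.
Qed.

Lemma integrand_ge0 n w fs (t : n.-tuple T) : word_letters (fun j => (j < n)%N) w ->
  Delta n t -> 0 <= integrand w fs t.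
Proof.
move=> lw Dt; apply: mulr_ge0; last first.
  by apply: prodr_ge0 => f _; exact: factor_val_ge0.
apply: has_sum_ge0 (has_Phi_Delta lw Dt) => k.
by apply: hlog_ge0 => j; exact: weights_ge0.
Qed.

(** Tonelli, the first coordinate being integrated first. *)
Lemma lebesgue_tuple_cons n (f : n.+1.-tuple T -> R) :
  measurable_fun (Delta n.+1) f ->
  (forall t, Delta n.+1 t -> 0 <= f t) ->
  (\int[lebesgue_tuple R n.+1]_(t in Delta n.+1) (f t)%:E =
   \int[lebesgue_tuple R n]_(t in Delta n)
     \int[@lebesgue_measure R]_(a in `]0%R, pos t 0[) (f [tuple of a :: t])%:E)%E.
Proof.
move=> mf f0.
have mD := @measurable_Delta n.+1.
have mc : measurable_fun [set: T * n.-tuple T]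
    (fun p => [tuple of p.1 :: p.2] : n.+1.-tuple T) by exact: measurable_cons.
rewrite [LHS](ge0_integral_pushforward mc (@lebesgue_measure R \x lebesgue_tuple R n)%E) //;
    last 2 first.
- exact/measurable_EFinP.
- by move=> t; rewrite inE lee_fin; exact: f0.
have mpre : measurable ((fun p : T * n.-tuple T => [tuple of p.1 :: p.2]) @^-1` Delta n.+1).
  by rewrite -[X in measurable X]setTI; exact: mc.
rewrite integral_mkcond fubini_tonelli2; last 2 first.
- apply/(measurable_restrictT _ mpre) => /=.
  apply/measurable_EFinP.
  apply: (measurable_comp mD) mf _; first by move=> _ [p Dp <-].
  exact: measurable_funS mc.
- move=> p; apply: erestrict_ge0 => q /= Dq; rewrite lee_fin; exact: f0.
rewrite [RHS]integral_mkcond; apply: eq_integral => t _.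
have mem a : (Delta n.+1 [tuple of a :: t]) = (`]0%R, pos t 0[%classic a /\ Delta n t) :> Prop.
  apply/propext; rewrite /= in_itv /=.
  rewrite -[X in X <-> _]/(simplex (a :: (t : seq R)) : Prop) simplex_cons.
  by split => [/andP|[-> ?]].
rewrite /fubini_G [RHS]/patch; case: ifPn => Dt.
  rewrite inE in Dt; rewrite [RHS]integral_mkcond; apply: eq_integral => a _.
  rewrite /patch /=; congr (if _ then _ else _).
  by apply/idP/idP; rewrite !inE /= mem => -[].
transitivity (\int[@lebesgue_measure R]_a (0 : \bar R))%E; last by rewrite integral0.
apply: eq_integral => a _; rewrite /patch ifN//.
by apply: contra Dt; rewrite !inE /= mem => -[].
Qed.

Lemma prod_factor_nil fs : exists q : rat, \prod_(f <- fs) factor_val ([::] : seq R) f = ratr q.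
Proof.
elim: fs => [|f fs [q IH]]; first by exists 1; rewrite big_nil rmorph1.
rewrite big_cons IH; have p1 i : pos ([::] : seq R) i = 1 by rewrite /pos nth_nil.
case: f => [i|i|i j] /=; rewrite !p1.
- by exists q; rewrite mul1r.
- by exists 0; rewrite ln1 oppr0 mul0r rmorph0.
- by exists 0; rewrite divr1 subrr ln0// oppr0 mul0r rmorph0.
Qed.

Lemma integrable_integrand n w fs z : word_letters (fun j => (j < n)%N) w ->
  (\int[lebesgue_tuple R n]_(t in Delta n) (integrand w fs t)%:E = z%:E)%E ->
  (lebesgue_tuple R n).-integrable (Delta n) (fun t => (integrand w fs t)%:E).
Proof.
move=> lw Ez; apply/integrableP; split.
  by apply/measurable_EFinP; exact: measurable_integrand.
rewrite (eq_integral (fun t : n.-tuple T => (integrand w fs t)%:E)) ?Ez ?ltry//.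
by move=> t; rewrite inE => Dt; rewrite gee0_abs// lee_fin (integrand_ge0 fs lw).
Qed.

(** Integrate one coordinate after the other.  When none is left, a factor is 0 or 1, and
    the word is empty. *)
Lemma integral_simplex_mzv n w fs : admissible w -> word_letters (fun j => (j < n)%N) w ->
  exists2 z : R, mzv_span z &
    (\int[lebesgue_tuple R n]_(t in Delta n) (integrand w fs t)%:E = z%:E)%E.
Proof.
elim: n w fs => [|n IH] w fs aw lw.
  have -> : w = [::].
    case: w aw lw => [//|[j|] w] aw lw; first by have := lw j; rewrite inE eqxx => /(_ isT).
    exfalso; have /negP := aw; apply; apply/eqP.
    elim: w {aw} lw => [//|a w IHw] lw /=.
    case: a lw => [j|] lw; first by have := lw j; rewrite !inE eqxx orbT => /(_ isT).
    by apply: IHw => j; rewrite inE /= => jw; apply: (lw j); rewrite !inE jw.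
  have [q Eq] := prod_factor_nil fs.
  exists (ratr q); first exact: mzv_spanQ.
  have integrand0 (t : 0.-tuple T) : integrand [::] fs t = ratr q.
    by rewrite (tuple0 t) /integrand Phi_nil mul1r.
  rewrite integral_dirac; first last.
  - by under eq_fun do rewrite integrand0; exact: measurable_cst.
  - exact: (@measurable_Delta 0).
  by rewrite integrand0 diracE mem_set ?mul1e//= /selberg_domain /= ltr01.
have [C hC EC] := integral_first_coord R fs (conj aw lw).
rewrite lebesgue_tuple_cons; first last.
- by move=> t Dt; exact: integrand_ge0 Dt.
- exact: measurable_integrand.
suff [z hz [_ Ez]] : exists2 z : R, mzv_span z &
    (lebesgue_tuple R n).-integrable (Delta n)
       (fun t : n.-tuple T => (\sum_(c <- C) c.1.1 * integrand c.1.2 c.2 t)%:E) /\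
    (\int[lebesgue_tuple R n]_(t in Delta n)
      (\sum_(c <- C) c.1.1 * integrand c.1.2 c.2 t)%:E = z%:E)%E.
  exists z => //; rewrite -Ez; apply: eq_integral => t; rewrite inE => Dt.
  by rewrite -EC ?size_tuple.
elim: C hC {EC} => [|c C IHC] hC.
  exists 0; first exact: mzv_span0.
  under eq_fun do rewrite big_nil.
  by split; [exact: integrable0|rewrite integral0].
have [hz ac lc] := hC c.1 (mem_head _ _).
have [|z2 hz2 [i2 E2]] := IHC; first by move=> d dC; apply: hC; rewrite inE dC orbT.
have [z1 hz1 E1] := IH c.1.2 c.2 ac lc.
have i1 := integrable_integrand lc E1.
have mD := @measurable_Delta n.
exists (c.1.1 * z1 + z2); first by apply: mzv_spanD => //; exact: mzv_spanM.
under eq_fun do rewrite big_cons EFinD EFinM.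
split; first by apply: integrableD => //; exact: integrableZl.
rewrite integralD//; last exact: integrableZl.
by rewrite integralZl// E1 E2.
Qed.

End Iterate.

(** * Polynomials in coordinates and logarithms *)

Section LogPoly.
Variables (R : realType) (N : nat).
Implicit Types (t : seq R) (P : factor -> Prop).

(** Functions are compared on the simplex only ([logpoly_ext]), so that identities between
    logarithms that hold there may be used. *)
Inductive logpoly P : (seq R -> R) -> Prop :=
| logpoly_rat q : logpoly P (fun=> ratr q)
| logpoly_factor f : P f -> logpoly P (fun t => factor_val t f)
| logpolyD g h : logpoly P g -> logpoly P h -> logpoly P (fun t => g t + h t)
| logpolyM g h : logpoly P g -> logpoly P h -> logpoly P (fun t => g t * h t)
| logpoly_ext g h : (forall t, size t = N -> simplex t -> g t = h t) ->
    logpoly P g -> logpoly P h.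

Definition is_coordinate f : Prop := if f is FX _ then True else False.

Lemma logpoly_coordinate g : logpoly is_coordinate g -> logpoly (fun=> True) g.
Proof.
elim=> [q|f _|g1 h _ hg _ hh|g1 h _ hg _ hh|g1 h e _ hg].
- exact: logpoly_rat.
- exact: logpoly_factor.
- exact: logpolyD.
- exact: logpolyM.
- exact: logpoly_ext e hg.
Qed.

Lemma logpoly1 P : logpoly P (fun=> 1).
Proof.
by apply: logpoly_ext (logpoly_rat P 1) => t _ _; rewrite rmorph1.
Qed.

Lemma logpolyN P g : logpoly P g -> logpoly P (fun t => - g t).
Proof.
move=> hg; apply: logpoly_ext (logpolyM (logpoly_rat P (-1)) hg) => t _ _.
by rewrite rmorphN1 mulN1r.
Qed.

Lemma logpolyB P g h : logpoly P g -> logpoly P h -> logpoly P (fun t => g t - h t).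
Proof. by move=> hg hh; apply: logpolyD => //; exact: logpolyN. Qed.

Lemma logpolyX P g n : logpoly P g -> logpoly P (fun t => g t ^+ n).
Proof.
move=> hg; elim: n => [|n IH].
  by apply: logpoly_ext (logpoly1 P) => t _ _; rewrite expr0.
by apply: logpoly_ext (logpolyM hg IH) => t _ _; rewrite exprS.
Qed.

Lemma logpoly_prod P (I : Type) (r : seq I) (Q : pred I) (F : I -> seq R -> R) :
  (forall i, logpoly P (F i)) -> logpoly P (fun t => \prod_(i <- r | Q i) F i t).
Proof.
move=> hF; elim: r => [|i r IH].
  by apply: logpoly_ext (logpoly1 P) => t _ _; rewrite big_nil.
case Qi: (Q i).
  by apply: logpoly_ext (logpolyM (hF i) IH) => t _ _; rewrite big_cons Qi.
by apply: logpoly_ext IH => t _ _; rewrite big_cons Qi.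
Qed.

Lemma logpoly_bounded g : logpoly is_coordinate g ->
  exists2 M, 0 <= M & forall t, size t = N -> simplex t -> `|g t| <= M.
Proof.
elim=> [q|f Pf|g1 h _ [M M0 hM] _ [M' M'0 hM']|g1 h _ [M M0 hM] _ [M' M'0 hM']|g1 h e _ [M M0 hM]].
- by exists `|ratr q|.
- exists 1 => // t _ st; case: f Pf => // i _ /=.
  by rewrite ger0_norm ?simplex_le1// ltW// simplex_gt0.
- exists (M + M'); first exact: addr_ge0.
  by move=> t sz st; rewrite (le_trans (ler_normD _ _))// lerD ?hM ?hM'.
- exists (M * M'); first exact: mulr_ge0.
  by move=> t sz st; rewrite normrM ler_pM ?hM ?hM'.
- by exists M => // t sz st; rewrite -e// hM.
Qed.

Lemma logpoly_expand P g : logpoly P g -> exists C : seq (rat * seq factor),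
  forall t, size t = N -> simplex t ->
    g t = \sum_(c <- C) ratr c.1 * \prod_(f <- c.2) factor_val t f.
Proof.
elim=> [q|f Pf|g1 h _ [C hC] _ [C' hC']|g1 h _ [C hC] _ [C' hC']|g1 h e _ [C hC]].
- by exists [:: (q, [::])] => t _ _; rewrite big_seq1 big_nil mulr1.
- by exists [:: (1, [:: f])] => t _ _; rewrite big_seq1 big_seq1 rmorph1 mul1r.
- by exists (C ++ C') => t sz st; rewrite hC// hC'// big_cat.
- exists [seq (c.1 * d.1, c.2 ++ d.2) | c <- C, d <- C'] => t sz st.
  rewrite hC// hC'// big_allpairs_dep /= mulr_suml; apply: eq_bigr => c _.
  rewrite mulr_sumr; apply: eq_bigr => d _ /=.
  by rewrite rmorphM big_cat /=; ring.
- by exists C => t sz st; rewrite -e// hC.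
Qed.

Lemma integral_logpoly P g : logpoly P g ->
  (lebesgue_tuple R N).-integrable (selberg_domain R N)
    (fun t : N.-tuple (measurableTypeR R) => (g t)%:E) /\
  mzv_span (\int[lebesgue_tuple R N]_(t in selberg_domain R N) g t).
Proof.
move=> /logpoly_expand [C hC].
have mD := @measurable_Delta R N.
have E (t : N.-tuple (measurableTypeR R)) : t \in selberg_domain R N ->
    (\sum_(c <- C) ratr c.1 * integrand [::] c.2 t)%:E = (g t)%:E.
  rewrite inE => Dt; rewrite hC ?size_tuple//; congr (_%:E).
  by apply: eq_bigr => c _; rewrite /integrand Phi_nil mul1r.
suff [z hz [iz Ez]] : exists2 z : R, mzv_span z &
    (lebesgue_tuple R N).-integrable (selberg_domain R N)
       (fun t : N.-tuple (measurableTypeR R) => (\sum_(c <- C) ratr c.1 * integrand [::] c.2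
           t)%:E) /\
    (\int[lebesgue_tuple R N]_(t in selberg_domain R N)
      (\sum_(c <- C) ratr c.1 * integrand [::] c.2 t)%:E = z%:E)%E.
  split; first by apply: eq_integrable iz => // t tD; exact: E.
  rewrite /Rintegral -(eq_integral _ _ E) Ez; exact: hz.
elim: C {hC E} => [|c C [z2 hz2 [i2 E2]]].
  exists 0; first exact: mzv_span0.
  under eq_fun do rewrite big_nil.
  by split; [exact: integrable0|rewrite integral0].
have [z1 hz1 E1] := @integral_simplex_mzv R N [::] c.2 isT (fun j => ltac:(by [])).
have i1 := @integrable_integrand R N [::] c.2 z1 (fun j => ltac:(by [])) E1.
exists (ratr c.1 * z1 + z2); first by apply: mzv_spanD => //; exact: mzv_spanZ.
under eq_fun do rewrite big_cons EFinD EFinM.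
split; first by apply: integrableD => //; exact: integrableZl.
rewrite integralD//; last exact: integrableZl.
by rewrite integralZl// E1 E2.
Qed.

Definition denominator t : R :=
  (\prod_(i < N) pos t i) * \prod_(p : ord_pair N) (pos t (val p).2 - pos t (val p).1).

Lemma denominator_gt0 t : size t = N -> simplex t -> 0 < denominator t.
Proof.
move=> sz st; apply: mulr_gt0; apply: prodr_gt0 => i _; first exact: simplex_gt0.
by rewrite subr_gt0 simplex_lt// ?sz ?ltn_ord//; exact: (valP i).
Qed.

Lemma logpoly_pos i : logpoly is_coordinate (fun t => pos t i).
Proof. exact: (@logpoly_factor _ (FX i)). Qed.

Lemma logpoly_denominator : logpoly is_coordinate denominator.
Proof.
apply: logpolyM; apply: logpoly_prod => i; first exact: logpoly_pos.
by apply: logpolyB; exact: logpoly_pos.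
Qed.

(** Elements of the ring have no poles on the simplex, and a power of [denominator] clears
    their denominators. *)
Lemma selberg_ring_value f : selberg_ring f -> exists (K : nat) (v g : seq R -> R),
  [/\ logpoly is_coordinate g,
      forall t : N.-tuple R, simplex t -> ratfun_value f t (v t)
    & forall t, size t = N -> simplex t -> v t * denominator t ^+ K = g t].
Proof.
have posE (t : N.-tuple R) (i : 'I_N) : tnth t i = pos t i by rewrite (tnth_nth 1).
elim=> [q|i|i|i j ij|f1 f2 _ [K1 [v1 [g1 [h1 e1 E1]]]] _ [K2 [v2 [g2 [h2 e2 E2]]]]|f1 f2 _ [K1
    [v1 [g1 [h1 e1 E1]]]] _ [K2 [v2 [g2 [h2 e2 E2]]]]].
- exists 0%N, (fun=> ratr q), (fun=> ratr q); split.
  + exact: logpoly_rat.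
  + by move=> t _; exact: RatFunValue.ratfun_value_const.
  + by move=> t _ _; rewrite expr0 mulr1.
- exists 0%N, (fun t => pos t i), (fun t => pos t i); split.
  + exact: logpoly_pos.
  + by move=> t _; rewrite -posE; exact: RatFunValue.ratfun_value_var.
  + by move=> t _ _; rewrite expr0 mulr1.
- exists 1%N, (fun t => (pos t i)^-1), (fun t => (\prod_(j < N | j != i) pos t j) *
    \prod_(p : ord_pair N) (pos t (val p).2 - pos t (val p).1)); split.
  + apply: logpolyM; apply: logpoly_prod => k; first exact: logpoly_pos.
    by apply: logpolyB; exact: logpoly_pos.
  + move=> t st; rewrite -posE; apply: RatFunValue.ratfun_value_inv.
      by rewrite posE gt_eqF// simplex_gt0.
    exact: RatFunValue.ratfun_value_var.
  + move=> t sz st; rewrite expr1 /denominator (bigD1 i) //= !mulrA mulVf ?mul1r//.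
    by rewrite gt_eqF// simplex_gt0.
- pose p0 : ord_pair N := exist _ (i, j) ij.
  exists 1%N, (fun t => (pos t i - pos t j)^-1), (fun t => - ((\prod_(j < N) pos t j) *
    \prod_(p : ord_pair N | p != p0) (pos t (val p).2 - pos t (val p).1))); split.
  + apply: logpolyN; apply: logpolyM; apply: logpoly_prod => k; first exact: logpoly_pos.
    by apply: logpolyB; exact: logpoly_pos.
  + move=> t st; rewrite -!posE; apply: RatFunValue.ratfun_value_inv.
      by rewrite !posE lt_eqF// subr_lt0 simplex_lt// size_tuple.
    apply: RatFunValue.ratfun_valueD; first exact: RatFunValue.ratfun_value_var.
    exact/RatFunValue.ratfun_valueN/RatFunValue.ratfun_value_var.
  + move=> t sz st; rewrite expr1 /denominator (bigD1 p0) //=.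
    have ne : pos t i - pos t j != 0 by rewrite lt_eqF// subr_lt0 simplex_lt// sz.
    rewrite -(opprB (pos t i)) mulNr mulrN mulrN; congr (- _).
    by rewrite mulrCA mulKf.
- exists (K1 + K2)%N, (fun t => v1 t + v2 t),
    (fun t => g1 t * denominator t ^+ K2 + g2 t * denominator t ^+ K1); split.
  + by apply: logpolyD; apply: logpolyM => //; apply: logpolyX; exact: logpoly_denominator.
  + by move=> t st; apply: RatFunValue.ratfun_valueD; auto.
  + by move=> t sz st; rewrite -E1// -E2// exprD; ring.
- exists (K1 + K2)%N, (fun t => v1 t * v2 t), (fun t => g1 t * g2 t); split.
  + exact: logpolyM.
  + by move=> t st; apply: RatFunValue.ratfun_valueM; auto.
  + by move=> t sz st; rewrite -E1// -E2// exprD; ring.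
Qed.

Lemma ratfun_evalE (f : ratfun N) (t : N.-tuple R) v :
  ratfun_value f t v -> ratfun_eval f t = v.
Proof.
move=> h; rewrite /ratfun_eval; apply: xget_unique => // w hw.
exact: ratfun_value_uniq hw h.
Qed.

End LogPoly.

Local Open Scope complex_scope.

(** * Estimates for the exponential function *)

Section Bounds.
Variable R : realType.
Implicit Types x y : R.

Lemma mvt0 (f df : R -> R) x : (forall c : R, is_derive c 1 f (df c)) -> f 0 = 0 ->
  exists2 c, `|c| <= `|x| & f x = df c * x.
Proof.
move=> dfc f0.
have cont a b : {within `[a, b], continuous f}.
  apply: continuous_in_subspaceT => c _.
  apply: differentiable_continuous; apply/derivable1_diffP.
  by have [] := dfc c.
have [x0|x0] := leP 0 x.
  have [c] := MVT_segment x0 (fun c _ => dfc c) (cont 0 x).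
  rewrite in_itv /= f0 !subr0 => /andP[c0 cx] E; exists c => //.
  by rewrite !ger0_norm.
have [c] := MVT_segment (ltW x0) (fun c _ => dfc c) (cont x 0).
rewrite in_itv /= f0 !sub0r => /andP[cx c0] E; exists c.
  by rewrite !ler0_norm ?lerN2// ltW.
by apply: oppr_inj; rewrite E mulrN.
Qed.

Lemma expR_sub1_le x : `|expR x - 1| <= `|x| * expR `|x|.
Proof.
have d (c : R) : is_derive c 1 (@expR R - cst 1) (expR c).
  by apply: is_derive_eq; rewrite subr0.
have [|c cx E] := @mvt0 _ _ x d; first by rewrite !fctE expR0 subrr.
move: E; rewrite !fctE => ->.
rewrite normrM mulrC ler_wpM2l// gtr0_norm ?expR_gt0// ler_expR.
exact: le_trans (ler_norm _) cx.
Qed.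

Lemma expR_sub2_le x : `|expR x - 1 - x| <= x ^+ 2 * expR `|x|.
Proof.
have d (c : R) : is_derive c 1 (@expR R - cst 1 - id) (expR c - 1).
  by apply: is_derive_eq; rewrite subr0.
have [|c cx E] := @mvt0 _ _ x d; first by rewrite !fctE expR0 !subr0 subrr.
move: E; rewrite !fctE => ->.
rewrite normrM mulrC -(real_normK (num_real x)) expr2 -mulrA ler_wpM2l//.
apply: le_trans (expR_sub1_le c) _.
by rewrite ler_pM ?expR_ge0// ler_expR.
Qed.

Lemma sin_le x : `|sin x| <= `|x|.
Proof.
have [c cx ->] := @mvt0 (@sin R) (@cos R) x (fun c => is_derive_sin c) (sin0 R).
by rewrite normrM ler_piMl// ler_norml cos_geN1 cos_le1.
Qed.

Lemma cos_sub1_le x : `|cos x - 1| <= x ^+ 2 /\ `|cos x - 1| <= `|x|.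
Proof.
have d (c : R) : is_derive c 1 (@cos R - cst 1) (- sin c).
  by apply: is_derive_eq; rewrite subr0.
have [|c cx E] := @mvt0 _ _ x d; first by rewrite !fctE cos0 subrr.
move: E; rewrite !fctE => ->; rewrite normrM normrN; split.
  rewrite -(real_normK (num_real x)) expr2 ler_wpM2r//.
  exact: le_trans (sin_le c) cx.
by rewrite ler_piMl// ler_norml sin_geN1 sin_le1.
Qed.

Lemma sin_sub_le x : `|sin x - x| <= x ^+ 2.
Proof.
have d (c : R) : is_derive c 1 (@sin R - id) (cos c - 1) by apply: is_derive_eq.
have [|c cx E] := @mvt0 _ _ x d; first by rewrite !fctE sin0 subrr.
move: E; rewrite !fctE => ->.
rewrite normrM -(real_normK (num_real x)) expr2 ler_wpM2r//.
exact: le_trans (cos_sub1_le c).2 cx.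
Qed.

Lemma cexpD (z w : R[i]) : cexp (z + w) = cexp z * cexp w.
Proof.
case: z => a b; case: w => c d; rewrite /cexp /=.
by rewrite expRD cosD sinD; simpc; congr (_ +i* _); ring.
Qed.

Lemma cexp0 : cexp (0 : R[i]) = 1.
Proof. by rewrite /cexp /= expR0 cos0 sin0 mul1r. Qed.

Lemma cexp_sum (I : Type) (r : seq I) (F : I -> R[i]) :
  cexp (\sum_(i <- r) F i) = \prod_(i <- r) cexp (F i).
Proof. exact: (big_morph _ cexpD cexp0). Qed.

Lemma cexp_real (a : R) : cexp a%:C = (expR a)%:C.
Proof. by rewrite /cexp /= cos0 sin0 complexr0 mulr1. Qed.

Lemma cexp_taylor1 (w : R[i]) (q : R) : `|Re w| + `|Im w| <= q ->
  `|Re (cexp w - 1 - w)| <= q ^+ 2 * expR q /\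
  `|Im (cexp w - 1 - w)| <= q ^+ 2 * expR q.
Proof.
case: w => x y /= hq; rewrite /cexp /=; simpc.
have xq : `|x| <= q by apply: le_trans hq; rewrite lerDl.
have sq : x ^+ 2 + y ^+ 2 <= q ^+ 2.
  rewrite -(real_normK (num_real x)) -(real_normK (num_real y)).
  apply: (@le_trans _ _ ((`|x| + `|y|) ^+ 2)).
    by rewrite sqrrD lerD2r lerDl mulrn_wge0// mulr_ge0.
  by rewrite lerXn2r ?nnegrE ?addr_ge0// (le_trans _ xq).
have e1 : 1 <= expR `|x| by rewrite -expR0 ler_expR.
have eq_ : expR `|x| <= expR q by rewrite ler_expR.
have ex : expR x <= expR `|x| by rewrite ler_expR ler_norm.
split.
  rewrite (_ : _ - _ = (expR x - 1 - x) + expR x * (cos y - 1)); last by ring.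
  apply: le_trans (ler_normD _ _) _.
  apply: (@le_trans _ _ ((x ^+ 2 + y ^+ 2) * expR `|x|)).
    rewrite mulrDl lerD ?expR_sub2_le// normrM mulrC ler_pM ?(cos_sub1_le _).1//.
    by rewrite ger0_norm ?expR_ge0.
  by rewrite ler_pM ?addr_ge0 ?sqr_ge0 ?expR_ge0.
rewrite (_ : _ - _ = (expR x - 1) * sin y + (sin y - y)); last by ring.
apply: le_trans (ler_normD _ _) _.
apply: (@le_trans _ _ ((`|x| * `|y| + y ^+ 2) * expR `|x|)).
  rewrite [X in _ <= X]mulrDl lerD//.
    rewrite normrM [X in _ <= X]mulrAC ler_pM ?sin_le//; exact: expR_sub1_le.
  by apply: le_trans (sin_sub_le y) _; rewrite ler_peMr ?sqr_ge0.
apply: ler_pM => //; first by rewrite addr_ge0 ?sqr_ge0 ?mulr_ge0.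
apply: (@le_trans _ _ ((`|x| + `|y|) ^+ 2)); last first.
  by rewrite lerXn2r ?nnegrE ?addr_ge0// (le_trans _ xq).
rewrite -(real_normK (num_real y)) sqrrD lerD2r mulr2n addrA lerDr.
by rewrite addr_ge0 ?sqr_ge0 ?mulr_ge0.
Qed.

Lemma cexp_mul_le (z r : R[i]) (B : R) : `|Re r| <= B -> `|Im r| <= B ->
  `|Re (cexp z * r)| <= expR (Re z) * (2 * B) /\
  `|Im (cexp z * r)| <= expR (Re z) * (2 * B).
Proof.
case: z => a b; case: r => u v /= hu hv; rewrite /cexp /=; simpc.
have cb : `|cos b| <= 1 by rewrite ler_norml cos_geN1 cos_le1.
have sb : `|sin b| <= 1 by rewrite ler_norml sin_geN1 sin_le1.
have e0 := expR_ge0 a.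
have H p q : `|p| <= 1 -> `|q| <= 1 -> `|expR a * p * u| + `|expR a * q * v| <= expR a * (2 * B).
  move=> p1 q1; rewrite !normrM (ger0_norm e0) -!mulrA -mulrDr ler_wpM2l//.
  rewrite mulr_natl mulr2n lerD// -[X in _ <= X]mul1r ler_pM//.
split; last first.
  by apply: le_trans (ler_normD _ _) _; rewrite addrC; apply: H.
apply: le_trans (ler_normB _ _) _; exact: H.
Qed.

(** The exponential factor absorbs all powers of L. *)
Lemma power_expR_le (L e : R) k : 0 <= L -> 0 < e ->
  L ^+ k * expR (- (e * L)) <= k`!%:R / e ^+ k.
Proof.
move=> L0 e0; rewrite ler_pdivlMr ?exprn_gt0// mulrAC -exprMn_comm; last exact: mulrC.
rewrite expRN ler_pdivrMr ?expR_gt0// (mulrC L).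
case: k => [|k]; first by rewrite expr0 mul1r -expR0 ler_expR mulr_ge0// ltW.
rewrite [X in _ <= X]mulrC -ler_pdivrMr ?ltr0n ?fact_gt0//.
apply: le_trans (@expR_ge1Dxn R (e * L) k (mulr_ge0 (ltW e0) L0)).
by rewrite lerDr.
Qed.

End Bounds.

(** * A criterion for complex differentiability *)

Section ComplexDifferential.
Variable R : realType.
Local Notation C := R[i].

Lemma normc_le (z : C) (B : R) : `|Re z| <= B -> `|Im z| <= B -> `|z| <= (2 * B)%:C.
Proof.
move=> hx hy; have B0 : 0 <= B by exact: le_trans hx.
rewrite normc_def lecR -[leRHS]ger0_norm ?mulr_ge0// -sqrtr_sqr.
apply: ler_wsqrtr.
have : `|Re z| ^+ 2 <= B ^+ 2 by rewrite lerXn2r.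
have : `|Im z| ^+ 2 <= B ^+ 2 by rewrite lerXn2r.
rewrite !real_normK ?num_real// => h1 h2.
have := sqr_ge0 B; lra.
Qed.

Lemma abs_Re_le (z : C) (B : R) : `|z| <= B%:C -> `|Re z| <= B.
Proof. by move=> h; rewrite -lecR (le_trans (normc_ge_Re z)). Qed.

Lemma abs_Im_le (z : C) (B : R) : `|z| <= B%:C -> `|Im z| <= B.
Proof.
rewrite normc_def lecR; apply: le_trans; rewrite -sqrtr_sqr.
by apply: ler_wsqrtr; rewrite lerDr sqr_ge0.
Qed.

Variable n : nat.
Local Notation V := 'rV[C]_n.
Implicit Types (h s : V).

Lemma coord_norm_le h i : `|h 0 i| <= `|h|.
Proof.
rewrite [leRHS]/Num.norm /= mx_normE.
exact: (@le_bigmax _ _ _ _ (fun i : 'I_1 * 'I_n => `|h i.1 i.2|%:nng) (0, i)).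
Qed.

End ComplexDifferential.

Definition linear_form (R : realType) n (c : 'I_n -> R[i]) (h : 'rV[R[i]]_n) : R[i] :=
  \sum_i h 0 i *: c i.

Lemma linear_form_linear (R : realType) n (c : 'I_n -> R[i]) : linear (linear_form c).
Proof.
move=> a u v; rewrite /linear_form scaler_sumr -big_split; apply: eq_bigr => i _ /=.
by rewrite !mxE scalerDl scalerA.
Qed.

HB.instance Definition _ (R : realType) n (c : 'I_n -> R[i]) :=
  GRing.isLinear.Build R[i] 'rV[R[i]]_n R[i] *:%R (linear_form c) (linear_form_linear c).

Lemma linear_form_continuous (R : realType) n (c : 'I_n -> R[i]) : continuous (linear_form c).
Proof.
move=> h; rewrite /continuous_at /linear_form.
elim: (index_enum _) => [|i r IH].
  rewrite big_nil; under eq_fun do rewrite big_nil; exact: (@cst_continuous _ _ 0 h).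
rewrite big_cons; under eq_fun do rewrite big_cons.
apply: (cvgD _ IH); apply: (cvgZr_tmp (k := h 0 i)); exact: (@coord_continuous R[i] 1 n 0 i h).
Qed.

Lemma differential_near (K : numFieldType) (V W : normedModType K) (F : V -> W)
    (df : {linear V -> W}) (s : V) : continuous df ->
  (forall e : K, 0 < e -> \forall h \near (0 : V), `|F (h + s) - F s - df h| <= e * `|h|) ->
  differentiable F s /\ 'd F s = df :> (V -> W).
Proof.
move=> cdf hF.
have E : F \o shift s = cst (F s) + df +o_ 0 id.
  apply/eqaddoP => e e0; near=> h.
  have -> : (F \o shift s - (cst (F s) + df)) h = F (h + s) - F s - df h.
    by rewrite !fctE /= opprD addrA.
  by near: h; exact: hF.
have ED : 'd F s = df :> (_ -> _) by apply: diff_unique.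
by split=> //; apply/diff_locallyP; rewrite ED.
Unshelve. all: by end_near. Qed.

Lemma quadratic_differential (R : realType) (V W : normedModType R[i]) (F : V -> W)
    (df : {linear V -> W}) (s : V) (r K : R) : 0 < r -> continuous df ->
  (forall (x : R) (h : V), `|h| = x%:C -> x <= r ->
    `|F (h + s) - F s - df h| <= (K * x ^+ 2)%:C) ->
  differentiable F s /\ 'd F s = df :> (V -> W).
Proof.
move=> r0 cdf hF; apply: differential_near => // e e0.
have [e1 e10 ->] : exists2 e1 : R, 0 < e1 & e = e1%:C.
  have /RRe_real <- : e \is Num.real by rewrite realE (ltW e0).
  by exists (Re e) => //; move: e0; rewrite ltcE /= => /andP[].
have K0 : 0 < `|K| + 1 by rewrite ltr_wpDl.
near=> h.
have [x hx] : exists x : R, `|h| = x%:C.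
  have : 0 <= `|h| by exact: normr_ge0.
  by rewrite lecE /= => /andP[/eqP]; case: `|h| => a b /= -> _; exists a.
have x0 : 0 <= x by have := normr_ge0 h; rewrite hx lecE => /andP[].
have xd : x <= Num.min r (e1 / (`|K| + 1)).
  rewrite -lecR -hx; near: h; apply: nbhs0_le.
  by rewrite ltcR lt_min r0 divr_gt0.
move: xd; rewrite le_min => /andP[xr]; rewrite ler_pdivlMr// => xe.
apply: le_trans (hF x h hx xr) _; rewrite hx -rmorphM lecR.
apply: (@le_trans _ _ ((`|K| + 1) * x ^+ 2)).
  by rewrite ler_wpM2r ?sqr_ge0// (le_trans (ler_norm K))// lerDl.
by rewrite expr2 mulrA ler_wpM2r// mulrC.
Unshelve. all: by end_near. Qed.

(** * Complex-valued integrals *)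

Section ComplexIntegral.
Context d (T : measurableType d) (R : realType) (mu : {measure set T -> \bar R}).
Variable (D : set T).
Hypothesis mD : measurable D.
Implicit Types (f g : T -> R[i]).

Let intg (f : T -> R) := mu.-integrable D (EFin \o f).

Let intgD (f g : T -> R) : intg f -> intg g -> intg (fun t => f t + g t).
Proof. by move=> hf hg; apply: eq_integrable (integrableD mD hf hg). Qed.

Let intgZ (k : R) (f : T -> R) : intg f -> intg (fun t => k * f t).
Proof. by move=> hf; apply: eq_integrable (integrableZl mD k hf). Qed.

Lemma eq_cintegrable f g : (forall t, D t -> f t = g t) ->
  cintegrable mu D f -> cintegrable mu D g.
Proof.
move=> e [hr hi]; split; [apply: eq_integrable hr|apply: eq_integrable hi] => //;
  by move=> t; rewrite inE => Dt; rewrite e.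
Qed.

Lemma eq_cintegral f g : (forall t, D t -> f t = g t) ->
  cintegral mu D f = cintegral mu D g.
Proof.
by move=> e; congr (_ +i* _); apply: eq_Rintegral => t; rewrite inE => Dt; rewrite e.
Qed.

Lemma cintegrableD f g : cintegrable mu D f -> cintegrable mu D g ->
  cintegrable mu D (fun t => f t + g t).
Proof.
move=> [fr fi] [gr gi]; split.
  by under eq_fun do rewrite raddfD; exact: intgD.
by under eq_fun do rewrite raddfD; exact: intgD.
Qed.

Lemma cintegralD f g : cintegrable mu D f -> cintegrable mu D g ->
  cintegral mu D (fun t => f t + g t) = cintegral mu D f + cintegral mu D g.
Proof.
move=> [fr fi] [gr gi]; rewrite /cintegral; simpc.
by congr (_ +i* _); rewrite -RintegralD//; apply: eq_Rintegral => t _; rewrite raddfD.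
Qed.

Lemma ReM (z w : R[i]) : Re (z * w) = Re z * Re w + (- Im z) * Im w.
Proof. by case: z => a b; case: w => c e; simpc; rewrite /= ?mulNr. Qed.

Lemma ImM (z w : R[i]) : Im (z * w) = Im z * Re w + Re z * Im w.
Proof. by case: z => a b; case: w => c e; simpc; rewrite /= addrC. Qed.

Lemma cintegrableZ (z : R[i]) f : cintegrable mu D f -> cintegrable mu D (fun t => z * f t).
Proof.
move=> [fr fi]; split.
  by under eq_fun do rewrite ReM; apply: intgD; exact: intgZ.
by under eq_fun do rewrite ImM; apply: intgD; exact: intgZ.
Qed.

Lemma cintegralZ (z : R[i]) f : cintegrable mu D f ->
  cintegral mu D (fun t => z * f t) = z * cintegral mu D f.
Proof.
move=> [fr fi]; rewrite /cintegral.
rewrite [RHS](_ : _ = (Re z * \int[mu]_(t in D) Re (f t) + (- Im z) * \int[mu]_(t in D) Im (f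
    t)) +i*
  (Im z * \int[mu]_(t in D) Re (f t) + Re z * \int[mu]_(t in D) Im (f t))); last first.
  by case: z => a b; simpc; congr (_ +i* _); rewrite addrC.
congr (_ +i* _); rewrite -!RintegralZl// -RintegralD//; try exact: intgZ.
  by apply: eq_Rintegral => t _; rewrite ReM.
by apply: eq_Rintegral => t _; rewrite ImM.
Qed.

Lemma cintegral_sum (I : Type) (r : seq I) (F : I -> T -> R[i]) :
  (forall i, cintegrable mu D (F i)) ->
  cintegrable mu D (fun t => \sum_(i <- r) F i t) /\
  cintegral mu D (fun t => \sum_(i <- r) F i t) = \sum_(i <- r) cintegral mu D (F i).
Proof.
move=> hF; elim: r => [|i r [h1 h2]].
  rewrite big_nil; under eq_fun do rewrite big_nil.
  split; first by split; exact: integrable0.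
  by rewrite /cintegral /= /Rintegral integral0.
rewrite big_cons -h2 -cintegralD//; under eq_fun do rewrite big_cons.
by split => //; exact: cintegrableD.
Qed.

Hypothesis muD : (mu D < +oo)%E.

Lemma bounded_cintegrable f (B : R) :
  measurable_fun D (fun t => Re (f t)) -> measurable_fun D (fun t => Im (f t)) ->
  (forall t, D t -> `|Re (f t)| <= B /\ `|Im (f t)| <= B) -> cintegrable mu D f.
Proof.
have H (g : T -> R) : measurable_fun D g -> (forall t, D t -> `|g t| <= B) -> intg g.
  move=> mg hg; apply: measurable_bounded_integrable => //.
  exists B; split; first exact: num_real.
  by move=> x Bx t Dt; apply: le_trans (hg _ Dt) _; exact: ltW.
by move=> mr mi hf; split; apply: H => // t /hf [].
Qed.

Lemma cintegral_le f (B : R) : cintegrable mu D f ->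
  (forall t, D t -> `|Re (f t)| <= B /\ `|Im (f t)| <= B) ->
  `|cintegral mu D f| <= (2 * (B * fine (mu D)))%:C.
Proof.
have H (g : T -> R) : intg g -> (forall t, D t -> `|g t| <= B) ->
    `|\int[mu]_(t in D) g t| <= B * fine (mu D).
  move=> ig hg; apply: le_trans (le_normr_Rintegral mD ig) _.
  rewrite -Rintegral_cst//; apply: le_Rintegral => //.
    by apply: eq_integrable (integrable_abse ig).
  apply: measurable_bounded_integrable => //.
  exists `|B|; split; first exact: num_real.
  by move=> x Bx t Dt; exact: ltW Bx.
move=> [fr fi] hf; apply: normc_le => /=; apply: H => // t /hf [] //.
Qed.

End ComplexIntegral.

(** * Laplace transforms in several variables *)

Section Laplace.
Context d (T : measurableType d) (R : realType) (mu : {measure set T -> \bar R}).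
Variables (D : set T) (V : finType) (g : T -> R) (l : V -> T -> R) (A : V -> R) (M : R).
Hypothesis mD : measurable D.
Hypothesis muD : (mu D < +oo)%E.
Hypothesis mg : measurable_fun D g.
Hypothesis ml : forall v, measurable_fun D (l v).
Hypothesis l_le0 : forall v t, D t -> l v t <= 0.
Hypothesis gM : forall t, D t -> `|g t| * expR (\sum_v A v * l v t) <= M.

Local Notation C := R[i].
Local Notation point := 'rV[C]_#|V|.
Implicit Types (s h : point) (m : {ffun V -> nat}).

Definition laplace_exponent s t : C := \sum_v ccoord s v * (l v t)%:C.

Definition laplace_coef m t : R := g t * \prod_v l v t ^+ m v.

Definition laplace_integrand m s t : C := (laplace_coef m t)%:C * cexp (laplace_exponent s t).

(** For m = 0, the Laplace transform of g; in general, what differentiation under the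
    integral sign suggests for its partial derivative of multi-index m. *)
Definition laplace m s : C := cintegral mu D (laplace_integrand m s).

Definition laplace_region : set point := [set s | forall v, A v < Re (ccoord s v)].

Definition succ_index v m : {ffun V -> nat} := [ffun w => (m w + (w == v))%N].

Lemma eq_laplace m m' s : m =1 m' -> laplace m s = laplace m' s.
Proof. by move=> /ffunP ->. Qed.

Lemma Re_laplace_exponent s t : Re (laplace_exponent s t) = \sum_v Re (ccoord s v) * l v t.
Proof. by rewrite raddf_sum; apply: eq_bigr => v _; apply: etrans (ReM _ _) _; rewrite /= mulr0
    addr0. Qed.

Lemma Im_laplace_exponent s t : Im (laplace_exponent s t) = \sum_v Im (ccoord s v) * l v t.
Proof. by rewrite raddf_sum; apply: eq_bigr => v _; apply: etrans (ImM _ _) _; rewrite /= mulr0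
    addr0. Qed.

Lemma laplace_exponentD h s t : laplace_exponent (h + s) t = laplace_exponent h t +
    laplace_exponent s t.
Proof.
by rewrite -big_split; apply: eq_bigr => v _; rewrite /ccoord mxE mulrDl.
Qed.

Lemma laplace_coef_succ_index v m t : laplace_coef (succ_index v m) t = laplace_coef m t * l v t.
Proof.
rewrite /laplace_coef -mulrA; congr (_ * _).
transitivity (\prod_w (l w t ^+ m w * l w t ^+ (w == v))).
  by apply: eq_bigr => w _; rewrite ffunE exprD.
rewrite big_split /=; congr (_ * _).
by rewrite (bigD1 v)//= eqxx expr1 big1 ?mulr1// => w /negbTE ->; rewrite expr0.
Qed.

Lemma laplace_integrand_succ_index v m s t :
  laplace_integrand (succ_index v m) s t = laplace_integrand m s t * (l v t)%:C.
Proof. by rewrite /laplace_integrand laplace_coef_succ_index rmorphM mulrAC. Qed.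

Let L t : R := - \sum_v l v t.

Let L_ge0 t : D t -> 0 <= L t.
Proof. by move=> Dt; rewrite oppr_ge0 sumr_le0// => v _; exact: l_le0. Qed.

Let l_le_L v t : D t -> `|l v t| <= L t.
Proof.
move=> Dt; rewrite ler0_norm ?l_le0// lerN2 (bigD1 v)//= gerDl.
by rewrite sumr_le0// => w _; exact: l_le0.
Qed.

Let deg m : nat := (\sum_v m v)%N.

Lemma laplace_coef_le m t : D t -> `|laplace_coef m t| <= `|g t| * L t ^+ deg m.
Proof.
move=> Dt; rewrite normrM ler_wpM2l// normr_prod -prodrXr ler_prod// => v _.
by rewrite normr_ge0 normrX lerXn2r ?nnegrE ?l_le_L ?L_ge0.
Qed.

Lemma laplace_margin s : laplace_region s ->
  exists2 e : R, 0 < e & forall v, A v + 2 * e <= Re (ccoord s v).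
Proof.
move=> Us; pose e := \big[Num.min/1]_v ((Re (ccoord s v) - A v) / 2).
exists e => [|v].
  by apply: lt_bigmin => // v _; rewrite divr_gt0// subr_gt0.
have : e <= (Re (ccoord s v) - A v) / 2 by exact: bigmin_le.
lra.
Qed.

(** The distance 2 e of s from the boundary of the region pays for the powers of L and for
    one additional factor exp(e L). *)
Lemma laplace_domination m k (e : R) s t : D t -> 0 < e ->
  (forall v, A v + 2 * e <= Re (ccoord s v)) ->
  `|laplace_coef m t| * expR (Re (laplace_exponent s t)) * (L t ^+ k * expR (e * L t)) <=
    M * ((deg m + k)`!%:R / e ^+ (deg m + k)).
Proof.
move=> Dt e0 hs; have L0 := L_ge0 Dt.
have hx : Re (laplace_exponent s t) <= \sum_v A v * l v t - e * L t - e * L t.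
  rewrite Re_laplace_exponent /L mulrN !opprK -addrA -mulrDl mulr_sumr -big_split ler_sum//= => v _.
  rewrite -mulrDl ler_wnM2r ?l_le0//; have := hs v; lra.
apply: (@le_trans _ _ ((`|g t| * expR (\sum_v A v * l v t)) *
    (L t ^+ (deg m + k) * expR (- (e * L t))))); last first.
  apply: ler_pM; rewrite ?mulr_ge0 ?expR_ge0 ?exprn_ge0 ?gM//.
  exact: power_expR_le.
apply: (@le_trans _ _ ((`|g t| * L t ^+ deg m) * (expR (\sum_v A v * l v t) * expR (- (e * L t))
    * expR (- (e * L t))) * (L t ^+ k * expR (e * L t)))).
  rewrite ler_wpM2r ?mulr_ge0 ?expR_ge0 ?exprn_ge0//.
  apply: ler_pM; rewrite ?expR_ge0 ?laplace_coef_le// -!expRD ler_expR.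
  exact: hx.
rewrite exprD [X in X <= _](_ : _ = (`|g t| * expR (\sum_v A v * l v t)) *
    (L t ^+ deg m * L t ^+ k * expR (- (e * L t))) * (expR (- (e * L t)) * expR (e * L t)));
        last by ring.
by rewrite -expRD addNr expR0 mulr1.
Qed.

Let mexp s : measurable_fun D (fun t => Re (laplace_exponent s t)) /\
  measurable_fun D (fun t => Im (laplace_exponent s t)).
Proof.
split.
  under eq_fun do rewrite Re_laplace_exponent.
  by apply: measurable_sum => v; apply: measurable_funM => //; exact: measurable_cst.
under eq_fun do rewrite Im_laplace_exponent.
by apply: measurable_sum => v; apply: measurable_funM => //; exact: measurable_cst.
Qed.

Let mcoef m : measurable_fun D (laplace_coef m).
Proof.
apply: measurable_funM => //.
apply: measurable_prod => v _; exact: measurable_funX.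
Qed.

Lemma Re_laplace_integrand m s t : Re (laplace_integrand m s t) =
  laplace_coef m t * (expR (Re (laplace_exponent s t)) * cos (Im (laplace_exponent s t))).
Proof. by rewrite /laplace_integrand /cexp; simpc. Qed.

Lemma Im_laplace_integrand m s t : Im (laplace_integrand m s t) =
  laplace_coef m t * (expR (Re (laplace_exponent s t)) * sin (Im (laplace_exponent s t))).
Proof. by rewrite /laplace_integrand /cexp; simpc. Qed.

Lemma integrable_laplace m s : laplace_region s ->
  cintegrable mu D (laplace_integrand m s).
Proof.
move=> Us; have [e e0 hs] := laplace_margin Us.
have [mr mi] := mexp s.
have mer : measurable_fun D (fun t => expR (Re (laplace_exponent s t))).
  exact: measurableT_comp (@measurable_expR R) mr.
apply: (@bounded_cintegrable _ _ _ _ _ mD muD _ (M * ((deg m + 0)`!%:R / e ^+ (deg m + 0)))).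
- under eq_fun do rewrite Re_laplace_integrand.
  apply: measurable_funM => //; apply: measurable_funM => //.
  exact: measurableT_comp (continuous_measurable_fun (@continuous_cos R)) mi.
- under eq_fun do rewrite Im_laplace_integrand.
  apply: measurable_funM => //; apply: measurable_funM => //.
  exact: measurableT_comp (continuous_measurable_fun (@continuous_sin R)) mi.
move=> t Dt; have := laplace_domination m 0 Dt e0 hs; rewrite expr0 mul1r => hB.
have e1 : 1 <= expR (e * L t) by rewrite -expR0 ler_expR mulr_ge0 ?L_ge0// ltW.
have H (c : R) : `|c| <= 1 -> `|laplace_coef m t * (expR (Re (laplace_exponent s t)) * c)| <=
    M * ((deg m + 0)`!%:R / e ^+ (deg m + 0)).
  move=> c1; apply: le_trans hB; rewrite !normrM (ger0_norm (expR_ge0 _)) mulrA.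
  by rewrite ler_wpM2l ?mulr_ge0 ?expR_ge0// (le_trans c1).
by rewrite Re_laplace_integrand Im_laplace_integrand; split; apply: H;
  rewrite ler_norml ?cos_geN1 ?cos_le1 ?sin_geN1 ?sin_le1.
Qed.

Lemma laplace_open : open laplace_region.
Proof.
rewrite openE => s Us; have [e e0 hs] := laplace_margin Us.
have e0' : 0 < e%:C by rewrite ltcR.
apply/nbhs_ballP; exists e%:C => // s'.
rewrite -ball_normE /= => ss' v.
have : `|(s - s') 0 (enum_rank v)| <= e%:C.
  by apply: le_trans (ltW ss'); exact: coord_norm_le.
move=> /abs_Re_le; rewrite !mxE raddfB /= => /(le_trans (ler_norm _)).
have := hs v; rewrite /ccoord; lra.
Qed.

Definition laplace_diff m s (j : 'I_#|V|) : C := laplace (succ_index (enum_val j) m) s.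

Lemma laplace_diffE m s h : laplace_region s ->
  cintegrable mu D (fun t => laplace_exponent h t * laplace_integrand m s t) /\
  linear_form (laplace_diff m s) h = cintegral mu D (fun t => laplace_exponent h t *
      laplace_integrand m s t).
Proof.
move=> Us.
have E t : \sum_(j < #|V|) h 0 j * laplace_integrand (succ_index (enum_val j) m) s t =
    laplace_exponent h t * laplace_integrand m s t.
  rewrite /laplace_exponent mulr_suml (reindex (@enum_rank V)) /=; last first.
    by exists (@enum_val V predT) => j _; rewrite ?enum_rankK ?enum_valK.
  by apply: eq_bigr => v _; rewrite enum_rankK laplace_integrand_succ_index /ccoord; ring.
have I j : cintegrable mu D (fun t => h 0 j * laplace_integrand (succ_index (enum_val j) m) s t).
  by apply: cintegrableZ => //; exact: integrable_laplace.
have [I1 I2] := cintegral_sum mD (index_enum _) I.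
split; first by apply: (eq_cintegrable mD _ I1) => t _; exact: E.
rewrite -(eq_cintegral mu (fun t _ => E t)) I2; apply: eq_bigr => j _.
by rewrite cintegralZ//; exact: integrable_laplace.
Qed.

Lemma laplace_exponent_le h (x : R) t : D t -> `|h| = x%:C ->
  `|Re (laplace_exponent h t)| + `|Im (laplace_exponent h t)| <= 2 * x * L t.
Proof.
move=> Dt hx.
have H (c : V -> R) : (forall v, `|c v| <= x) -> `|\sum_v c v * l v t| <= x * L t.
  move=> hc; apply: le_trans (ler_norm_sum _ _ _) _.
  rewrite /L mulrN mulr_sumr -sumrN ler_sum// => v _.
  by rewrite normrM -mulrN ler_pM// ler0_norm ?l_le0.
have hv v : `|ccoord h v| <= x%:C by rewrite -hx; exact: coord_norm_le.
rewrite Re_laplace_exponent Im_laplace_exponent (_ : 2 * x * L t = x * L t + x * L t); last by ring.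
apply: lerD; apply: H => v; [exact: abs_Re_le|exact: abs_Im_le].
Qed.

(** For |h| = x at most e/2 the second order remainder of exp is at most a constant times
    (x L)^2 exp(e L), which [laplace_domination] bounds uniformly in t. *)
Lemma differentiable_laplace m s : laplace_region s ->
  differentiable (laplace m) s /\
  'd (laplace m) s = linear_form (laplace_diff m s) :> (point -> C).
Proof.
move=> Us; have [e e0 hs] := laplace_margin Us.
pose C0 := M * ((deg m + 2)`!%:R / e ^+ (deg m + 2)).
pose B := 8 * C0.
apply: (@quadratic_differential R _ _ (laplace m) (linear_form (laplace_diff m s)) s (e / 2) (2
    * (B * fine (mu D)))).
- by rewrite divr_gt0.
- exact: linear_form_continuous.
move=> x h hx xe.
have x0 : 0 <= x by have := normr_ge0 h; rewrite hx lecE => /andP[].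
have Uhs : laplace_region (h + s).
  move=> v; have /abs_Re_le : `|ccoord h v| <= x%:C by rewrite -hx; exact: coord_norm_le.
  rewrite /ccoord mxE raddfD /= => /ler_normlP[]; have := hs v; rewrite /ccoord; lra.
have [I2 E2] := laplace_diffE m h Us.
have I0 := integrable_laplace m Us; have I1 := integrable_laplace m Uhs.
pose rest t := (laplace_integrand m (h + s) t + (-1) * laplace_integrand m s t) + (-1) *
    (laplace_exponent h t * laplace_integrand m s t).
have Ir : cintegrable mu D rest.
  apply: cintegrableD => //; last by apply: cintegrableZ.
  by apply: cintegrableD => //; apply: cintegrableZ.
have -> : laplace m (h + s) - laplace m s - linear_form (laplace_diff m s) h = cintegral mu D rest.
  rewrite E2 /rest !cintegralD ?cintegralZ//; do ?[by apply: cintegrableZ|by apply: cintegrableD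
      => //; apply: cintegrableZ].
  by rewrite !mulN1r.
rewrite (_ : 2 * (B * fine (mu D)) * x ^+ 2 = 2 * (B * x ^+ 2 * fine (mu D))); last by ring.
apply: cintegral_le => // t Dt.
have L0 := L_ge0 Dt.
pose w := laplace_exponent h t; pose z := laplace_exponent s t.
have -> : rest t = (laplace_coef m t)%:C * (cexp z * (cexp w - 1 - w)).
  by rewrite /rest /laplace_integrand laplace_exponentD cexpD -/w -/z; ring.
have [a1 a2] := cexp_taylor1 (laplace_exponent_le Dt hx).
have [b1 b2] := cexp_mul_le z a1 a2.
have H (c : R) : `|c| <= expR (Re z) * (2 * ((2 * x * L t) ^+ 2 * expR (2 * x * L t))) ->
    `|laplace_coef m t * c| <= B * x ^+ 2.
  move=> hc; rewrite normrM.
  apply: (@le_trans _ _ (8 * x ^+ 2 * (`|laplace_coef m t| * expR (Re z) * (L t ^+ 2 * expR (e *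
      L t))))).
    rewrite (_ : 8 * _ * _ = `|laplace_coef m t| * (expR (Re z) * (2 * ((2 * x * L t) ^+ 2 *
        expR (e * L t))))); last by ring.
    rewrite ler_wpM2l// (le_trans hc)// !ler_wpM2l ?expR_ge0 ?sqr_ge0//.
    by rewrite ler_expR ler_wpM2r//; lra.
  rewrite /B mulrAC ler_wpM2r ?sqr_ge0// ler_wpM2l// .
  exact: laplace_domination.
by split; [rewrite ReM /= oppr0 mul0r addr0|rewrite ImM /= mul0r add0r]; apply: H.
Qed.

Lemma partial_laplace v m s : laplace_region s ->
  partial v (laplace m) s = laplace (succ_index v m) s.
Proof.
move=> Us; have [df dE] := differentiable_laplace m Us.
rewrite /partial deriveE// dE /linear_form (bigD1 (enum_rank v))//= big1.
  by rewrite addr0 mxE !eqxx scale1r /laplace_diff enum_rankK.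
by move=> j jv; rewrite mxE (negbTE jv) andbF scale0r.
Qed.

Lemma partial_eq v (F G : point -> C) s : (forall s, laplace_region s -> F s = G s) ->
  laplace_region s -> partial v F s = partial v G s.
Proof.
move=> FG Us; apply: near_eq_derive.
by apply: filterS FG _; exact: open_nbhs_nbhs (conj laplace_open Us).
Qed.

Lemma mpartial_laplace m (F : point -> C) s :
  (forall s, laplace_region s -> F s = laplace [ffun=> 0%N] s) -> laplace_region s ->
  mpartial m F s = laplace m s.
Proof.
move=> hF Us; rewrite /mpartial.
suff H (r : seq V) : uniq r -> forall s, laplace_region s ->
    foldr (fun i => iter (m i) (partial i)) F r s =
    laplace [ffun v => if v \in r then m v else 0%N] s.
  by rewrite H ?enum_uniq//; apply: eq_laplace => v; rewrite ffunE mem_enum.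
elim: r => [_ s' Us'|v r IH /= /andP[vr ur]].
  by rewrite /= hF//; apply: eq_laplace => v; rewrite !ffunE.
suff H k s' : laplace_region s' ->
    iter k (partial v) (foldr (fun i => iter (m i) (partial i)) F r) s' =
    laplace [ffun w => if w \in r then m w else if w == v then k else 0%N] s'.
  move=> s' Us'; rewrite H//; apply: eq_laplace => w; rewrite !ffunE inE.
  by case: (w \in r); rewrite ?orbT ?orbF//; case: eqP => // ->.
elim: k s' => [|k IHk] s' Us'.
  rewrite /= IH//; apply: eq_laplace => w; rewrite !ffunE.
  by case: (w \in r) => //; case: eqP.
rewrite iterS (partial_eq v IHk Us') partial_laplace//.
apply: eq_laplace => w; rewrite !ffunE.
case: eqP => [->|_]; last by rewrite addn0.
by rewrite (negbTE vr) addn1.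
Qed.

End Laplace.

(** * The Selberg integral *)

Section SelbergLaplace.
Variables (R : realType) (N : nat).
Local Notation V := (selberg_var N).
Local Notation mu := (lebesgue_tuple R N).
Local Notation D := (selberg_domain R N).
Local Notation T := (N.-tuple (measurableTypeR R)).
Implicit Types (t : seq R) (v : V).

Definition selberg_base v t : R :=
  match v with
  | inl (inl i) => pos t i
  | inl (inr i) => 1 - pos t i
  | inr p => pos t (val p).2 - pos t (val p).1
  end.

Definition selberg_log v t : R := ln (selberg_base v t).

(** The bounds for the real parts of the exponents: f has no poles at t_i = 1. *)
Definition pole_bound (K : nat) v : nat := if v is inl (inr _) then 0%N else K.

Lemma prod_selberg_var (S : comPzRingType) (F : V -> S) :
  \prod_v F v = (\prod_(i < N) (F (inl (inl i)) * F (inl (inr i)))) * \prod_p F (inr p).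
Proof. by rewrite !big_sumType big_split. Qed.

Lemma selberg_base_gt0 v t : size t = N -> simplex t -> 0 < selberg_base v t.
Proof.
move=> sz st; case: v => [[i|i]|p] /=; first exact: simplex_gt0.
  rewrite subr_gt0 -(nth_default 1 (leqnn (size t))) -/(pos t _).
  by apply: simplex_lt; rewrite ?sz ?ltn_ord.
by rewrite subr_gt0 simplex_lt ?sz ?ltn_ord//; exact: (valP p).
Qed.

Lemma selberg_base_le1 v t : simplex t -> selberg_base v t <= 1.
Proof.
move=> st; case: v => [[i|i]|p] /=; first exact: simplex_le1.
  by rewrite gerBl ltW// simplex_gt0.
by rewrite (le_trans _ (simplex_le1 (val p).2 st))// gerBl ltW// simplex_gt0.
Qed.

Lemma logpoly_base v : logpoly N is_coordinate (selberg_base v).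
Proof.
case: v => [[i|i]|p] /=; first exact: logpoly_pos.
  by apply: logpolyB; [exact: logpoly1|exact: logpoly_pos].
by apply: logpolyB; exact: logpoly_pos.
Qed.

(** ln (t_j - t_i) = ln t_j + ln (1 - t_i/t_j), and 1 - t_i is the case t_j = 1. *)
Lemma logpoly_log v : logpoly N (fun=> True) (selberg_log v).
Proof.
have F f : logpoly N (fun=> True) (fun t => - factor_val t f).
  by apply: logpolyN; apply: logpoly_factor.
case: v => [[i|i]|p].
- by apply: logpoly_ext (F (FL i)) => t _ _ /=; rewrite opprK.
(* the coordinate of index N is 1 *)
- apply: logpoly_ext (F (FP i (N - i.+1))) => t sz _.
  by rewrite /selberg_log /factor_val /selberg_base opprK -addSn subnKC ?ltn_ord// {2}/pos
      nth_default ?sz// invr1 mulr1.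
- set i := (val p).1; set j := (val p).2; have ij : (i < j)%N := valP p.
  apply: logpoly_ext (logpolyD (F (FL j)) (F (FP i (j - i.+1)))) => t sz st.
  rewrite /selberg_log /factor_val /selberg_base !opprK -addSn subnKC// -lnM ?posrE
      ?simplex_gt0//; last first.
    by rewrite subr_gt0 ltr_pdivrMr ?simplex_gt0// mul1r simplex_lt ?sz ?ltn_ord.
  by rewrite mulrBr mulr1 mulrCA divff ?mulr1// gt_eqF// simplex_gt0.
Qed.

Lemma measurable_logpoly P h : logpoly N P h ->
  measurable_fun D (fun t : T => h t).
Proof.
by move=> /integral_logpoly[/integrableP[/measurable_EFinP + _] _].
Qed.

Lemma selberg_domain_finite : (mu D < +oo)%E.
Proof.
have mD := @measurable_Delta R N.
have [/integrableP[_ +] _] := integral_logpoly (logpoly1 R N xpredT).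
by rewrite (_ : (fun _ => _) = cst 1%E) ?integral_cst ?mul1e//; apply/funext => t; rewrite /=
    normr1.
Qed.

Lemma denominator_exp K t : size t = N -> simplex t ->
  expR (\sum_v (pole_bound K v)%:R * selberg_log v t) = denominator N t ^+ K.
Proof.
move=> sz st; rewrite expR_sum prod_selberg_var /denominator exprMn -!prodrXl.
congr (_ * _); apply: eq_bigr => i _; rewrite /selberg_log /= ?mul0r ?expR0 ?mulr1.
  by rewrite expRM_natl lnK// posrE; exact: (@selberg_base_gt0 (inl (inl i))).
by rewrite expRM_natl lnK// posrE; exact: (@selberg_base_gt0 (inr i)).
Qed.

Lemma cexp_natM (k : nat) (x : R) : cexp (k%:R * x%:C) = (expR x ^+ k)%:C.
Proof.
by rewrite -expRM_natl -cexp_real rmorphM rmorph_nat.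
Qed.

Variables (f : ratfun N) (K : nat) (v g : seq R -> R).
Hypothesis g_poly : logpoly N is_coordinate g.
Hypothesis f_value : forall t : N.-tuple R, simplex t -> ratfun_value f t (v t).
Hypothesis vg : forall t, size t = N -> simplex t -> v t * denominator N t ^+ K = g t.

Let A w : R := (pole_bound K w)%:R.
Let vT (t : T) : R := v t.
Let logT w (t : T) : R := selberg_log w t.

Lemma selberg_integrandE s (t : T) : D t ->
  selberg_integrand f s t =
  laplace_integrand vT logT [ffun=> 0%N] s t.
Proof.
move=> Dt; rewrite /laplace_integrand /laplace_coef /laplace_exponent cexp_sum.
rewrite [\prod_w _ ^+ _]big1 ?mulr1 => [|w _]; last by rewrite ffunE expr0.
rewrite prod_selberg_var /selberg_integrand (ratfun_evalE (f_value Dt)) mulrA.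
have posE (i : 'I_N) : tnth t i = pos t i by rewrite (tnth_nth 1).
congr (_ * _ * _); apply: eq_bigr => i _; rewrite /cpow !posE //.
Qed.

Lemma selberg_regionE : selberg_region (fun i => A (inl (inl i)))
  (fun i => A (inl (inr i))) (fun p => A (inr p)) = laplace_region A.
Proof.
apply/seteqP; split => s; first by move=> [ha hb hc] [[i|i]|p].
by move=> h; split => i; exact: h.
Qed.

(** The inverse of the denominator is written as an exponential of logarithms. *)
Lemma measurable_ratfun_value :
  measurable_fun D (fun t : T => v t).
Proof.
have mD := @measurable_Delta R N.
apply: (eq_measurable_fun (fun t : T =>
    g t * expR (- \sum_w A w * selberg_log w t))).
  move=> t; rewrite inE => Dt.
  have sz : size t = N := size_tuple t.
  rewrite expRN denominator_exp// -vg// mulfK// expf_neq0//.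
  by rewrite gt_eqF// denominator_gt0.
apply: measurable_funM; first exact: measurable_logpoly g_poly.
apply: measurableT_comp (@measurable_expR R) _; apply: measurable_funN.
apply: measurable_sum => w; apply: measurable_funM; first exact: measurable_cst.
exact: measurable_logpoly (logpoly_log w).
Qed.

(** At an integral point the exponents exceed the orders of the poles of f by natural
    numbers, so that only polynomials and logarithms are left. *)
Lemma taylor_integrand (m : {ffun V -> nat}) s (k : V -> nat) :
  (forall w, ccoord s w = (pole_bound K w + k w)%:R) ->
  exists2 h, logpoly N (fun=> True) h & forall t : T, D t ->
    laplace_integrand vT logT m s t = (h t)%:C.
Proof.
move=> hs.
exists (fun t => g t * \prod_w selberg_log w t ^+ m w * \prod_w selberg_base w t ^+ k w).
  apply: logpolyM; last first.
    by apply: logpoly_prod => w; apply: logpolyX; exact/logpoly_coordinate/logpoly_base.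
  apply: logpolyM; first exact: logpoly_coordinate.
  by apply: logpoly_prod => w; apply: logpolyX; exact: logpoly_log.
move=> t Dt; have sz : size t = N := size_tuple t.
rewrite /laplace_integrand /laplace_coef /laplace_exponent cexp_sum /vT /logT.
rewrite -vg// -(denominator_exp K sz Dt) expR_sum.
rewrite (eq_bigr (fun w => (expR ((pole_bound K w)%:R * selberg_log w t) * selberg_base w t ^+ k
    w)%:C)); last first.
  move=> w _; rewrite hs cexp_natM exprD expRM_natl; congr ((_ * _ ^+ _)%:C).
  by rewrite lnK// posrE selberg_base_gt0.
by rewrite -rmorph_prod big_split /= -rmorphM; congr (_%:C); ring.
Qed.

End SelbergLaplace.

Theorem theorem1p3 (R : realType) (N : nat) (hN : (1 <= N)%N)
    (f : ratfun N) (hf : selberg_ring f) :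
  exists (A B : 'I_N -> R) (G : ord_pair N -> R),
    [/\ forall s, selberg_region A B G s ->
          cintegrable (lebesgue_tuple R N) (selberg_domain R N)
            (selberg_integrand f s),
        holomorphic_on (selberg_region A B G) (selberg_integral f)
      & forall a, selberg_region A B G a -> integral_point a ->
          forall m, mzv_combination (taylor_coef (selberg_integral f) a m)].
Proof.
have [K [v [g [g_poly f_value vg]]]] := selberg_ring_value R hf.
pose A (w : selberg_var N) : R := (@pole_bound N K w)%:R.
exists (fun i => A (inl (inl i))), (fun i => A (inl (inr i))), (fun p => A (inr p)).
have -> := selberg_regionE R N K.
pose vt (t : N.-tuple (measurableTypeR R)) : R := v t.
pose lt (w : selberg_var N) (t : N.-tuple (measurableTypeR R)) : R := selberg_log w t.
have mD := @measurable_Delta R N.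
have muD := selberg_domain_finite R N.
have mv : measurable_fun (selberg_domain R N) vt by exact: measurable_ratfun_value g_poly vg.
have ml w : measurable_fun (selberg_domain R N) (lt w).
  exact: measurable_logpoly (logpoly_log R w).
have l0 w t : selberg_domain R N t -> lt w t <= 0.
  move=> Dt; rewrite -(@ln1 R) ler_ln ?posrE ?ltr01 ?selberg_base_le1//.
  by rewrite selberg_base_gt0// size_tuple.
have [M _ hM] := logpoly_bounded g_poly.
have bound t : selberg_domain R N t -> `|vt t| * expR (\sum_w A w * lt w t) <= M.
  move=> Dt; have sz : size t = N := size_tuple t.
  have d0 : 0 <= denominator N t ^+ K by rewrite exprn_ge0// ltW// denominator_gt0.
  by rewrite denominator_exp// -[X in _ * X]ger0_norm// -normrM /vt (vg _ sz Dt) hM.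
have FE s : selberg_integral f s =
    laplace (lebesgue_tuple R N) (selberg_domain R N) vt lt [ffun=> 0%N] s.
  by apply: eq_cintegral => t Dt; exact: selberg_integrandE f_value _ _ Dt.
split.
- move=> s hs.
  have I := integrable_laplace mD muD mv ml l0 bound [ffun=> 0%N] hs.
  apply: (eq_cintegrable mD _ I) => t Dt.
  by rewrite (selberg_integrandE f_value).
- split=> [|s hs]; first exact: laplace_open.
  have [df _] := differentiable_laplace mD muD mv ml l0 bound [ffun=> 0%N] hs.
  have /funext -> := FE; exact: df.
move=> a ha /choice[z hz] m.
have zA w : (pole_bound K w)%:Z <= z w.
  have := ha w; rewrite hz /A (_ : Re _ = (z w)%:~R) => [/ltW|].
    by rewrite -(ler_int R) -pmulrn.
  by rewrite -[in LHS](rmorph_int (real_complex R)).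
have hk w : ccoord a w = (pole_bound K w + `|z w - (pole_bound K w)%:Z|)%:R.
  rewrite hz pmulrn PoszD gez0_abs ?subr_ge0//.
  by rewrite addrCA subrr addr0.
have [h h_poly hE] := taylor_integrand g_poly vg m hk.
have [_ [c cadm cE]] := integral_logpoly h_poly.
rewrite /taylor_coef (mpartial_laplace mD muD mv ml l0 bound m (fun s _ => FE s) ha).
have -> : laplace (lebesgue_tuple R N) (selberg_domain R N) vt lt m a =
    (\int[lebesgue_tuple R N]_(t in selberg_domain R N) h t)%:C.
  rewrite /laplace (eq_cintegral _ hE) /cintegral /=.
  by rewrite [X in _ +i* X]Rintegral_cst// mul0r.
rewrite -(rmorph_nat (real_complex R)) -fmorphV -rmorphM.
have : mzv_span (ratr ((\prod_w (m w)`!)%:R^-1) * \int[lebesgue_tuple R N]_(t in selberg_domain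
    R N) h t).
  by apply: mzv_spanZ; exists c.
move=> [c' c'adm c'E]; exists c' => //.
by rewrite -c'E fmorphV rmorph_nat mulrC.
Qed.
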